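(* Let $\xi<\omega_1$. (1) Any normalized block sequence in $X_\xi$ contains a subsequence $(x_i)_{i=1}^\infty$ such that for some normalized block sequence $(x_i^* )_{i=1}^\infty\subset X_\xi^*$ and some $\varrho\in R(\xi)$, $((x_i)_{i=1}^\infty,(x_i^* )_{i=1}^\infty)$ is a $\varrho$-Schreier pair. (2) Any normalized block sequence in $X_\xi^*$ contains a subsequence $(x_i^* )_{i=1}^\infty$ such that for some normalized block sequence $(x_i)_{i=1}^\infty\subset X_\xi$ and some $\varrho\in R(\xi)$, $((x_i)_{i=1}^\infty,(x_i^* )_{i=1}^\infty)$ is a $\varrho$-Schreier pair.
   Context: Notation. $\mathbb N=\{1,2,\dots\}$; $[\mathbb N]^{<\omega}$ and $[\mathbb N]$ are the sets of finite, resp. infinite, subsets of $\mathbb N$. $\max\varnothing=0$, $\min\varnothing=\infty$; $E<F$ means $\max E<\min F$, and $n\leqslant E$ means $n\leqslant\min E$. $\omega_1$ is the first uncountable ordinal. For ordinals $\iota\leqslant\xi$, $\xi-\iota$ is the unique ordinal $\varrho$ with $\iota+\varrho=\xi$, and $R(\xi)=\{\xi-\iota:\iota\leqslant\xi\}$ (a finite set). Schreier families. $\mathcal S_0=\{\varnothing\}\cup\{\{n\}:n\in\mathbb N\}$; $\mathcal S_{\xi+1}=\{\varnothing\}\cup\{\bigcup_{i=1}^kE_i: k\leqslant E_1<\dots<E_k,\ \varnothing\ne E_i\in\mathcal S_\xi\}$; for a countable limit ordinal $\xi$ one fixes once and for all a sequence $\xi_n\uparrow\xi$ with $\mathcal S_{\xi_n+1}\subset\mathcal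 S_{\xi_{n+1}}$ for all $n$, and $\mathcal S_\xi=\{\varnothing\}\cup\{E\ne\varnothing:\exists n\leqslant E,\ E\in\mathcal S_{\xi_n+1}\}$. Schreier spaces. The scalar field $\mathbb K$ is $\mathbb R$ or $\mathbb C$. $c_{00}$ is the space of finitely nonzero scalar sequences, $(e_i)$ its canonical basis. $X_\xi$ is the completion of $c_{00}$ under $\|x\|_\xi=\sup_{E\in\mathcal S_\xi}\|Ex\|_{\ell_1}$, where $Ex$ is the coordinate restriction of $x$ to $E$. $(e_i^\xi)$ denotes the canonical basis of $X_\xi$ and $(f_i^\xi)\subset X_\xi^*$ its coordinate functionals, which form a basis of $X_\xi^*$ (the canonical basis of $X^*_\xi$). A block sequence in $X_\xi$ (resp. $X_\xi^*$) is a sequence of nonzero finitely supported vectors with successive supports with respect to $(e_i^\xi)$ (resp. $(f_i^\xi)$). $|x|$, $|x^*|$ denote coordinatewise moduli with respect to these bases. $\approx$ denotes equivalence of basic sequences. $(x\otimes x^* )(y)=x^*(y)x$. A pair of normalized block sequences $(x_i)\subset X_\xi$, $(x_i^* )\subset X_\xi^*$ is a $\varrho$-Schreier pair ($\varrho<\omega_1$) if for some $J\in[\mathbb N]$: (i) $x_i^*(x_j)=0$ for $i\neq j$; (ii) $\mathrm{Re}\,x_i^*(x_i)=|x_i^*|(|x_i|)$ for all $i$; (iii) $\inf_i\mathrm{Re}\,x_i^*(x_i)>0$; (iv) $(x_i)_{i=1}^\infty\approx(e_i^\varrho)_{i\in J}$; (v) $(x_i^* )_{i=1}^\infty\approx(f_i^\varrho)_{i\in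 J}$; (vi) $\sup_n\|\sum_{i=1}^nx_i\otimes x_i^*\|<\infty$. *)

(* Defs.v *)
From HB Require Import structures.
From mathcomp Require Import all_boot all_order all_algebra finmap complex.
From mathcomp Require Import all_classical all_reals all_analysis.
From mathcomp Require wochoice.
Import numFieldNormedType.Exports.

Set Implicit Arguments.
Unset Strict Implicit.
Unset Printing Implicit Defensive.

Import Order.TTheory GRing.Theory Num.Theory.
Local Open Scope classical_set_scope.
Local Open Scope ring_scope.

(** [omega1] consists of the points with countably many predecessors in a
    well-order of [set nat].  As [set nat] is uncountable, this is a well-ordered
    uncountable set all of whose proper initial segments are countable
    ([omega1_min], [omega1_countable], [omega1_uncountable]), that is, a copy
    of the first uncountable ordinal. *)

Definition wo_set_nat : rel (set nat) :=
  sval (wochoice.well_ordering_principle (set nat)).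

Lemma wo_set_natP : wochoice.well_order wo_set_nat.
Proof. exact: (svalP (wochoice.well_ordering_principle (set nat))). Qed.

Definition omega1 : Type :=
  {x : set nat | `[< countable [set y | wo_set_nat y x] >]}.

HB.instance Definition _ := Choice.on omega1.

Definition ole (a b : omega1) : bool := wo_set_nat (val a) (val b).

Lemma wo_min (A : set (set nat)) : A !=set0 ->
  exists x, A x /\ forall y, A y -> wo_set_nat x y.
Proof.
move=> [x Ax].
have [|z [[Az lbz] _]] := wo_set_natP (A := mem A).
  by exists x; rewrite !inE.
exists z; split; first by rewrite !inE in Az.
by move=> y Ay; apply: lbz; rewrite !inE.
Qed.

Lemma wo_total : total wo_set_nat.
Proof.
move=> x y; have [|z [[->|->] zmin]] := @wo_min [set z | z = x \/ z = y].
- by exists x; left.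
- by rewrite (zmin y) //; right.
- by rewrite (zmin x) ?orbT //; left.
Qed.

Lemma wo_refl : reflexive wo_set_nat.
Proof. by move=> x; have := wo_total x x; rewrite orbb. Qed.

Lemma wo_anti : antisymmetric wo_set_nat.
Proof.
move=> x y /andP[xy yx].
have [|z [_ uz]] := wo_set_natP (A := mem [set z | z = x \/ z = y]).
  by exists x; rewrite !inE; left.
have minE u : u = x \/ u = y -> wo_set_nat u x -> wo_set_nat u y -> z = u.
  move=> uxy ux uy; apply: uz; split; first by rewrite !inE.
  by move=> w; rewrite !inE => -[] ->.
by rewrite -(minE x (or_introl erefl) (wo_refl x) xy)
           -(minE y (or_intror erefl) yx (wo_refl y)).
Qed.

Lemma wo_trans : transitive wo_set_nat.
Proof.
move=> y x z xy yz.
have [|m [mxyz mmin]] := @wo_min [set w | [\/ w = x, w = y | w = z]].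
  by exists x; constructor 1.
have mx : wo_set_nat m x by apply: mmin; constructor 1.
have my : wo_set_nat m y by apply: mmin; constructor 2.
have mz : wo_set_nat m z by apply: mmin; constructor 3.
case: mxyz => E; rewrite {}E in mx my mz.
- exact: mz.
- by rewrite (_ : x = y) //; apply: wo_anti; rewrite xy mx.
- by rewrite (_ : y = z) in xy *; rewrite ?xy //; apply: wo_anti; rewrite yz my.
Qed.

Lemma ole_refl : reflexive ole. Proof. by move=> a; exact: wo_refl. Qed.
Lemma ole_anti : antisymmetric ole.
Proof. by move=> a b /wo_anti/val_inj. Qed.
Lemma ole_trans : transitive ole.
Proof. by move=> b a c; exact: wo_trans. Qed.
Lemma ole_total : total ole. Proof. by move=> a b; exact: wo_total. Qed.

Fact omega1_display : Order.disp_t. Proof. exact: Order.Disp tt tt. Qed.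

HB.instance Definition _ := Order.Le_isPOrder.Build omega1_display omega1
  ole_refl ole_anti ole_trans.
HB.instance Definition _ :=
  Order.POrder_isTotal.Build omega1_display omega1 ole_total.

Lemma omega1_min (A : set omega1) : A !=set0 ->
  exists a, A a /\ forall b, A b -> (a <= b)%O.
Proof.
move=> [a Aa]; have [|x [[b Ab <-] xmin]] := @wo_min (val @` A).
  by exists (val a), a.
by exists b; split => // c Ac; apply: xmin; exists c.
Qed.

Lemma omega1_countable (a : omega1) : countable [set b : omega1 | (b <= a)%O].
Proof.
have /asboolP/countable_injP[f finj] := valP a.
apply/countable_injP; exists (f \o val) => b c; rewrite !inE => ba ca fbc.
by apply/val_inj/finj; rewrite ?inE.
Qed.

Lemma set_nat_uncountable : ~ countable [set: set nat].
Proof.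
move=> /countable_injP[f finj].
pose D : set nat := [set n | exists S : set nat, f S = n /\ ~ S n].
have nD : ~ D (f D).
  move=> DfD; have [S [fSD nS]] := DfD.
  have SD : S = D by apply: finj; rewrite ?inE.
  by apply: nS; rewrite SD.
by apply: (nD); exists D.
Qed.

Lemma omega1_uncountable : ~ countable [set: omega1].
Proof.
move=> c1; pose A : set (set nat) := range (val : omega1 -> set nat).
have cA : countable A by apply: sub_countable c1; exact: card_image_le.
have [|m [nAm mmin]] := @wo_min (~` A).
  apply: contrapT => /set0P/negP; rewrite negbK => /eqP A0.
  by apply: set_nat_uncountable; rewrite -[setT]setC0 -A0 setCK.
apply: nAm; have cm : `[< countable [set y | wo_set_nat y m] >].
  apply/asboolP; apply: (@sub_countable _ _ _ (A `|` [set m])).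
    apply: subset_card_le => y /= ym.
    have [Ay|nAy] := pselect (A y); first by left.
    by right; apply: wo_anti; rewrite ym mmin.
  have -> : A `|` [set m] = \bigcup_(b in [set: bool]) (if b then A else [set m]).
    rewrite eqEsubset; split => y; last by move=> [[] _ /=]; [left|right].
    by move=> [Ay|ym]; [exists true|exists false].
  by apply: bigcup_countable => // -[].
by exists (exist _ m cm).
Qed.

Definition osucc (a : omega1) : omega1 :=
  xget a [set b | (a < b)%O /\ forall c, (a < c)%O -> (b <= c)%O].

Lemma osuccP (a : omega1) :
  (a < osucc a)%O /\ forall c, (a < c)%O -> (osucc a <= c)%O.
Proof.
rewrite /osucc; case: xgetP => [b _ //|none]; exfalso.
have [b [ab bmin]] : exists b, (a < b)%O /\ forall c, (a < c)%O -> (b <= c)%O.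
  apply: omega1_min; apply: contrapT => nab; apply: omega1_uncountable.
  apply: sub_countable (omega1_countable a); apply: subset_card_le => b _ /=.
  by rewrite leNgt; apply/negP => ab; apply: nab; exists b.
exact: (none b).
Qed.

Definition is_ozero (a : omega1) : Prop := forall b, (a <= b)%O.

Definition is_olimit (a : omega1) : Prop :=
  ~ is_ozero a /\ forall b, a <> osucc b.

Definition is_osup (A : set omega1) (a : omega1) : Prop :=
  (forall b, A b -> (b <= a)%O) /\
  forall c, (forall b, A b -> (b <= c)%O) -> (a <= c)%O.

(** [oadd a b c] is the graph [a + b = c] of ordinal addition, by the usual
    transfinite recursion on [b]. *)
Inductive oadd (a : omega1) : omega1 -> omega1 -> Prop :=
| oadd0 z of is_ozero z : oadd a z a
| oaddS b c of oadd a b c : oadd a (osucc b) (osucc c)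
| oadd_lim b c (g : omega1 -> omega1) of
    is_olimit b &
    (forall d, (d < b)%O -> oadd a d (g d)) &
    is_osup [set g d | d in [set d | (d < b)%O]] c : oadd a b c.

(** The set [R(xi)] of all [xi - iota] with [iota <= xi]. *)
Definition remainders (xi : omega1) : set omega1 :=
  [set rho | exists iota, (iota <= xi)%O /\ oadd iota rho xi].

(** Throughout, [i : nat] stands for the positive integer [i.+1].  Hence, for
    [i] the code of a member of [E], the condition [k <= E] reads [k <= i.+1],
    and if [n] is itself the code of a positive integer, [n <= E] reads
    [n <= i]. *)

Definition fset_lt (E F : {fset nat}) : bool :=
  all (fun i => all (fun j => i < j)%N F) E.

(** [fs xi n] is the term of index [n.+1] of the sequence chosen for the limit
    ordinal [xi]. *)
Inductive Schreier (fs : omega1 -> nat -> omega1) :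
    omega1 -> {fset nat} -> Prop :=
| Schreier_empty xi : Schreier fs xi fset0
| Schreier0 xi n of is_ozero xi : Schreier fs xi [fset n]%fset
| SchreierS xi (s : seq {fset nat}) of
    (forall E, E \in s -> E <> fset0) &
    (forall E, E \in s -> Schreier fs xi E) &
    sorted fset_lt s &
    (forall i, i \in head fset0 s -> size s <= i.+1)%N :
    Schreier fs (osucc xi) (\bigcup_(E <- s) E)%fset
| Schreier_lim xi n E of
    is_olimit xi &
    (forall i, i \in E -> n <= i)%N &
    Schreier fs (osucc (fs xi n)) E :
    Schreier fs xi E.

Definition fundamental_system (fs : omega1 -> nat -> omega1) : Prop :=
  forall xi, is_olimit xi ->
  [/\ forall n, (fs xi n < fs xi n.+1)%O,
      is_osup (range (fs xi)) xi &
      forall n, Schreier fs (osucc (fs xi n)) `<=` Schreier fs (fs xi n.+1)].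

Inductive scalar_kind := RealScalars | ComplexScalars.

Definition scalars (R : realType) (k : scalar_kind) : numFieldType :=
  match k with
  | RealScalars => R : numFieldType
  | ComplexScalars => R[i] : numFieldType
  end.

Definition scalar_re (R : realType) (k : scalar_kind) : scalars R k -> R :=
  match k with RealScalars => id | ComplexScalars => @complex.Re R end.

(** The norm of a normed space over [K] is [K]-valued; its values are real,
    and [rnorm] is the same norm as an element of [R]. *)
Definition rnorm (R : realType) (k : scalar_kind)
    (V : normedModType (scalars R k)) (v : V) : R := scalar_re `|v|.

Definition opnorm (R : realType) (k : scalar_kind)
    (V W : normedModType (scalars R k)) (T : V -> W) : R :=
  sup [set rnorm (T v) | v in [set v | rnorm v <= 1]].

Section c00.
Variable K : numFieldType.

Definition finitely_nonzero : {pred nat -> K^o} :=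
  fun x => `[< finite_set [set i | x i != 0] >].

Lemma finitely_nonzero_submod : submod_closed finitely_nonzero.
Proof.
split=> [|a x y /asboolP fx /asboolP fy]; apply/asboolP.
  by rewrite (_ : [set _ | _] = set0) // -subset0 => i /=; rewrite eqxx.
have : finite_set ([set i | x i != 0] `|` [set i | y i != 0]).
  by rewrite finite_setU.
apply: sub_finite_set => i /= axy; apply: contrapT => /not_orP[].
move=> /negP/negPn/eqP xi0 /negP/negPn/eqP yi0; move/eqP: axy; apply.
by rewrite addrfctE scalrfctE xi0 yi0 scaler0 addr0.
Qed.

HB.instance Definition _ :=
  GRing.isSubmodClosed.Build K (nat -> K^o) finitely_nonzero
    finitely_nonzero_submod.

Record c00 := C00 { c00_seq :> nat -> K^o; _ : c00_seq \in finitely_nonzero }.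

HB.instance Definition _ := [isSub for c00_seq].
HB.instance Definition _ := [Choice of c00 by <:].
HB.instance Definition _ := [SubChoice_isSubLmodule of c00 by <:].

Definition support (c : c00) : set nat := [set j | c j != 0].

Lemma unit_seq_finitely_nonzero (j : nat) :
  (fun i => (i == j)%:R) \in finitely_nonzero.
Proof.
apply/asboolP; apply: (@sub_finite_set _ _ [set j]) => // i /=.
case: (eqVneq i j) => [->|_] // /negP[]; exact/eqP.
Qed.

Definition c00_unit (j : nat) : c00 := C00 (unit_seq_finitely_nonzero j).

End c00.

Section dual.
Variables (K : numFieldType) (X : normedModType K).

Definition continuous_functional : {pred X -> K^o} :=
  fun f => `[< linear f /\ continuous f >].

Lemma continuous_functional_submod : submod_closed continuous_functional.
Proof.
split=> [|a f g /asboolP[lf cf] /asboolP[lg cg]]; apply/asboolP.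
  split; last exact: cst_continuous.
  by move=> a x y /=; rewrite scaler0 addr0.
split=> [b x y|x].
  rewrite !addrfctE !scalrfctE lf lg !scalerDr !scalerA (mulrC a b).
  by rewrite addrACA.
apply: continuousD; last exact: cg.
by apply: continuousZl_tmp; exact: cf.
Qed.

HB.instance Definition _ :=
  GRing.isSubmodClosed.Build K (X -> K^o) continuous_functional
    continuous_functional_submod.

Record dual :=
  Dual { dual_fun :> X -> K^o; _ : dual_fun \in continuous_functional }.

HB.instance Definition _ := [isSub for dual_fun].
HB.instance Definition _ := [Choice of dual by <:].
HB.instance Definition _ := [SubChoice_isSubLmodule of dual by <:].

End dual.

Section blocks.
Variables (K : numFieldType) (V : lmodType K) (b : nat -> V).

Definition combination (c : c00 K) : V := \sum_(j \in support c) c j *: b j.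

Definition successive (c d : c00 K) : Prop :=
  forall i j, support c i -> support d j -> (i < j)%N.

Definition block_sequence (x : nat -> V) : Prop :=
  (forall n, x n <> 0) /\
  exists c : nat -> c00 K, (forall n, x n = combination (c n)) /\
                           forall n, successive (c n) (c n.+1).

(** When [b] is linearly independent, [coefficients x] are the coordinates of
    the finitely supported vector [x]; they are used for such [x] only. *)
Definition coefficients (x : V) : c00 K :=
  xget 0 [set c | combination c = x].

Definition modulus (x : V) : V :=
  \sum_(j \in support (coefficients x)) `|coefficients x j| *: b j.

End blocks.

Definition equivalent (R : realType) (K : numFieldType) (U V : lmodType K)
    (NU : U -> R) (NV : V -> R) (u : nat -> U) (v : nat -> V) : Prop :=
  exists2 C : R, 0 < C & forall n (a : nat -> K),
    NU (\sum_(i < n) a i *: u i) <= C * NV (\sum_(i < n) a i *: v i) /\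
    NV (\sum_(i < n) a i *: v i) <= C * NU (\sum_(i < n) a i *: u i).

(** A completion of [V] under the norm [N]: a Banach space with a linear
    isometric embedding of [V] onto a dense subspace.  It is unique up to
    isometric isomorphism. *)
Record completion (R : realType) (k : scalar_kind) (V : lmodType (scalars R k))
    (N : V -> R) := Completion {
  completion_space :> completeNormedModType (scalars R k);
  embed : {linear V -> completion_space};
  embed_isometric : forall v, rnorm (embed v) = N v;
  embed_dense : dense (range embed) }.

Definition schreier_norm (R : realType) (k : scalar_kind)
    (fs : omega1 -> nat -> omega1) (xi : omega1) (x : c00 (scalars R k)) : R :=
  sup [set \sum_(i <- E) rnorm (x i) | E in Schreier fs xi].

Section schreier_space.
Variables (R : realType) (k : scalar_kind) (fs : omega1 -> nat -> omega1).
Variable xi : omega1.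
Variable X : completion (@schreier_norm R k fs xi).

Definition basis (j : nat) : X := embed X (c00_unit _ j).

(** The functional biorthogonal to [basis]; it is unique because the span of
    [basis] is dense. *)
Definition coordinate (j : nat) : dual X :=
  xget 0 [set f : dual X | forall i, f (basis i) = (i == j)%:R].

Definition normalized_block (x : nat -> X) : Prop :=
  (forall n, rnorm (x n) = 1) /\ block_sequence basis x.

Definition normalized_dual_block (f : nat -> dual X) : Prop :=
  (forall n, opnorm (f n) = 1) /\ block_sequence coordinate f.

Definition rank_one (x : X) (f : dual X) : X -> X := fun y => f y *: x.

End schreier_space.

(** The infinite set [J] is given by its increasing enumeration.  In the second
    clause the right-hand side is a nonnegative real scalar, so that taking its
    real part only changes its type. *)
Definition schreier_pair (R : realType) (k : scalar_kind)
    (fs : omega1 -> nat -> omega1)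
    (X : forall xi, completion (@schreier_norm R k fs xi)) (xi rho : omega1)
    (x : nat -> X xi) (f : nat -> dual (X xi)) : Prop :=
  normalized_block x /\ normalized_dual_block f /\
  exists J : nat -> nat, {homo J : m n / (m < n)%N} /\
  [/\ forall i j, i <> j -> f i (x j) = 0,
      forall i, scalar_re (f i (x i)) =
        scalar_re (modulus (@coordinate _ _ _ _ (X xi)) (f i)
                           (modulus (@basis _ _ _ _ (X xi)) (x i))),
      0 < inf (range (fun i => scalar_re (f i (x i)))) &
      [/\ equivalent (@rnorm _ _ _) (@rnorm _ _ _)
            x (fun i => basis (X rho) (J i)),
          equivalent (fun g : dual (X xi) => opnorm g)
            (fun g : dual (X rho) => opnorm g)
            f (fun i => coordinate (X rho) (J i)) &
          has_ubound (range (fun n =>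
            opnorm (\sum_(i < n) rank_one (x i) (f i))))]].

(* Main.v *)
(** Write [xi = iota + rho].  Up to moving sets far out, a set of the Schreier
    family [xi] is a [rho]-indexed union of successive sets of the family [iota].
    Both estimates of a Schreier pair are reduced to inequalities between sums of
    nonnegative weights: ([upper]) combinations of the [x i] are dominated in [X xi]
    by combinations of unit vectors [e (J i)] of [X rho], and ([lower])
    [y |-> sum_i f i y * e (J i)] is bounded from [X xi] to [X rho].  With
    biorthogonality they give both equivalences and the bound on the projections.

    [upper] holds for a subsequence as soon as the norms of the [x i] tend to [0]
    for every index below [iota].  In (1), [iota] is the least index whose norm does
    not tend to [0], and [f i] is supported on a set of the family [iota] that
    carries a fixed part of the mass of [x i].

    In (2), call [zeta] tested if some subsequence of the functionals is bounded
    below on vectors of norm at most one whose norms of index below [zeta] tend to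
    [0].  If [xi] is tested then [rho = 0] works.  Otherwise let [kappa] be the least
    index that is not tested; the remainders [xi - eta], [eta < kappa], are
    nonincreasing in [eta], hence equal to a fixed [rho] for [eta] in some interval
    from [iota] to [kappa].  As [kappa] is not tested, for every [n] vectors that are
    small for some such index [eta n] are almost annihilated, up to [2 ^- n], so the
    functionals split into series with geometric coefficients, whose [n]-th term is
    controlled by unions of boundedly many sets of the family [eta n]; since
    [eta n + rho = xi] and [rho <> 0], each term satisfies [lower].  The unions are
    not successive, which is why the families have to be shown [mergeable]. *)

Require Import Defs.
From mathcomp Require Import all_boot all_order all_algebra finmap complex.
From mathcomp Require Import all_classical all_reals all_analysis.
From mathcomp Require Import zify lra.
Import numFieldNormedType.Exports.

Set Implicit Arguments.
Unset Strict Implicit.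
Unset Printing Implicit Defensive.

Import Order.TTheory GRing.Theory Num.Theory.
Local Open Scope classical_set_scope.
Local Open Scope ring_scope.

(** * Countable ordinals and remainders *)

(** The sequences fixed at different limit ordinals are unrelated, so no exact identity links the
    families of index [iota], [rho] and [iota + rho]. Splitting a set ([Schreier_decompose]) and
    assembling one ([Schreier_compose]) work only up to reindexing functions [phi] and [psi], which
    pull in opposite directions: the upper estimate wants [J i] large compared with the end of the
    preceding block, the lower estimate wants block [i] far out compared with [J i]. Choosing [J i]
    and block [i] alternately satisfies both with one [J].

    In (2) no single set need carry a fixed part of a functional, so each block contributes unions
    of [m] sets, with [m] growing along the series. The step from [iota] to [iota + 1] absorbs the
    factor [m] by starting later; for [rho = 0] there is no such step, whence the condition that
    [m = 1] or [rho] is nonzero, and the separate treatment of the case where [xi] is tested. The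
    remainder has to be constant on an interval because all terms of the series must be summed
    against the same sets of the family [rho], coded by the same [J]. *)

Lemma omega1_ind (P : omega1 -> Prop) :
  (forall a, (forall b, (b < a)%O -> P b) -> P a) -> forall a, P a.
Proof.
move=> step a; apply: contrapT => nPa.
have [|b [nPb bmin]] := @omega1_min [set b | ~ P b]; first by exists a.
apply: nPb; apply: step => c cb; apply: contrapT => /bmin.
by rewrite leNgt cb.
Qed.

Lemma osucc_gt (a : omega1) : (a < osucc a)%O.
Proof. by have [] := osuccP a. Qed.

Lemma osucc_le (a b : omega1) : (osucc a <= b)%O = (a < b)%O.
Proof.
have [ab amin] := osuccP a; apply/idP/idP; last exact: amin.
exact: lt_le_trans.
Qed.

Lemma lt_osucc (a b : omega1) : (a < osucc b)%O = (a <= b)%O.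
Proof. by rewrite !ltNge osucc_le -leNgt. Qed.

Lemma osucc_inj : injective osucc.
Proof. by move=> a b ab; apply/le_anti; rewrite -!lt_osucc -ab osucc_gt ab osucc_gt. Qed.

Lemma ozero_not_succ (a b : omega1) : is_ozero a -> a <> osucc b.
Proof. by move=> a0 ab; have := a0 b; rewrite ab osucc_le ltxx. Qed.

Lemma ozero_exists : exists a, is_ozero a.
Proof.
have [|a [_ amin]] := @omega1_min setT; last by exists a => b; apply: amin.
apply/set0P/eqP => T0; apply: omega1_uncountable.
by rewrite T0.
Qed.

Variant ordinal_kind (a : omega1) : Prop :=
| ZeroOrdinal of is_ozero a
| SuccOrdinal b of a = osucc b
| LimitOrdinal of is_olimit a.

Lemma ordinal_kindP (a : omega1) : ordinal_kind a.
Proof.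
have [a0|na0] := pselect (is_ozero a); first exact: ZeroOrdinal.
have [[b ab]|nab] := pselect (exists b, a = osucc b); first exact: SuccOrdinal ab.
by apply: LimitOrdinal; split => // b ab; apply: nab; exists b.
Qed.

Lemma olimit_succ (a b : omega1) : is_olimit a -> (b < a)%O -> (osucc b < a)%O.
Proof.
move=> [_ ns] ba; rewrite lt_neqAle osucc_le ba andbT.
by apply/eqP => ab; apply: (ns b).
Qed.

Lemma osup_gt (A : set omega1) a b : is_osup A a -> (b < a)%O ->
  exists2 c, A c & (b < c)%O.
Proof.
move=> [_ amin] ba; apply: contrapT => nA.
suff /amin : forall c, A c -> (c <= b)%O by rewrite leNgt ba.
by move=> c Ac; rewrite leNgt; apply/negP => bc; apply: nA; exists c.
Qed.

Lemma osup_uniq (A : set omega1) a b : is_osup A a -> is_osup A b -> a = b.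
Proof.
by move=> [ua la] [ub lb]; apply/le_anti; rewrite la //= lb.
Qed.

Lemma not_ozero_succ b : ~ is_ozero (osucc b).
Proof. by move=> /(_ b); rewrite osucc_le ltxx. Qed.

Variant oadd_spec (a b c : omega1) : Prop :=
| OaddZero of is_ozero b & c = a
| OaddSucc b' c' of b = osucc b' & c = osucc c' & oadd a b' c'
| OaddLimit g of is_olimit b & (forall d, (d < b)%O -> oadd a d (g d))
    & is_osup [set g d | d in [set d | (d < b)%O]] c.

Lemma oaddP a b c : oadd a b c -> oadd_spec a b c.
Proof.
case; first by move=> z z0; exact: OaddZero.
- by move=> b' c' h; exact: OaddSucc h.
- by move=> b' c' g h1 h2 h3; exact: OaddLimit h1 h2 h3.
Qed.

Lemma oadd_zero a b c : is_ozero b -> oadd a b c -> c = a.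
Proof.
move=> b0 /oaddP[//|b' c' E|g [] //]; by case: (ozero_not_succ b0 E).
Qed.

Lemma oadd_fun a b c c' : oadd a b c -> oadd a b c' -> c = c'.
Proof.
move=> h; elim: h c' => [z z0|b0 c0 _ IH|b0 c0 g lim _ IH sup] c'.
- by move=> /(oadd_zero z0).
- move=> /oaddP[/not_ozero_succ //|b' c1 /osucc_inj<- -> /IH-> //|g [_ ns]].
  by have := ns b0.
- move=> /oaddP[z0|b' c1 E|g' _ gh' sup'].
  + by case: lim.
  + by case: lim => _ /(_ b') [].
  + apply: osup_uniq sup _.
    rewrite (_ : [set _ | _ in _] = [set g' d | d in [set d | (d < b0)%O]]) //.
    by apply: eq_imagel => d /= db; apply: IH => //; apply: gh'.
Qed.

Lemma oadd_ge a b c : oadd a b c -> (a <= c)%O /\ (b <= c)%O.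
Proof.
elim=> [z z0|b0 c0 _ [ac bc]|b0 c0 g lim _ IH [ub lb]].
- by split => //; apply: z0.
- rewrite osucc_le lt_osucc; split => //.
  by apply: le_trans ac _; apply: ltW; apply: osucc_gt.
- have [z z0] := ozero_exists.
  have zb : (z < b0)%O.
    rewrite lt_neqAle z0 andbT; apply/eqP => E.
    by case: lim => + _; apply; rewrite -E.
  split.
    by apply: le_trans (IH _ zb).1 (ub _ _); exists z.
  rewrite leNgt; apply/negP => cb; have := IH _ (olimit_succ lim cb).
  case=> _; rewrite osucc_le ltNge => /negP; apply.
  by apply: ub; exists (osucc c0) => //=; apply: olimit_succ.
Qed.

Lemma oadd_below a b c : oadd a b c -> forall d, (d < b)%O ->
  exists2 c', (c' < c)%O & oadd a d c'.
Proof.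
elim=> [z z0|b0 c0 h IH|b0 c0 g lim h IH [ub lb]] d.
- by rewrite ltNge z0.
- rewrite lt_osucc le_eqVlt => /predU1P[->|/IH[c' c'c h']].
    by exists c0 => //; apply: osucc_gt.
  by exists c' => //; apply: lt_trans c'c (osucc_gt _).
- move=> db; exists (g d); last exact: h.
  have sdb := olimit_succ lim db.
  have -> : (g d < c0)%O = (osucc (g d) <= c0)%O by rewrite osucc_le.
  by apply: ub; exists (osucc d) => //; apply: oadd_fun (h _ sdb) (oaddS (h _ db)).
Qed.

Lemma oadd_lt a b b' c c' : oadd a b c -> oadd a b' c' -> (b < b')%O -> (c < c')%O.
Proof.
move=> h h' bb'; have [c1 c1c h1] := oadd_below h' bb'.
by rewrite (oadd_fun h h1).
Qed.

Lemma oadd_monol a a' b c c' : (a <= a')%O -> oadd a b c -> oadd a' b c' ->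
  (c <= c')%O.
Proof.
move=> aa' h; elim: h c' => [z z0|b0 c0 _ IH|b0 c0 g lim _ IH sup] c'.
- by move=> /(oadd_zero z0) ->.
- move=> /oaddP[/not_ozero_succ //|b' c1 /osucc_inj<- -> /IH|g [_ ns]].
    by rewrite osucc_le lt_osucc.
  by have := ns b0.
- move=> /oaddP[z0|b' c1 E|g' _ gh' [ub' _]].
  + by case: lim.
  + by case: lim => _ /(_ b') [].
  + case: sup => _; apply => _ [d db <-].
    apply: le_trans (IH d db _ (gh' _ db)) _.
    by apply: ub'; exists d.
Qed.

(** If [r < r'], then [i' + r < i' + r' = x] by strict monotonicity on the right, whereas
    [x = i + r <= i' + r] by weak monotonicity on the left. *)
Lemma remainder_anti i i' r r' x : (i <= i')%O -> oadd i r x -> oadd i' r' x ->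
  (r' <= r)%O.
Proof.
move=> ii' h h'; rewrite leNgt; apply/negP => rr'.
have [c cx h1] := oadd_below h' rr'.
by have := oadd_monol ii' h h1; rewrite leNgt cx.
Qed.

(** At a limit [x] the remainder is the least strict upper bound [b] of the remainders of the
    ordinals from [i] up to [x]. It is a limit since these remainders are closed under successor,
    and a bound [u < x] of the sums would be refuted by the remainder of an ordinal above [u]. *)
Lemma remainder_exists i x : (i <= x)%O -> exists r, oadd i r x.
Proof.
elim/omega1_ind: x => x IH; rewrite le_eqVlt => /predU1P[<-|ix].
  by have [z z0] := ozero_exists; exists z; apply: oadd0.
have [x0|y xy|lim] := ordinal_kindP x.
- by have := x0 i; rewrite leNgt ix.
- have [||r h] := IH y; first by rewrite xy osucc_gt.
    by rewrite -lt_osucc -xy.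
  by rewrite xy; exists (osucc r); apply: oaddS.
pose B : set omega1 := [set b | forall r c, (c < x)%O -> oadd i r c -> (r < b)%O].
have [|b [Bb bmin]] := @omega1_min B.
  by exists x => r c cx /oadd_ge[_ rc]; apply: le_lt_trans cx.
have below d : (d < b)%O -> exists2 c, (c < x)%O & oadd i d c.
  move=> db; have [r [c [cx h dr]]] : exists r c, [/\ (c < x)%O, oadd i r c & (d <= r)%O].
    apply: contrapT => nex; have /bmin : B d; last by rewrite leNgt db.
    move=> r c cx h; rewrite ltNge; apply/negP => dr; apply: nex.
    by exists r, c.
  move: dr; rewrite le_eqVlt => /predU1P[->|dr]; first by exists c.
  have [c' c'c h'] := oadd_below h dr.
  by exists c' => //; apply: lt_trans cx.
exists b.
have sx c : (c < x)%O -> (osucc c < x)%O by apply: olimit_succ.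
have limb : is_olimit b.
  split=> [b0|d bd].
    have [z z0] := ozero_exists.
    by have := Bb z i ix (oadd0 _ z0); rewrite ltNge b0.
  have [c cx h] : exists2 c, (c < x)%O & oadd i d c.
    by apply: below; rewrite bd osucc_gt.
  by have := Bb _ _ (sx _ cx) (oaddS h); rewrite bd ltxx.
pose g d := xget i [set c | (c < x)%O /\ oadd i d c].
have gP d : (d < b)%O -> (g d < x)%O /\ oadd i d (g d).
  move=> db; rewrite /g; case: xgetP => [c _ //|none].
  by have [c cx h] := below d db; case: (none c).
apply: (@oadd_lim _ _ _ g) => // [d /gP[] //|].
split=> [_ [d /gP[gx _] <-]|u uu]; first exact: ltW.
rewrite leNgt; apply/negP => ux.
pose v := Order.max i (osucc u).
have vx : (v < x)%O by rewrite gt_max ix sx.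
have iv : (i <= v)%O by rewrite le_max lexx.
have [r h] := IH v vx iv.
have rb := Bb _ _ vx h.
have : (g r <= u)%O by apply: uu; exists r.
rewrite (oadd_fun (gP _ rb).2 h) /v ge_max => /andP[_].
by rewrite osucc_le ltxx.
Qed.

Lemma oadd_limit a b c : is_olimit b -> oadd a b c -> is_olimit c.
Proof.
move=> lim h; have nb0 : ~ is_ozero b by case: lim.
have [z z0] := ozero_exists.
have zb : (z < b)%O.
  by rewrite lt_neqAle z0 andbT; apply/eqP => E; apply: nb0; rewrite -E.
split=> [c0|e ce].
  by have [c' + _] := oadd_below h zb; rewrite ltNge c0.
have [/nb0 //|b' ? E|g _ gh sup] := oaddP h; first by case: lim => _ /(_ b').
have [|_ [d db <-] ed] := osup_gt (b := e) sup; first by rewrite ce osucc_gt.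
have := oadd_lt (gh _ db) h db.
by rewrite ce lt_osucc leNgt ed.
Qed.

(** * Schreier families *)

Lemma fset_ltP (E F : {fset nat}) :
  reflect (forall i j, i \in E -> j \in F -> (i < j)%N) (fset_lt E F).
Proof.
apply: (iffP allP) => [h i j iE jF|h i iE].
  by have /allP := h i iE; apply.
by apply/allP => j; apply: h.
Qed.

Definition fcups (s : seq {fset nat}) : {fset nat} := (\bigcup_(E <- s) E)%fset.

Lemma in_fcups (s : seq {fset nat}) x : reflect (exists2 E, E \in s & x \in E) (x \in fcups s).
Proof.
apply: (iffP (bigfcupP _ _ _ _)) => [[E]|[E Es xE]].
  by rewrite andbT => Es xE; exists E.
by exists E => //; rewrite andbT.
Qed.

Lemma fcups_cat s t : fcups (s ++ t) = (fcups s `|` fcups t)%fset.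
Proof. by rewrite /fcups big_cat. Qed.

Lemma fcups_nil : fcups [::] = fset0.
Proof. by rewrite /fcups big_nil. Qed.

Lemma fcups_cons E s : fcups (E :: s) = (E `|` fcups s)%fset.
Proof. by rewrite /fcups big_cons. Qed.

Lemma fcups_filter (s : seq {fset nat}) :
  fcups [seq E <- s | E != fset0] = fcups s.
Proof.
apply/fsetP => x; apply/in_fcups/in_fcups => -[E].
  by rewrite mem_filter => /andP[_ Es] xE; exists E.
move=> Es xE; exists E => //; rewrite mem_filter Es andbT.
by apply/eqP => E0; rewrite E0 inE in xE.
Qed.

Lemma fset_minP (E : {fset nat}) : E != fset0 ->
  exists2 m, m \in E & forall x, x \in E -> (m <= x)%N.
Proof.
move=> /fset0Pn[x0 x0E].
have ex : exists m, m \in E by exists x0.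
by case: (ex_minnP ex) => m mE mmin; exists m.
Qed.

Lemma fset_maxP (E : {fset nat}) : E != fset0 ->
  exists2 m, m \in E & forall x, x \in E -> (x <= m)%N.
Proof.
move=> /fset0Pn[x0 x0E].
have ex : exists m, m \in E by exists x0.
have ub i : i \in E -> (i <= \max_(j <- E) j)%N.
  by move=> iE; apply: (@leq_bigmax_seq _ _ (fun _ => true) id).
by case: (ex_maxnP ex ub) => m mE mmax; exists m.
Qed.

Section Schreier_families.
Variable fs : omega1 -> nat -> omega1.
Hypothesis fsP : fundamental_system fs.
Local Notation S := (Schreier fs).

(** The relation [fset_lt] is not transitive through the empty set; an element of the middle set
    restores transitivity. *)
Lemma sorted_fset_lt_pairwise (s : seq {fset nat}) :
  (forall E, E \in s -> E <> fset0) -> sorted fset_lt s -> pairwise fset_lt s.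
Proof.
elim: s => // E s IH n0 /=; move=> Es; apply/andP; split; last first.
  by apply: IH => [F Fs|]; [apply: n0; rewrite inE Fs orbT|apply: path_sorted Es].
have {}n0 F : F \in s -> F <> fset0 by move=> Fs; apply: n0; rewrite inE Fs orbT.
elim: s E Es n0 {IH} => // F s IH E /= /andP[EF Fs] n0.
rewrite EF /=.
have /allP h : all (fset_lt F) s.
  by apply: IH => // G Gs; apply: n0; rewrite inE Gs orbT.
apply/allP => G Gs; apply/fset_ltP => i j iE jG.
have [k kF] : exists k, k \in F by apply/fset0Pn/eqP/n0; rewrite inE eqxx.
move/fset_ltP: EF => /(_ i k iE kF) /ltn_trans; apply.
by move/fset_ltP: (h G Gs); apply.
Qed.

Lemma fcups_head_size (s : seq {fset nat}) i :
  (forall E, E \in s -> E <> fset0) -> pairwise fset_lt s ->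
  (forall i, i \in head fset0 s -> size s <= i.+1)%N ->
  i \in fcups s -> (size s <= i.+1)%N.
Proof.
move=> n0 pw sz /in_fcups[F Fs iF].
case: s n0 sz Fs pw => // G s n0 sz.
rewrite inE => /predU1P[FG _|Fs /andP[/allP GF _]]; first by apply: sz; rewrite /= -FG.
have [k kG] : exists k, k \in G by apply/fset0Pn/eqP/n0; rewrite inE eqxx.
have ki : (k < i)%N by move/fset_ltP: (GF _ Fs); apply.
by apply: leq_trans (sz k kG) _; rewrite ltnS ltnW.
Qed.

Lemma Schreier_zero_inv x E : is_ozero x -> S x E ->
  E = fset0 \/ exists n, E = [fset n]%fset.
Proof.
move=> x0 h; case: h x0 => [||x' s _ _ _ _ /not_ozero_succ//|x' n E' [] //].
- by left.
- by move=> x' n _ _; right; exists n.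
Qed.

Lemma Schreier_succ_inv x E : S (osucc x) E ->
  exists s, [/\ E = fcups s, (forall F, F \in s -> F <> fset0),
    (forall F, F \in s -> S x F), pairwise fset_lt s &
    forall i, i \in E -> (size s <= i.+1)%N].
Proof.
move Ex: (osucc x) => x' h.
case: h Ex => [x1 _|x1 n x10 Ex|x1 s n0 sS srt sz /osucc_inj->|x1 n E' [_ ns] _ _ /esym Ex].
- by exists [::]; split; rewrite ?fcups_nil.
- by case: (ozero_not_succ x10 (esym Ex)).
- exists s; have pw := sorted_fset_lt_pairwise n0 srt; split => // i.
  exact: fcups_head_size.
- by case: (ns x).
Qed.

Lemma Schreier_limit_inv x E : is_olimit x -> S x E ->
  E = fset0 \/ exists n, (forall i, i \in E -> (n <= i)%N) /\ S (osucc (fs x n)) E.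
Proof.
move=> lim h; case: h lim => [|x' n x0 []//|x' s _ _ _ _ [_ /(_ x')] //|x' n E' _ nE h _].
- by left.
- by right; exists n.
Qed.

(** A form of the successor constructor that tolerates empty pieces: they are dropped, which only
    lowers the number of pieces. Constructions that cut or merge pieces can then ignore
    emptiness. *)
Lemma Schreier_pairwise x (s : seq {fset nat}) :
  (forall E, E \in s -> S x E) -> pairwise fset_lt s ->
  (forall i, i \in fcups s -> (size s <= i.+1)%N) -> S (osucc x) (fcups s).
Proof.
move=> sS pw sz; rewrite -fcups_filter; apply: SchreierS => [E|E||i iH].
- by rewrite mem_filter => /andP[/eqP].
- by rewrite mem_filter => /andP[_]; apply: sS.
- by apply: pairwise_sorted; apply: pairwise_filter.
- apply: leq_trans (_ : (size s <= _)%N); first by rewrite size_filter count_size.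
  apply: sz; rewrite -fcups_filter; apply/in_fcups.
  case: [seq _ <- _ | _] iH => [|E t] /= iH; first by rewrite inE in iH.
  by exists E; rewrite ?inE ?eqxx.
Qed.

(** Taking [u = q] gives that the families are hereditary, [I = E] and [q]
    the identity that they are spreading. *)
Lemma Schreier_spread x E (I : {fset nat}) (u q : nat -> nat) :
  S x E -> (forall i, i \in I -> q i \in E) ->
  (forall i j, i \in I -> j \in I -> (i < j)%N -> (q i < q j)%N) ->
  (forall i j, i \in I -> j \in I -> (i < j)%N -> (u i < u j)%N) ->
  (forall i, i \in I -> (q i <= u i)%N) -> S x (u @` I)%fset.
Proof.
move=> h; elim: h I => {x E} [x|x n x0|x s n0 _ IH srt sz|x n E lim nE _ IH] I qE qI uI qu.
- have -> : (u @` I = fset0)%fset; last exact: Schreier_empty.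
  by apply/fsetP => y; rewrite inE; apply/imfsetP => -[i /qE]; rewrite inE.
- have [->|/fset0Pn[i iI]] := eqVneq I fset0; first by rewrite imfset0; apply: Schreier_empty.
  have qn j : j \in I -> q j = n by move=> /qE; rewrite inE => /eqP.
  have -> : I = [fset i]%fset.
    apply/fsetP => j; rewrite inE; apply/idP/eqP => [jI|->//].
    by case: (ltngtP j i) => // /qI; rewrite !qn // ltnn => h; have := h _ _; rewrite jI iI; move/(_ isT isT).
  rewrite (_ : _ @` _ = [fset u i])%fset; first exact: Schreier0.
  by apply/fsetP => y; rewrite inE; apply/imfsetP/eqP => /= [[j]|->]; [rewrite inE => /eqP->|exists i; rewrite ?inE].
- have pw := sorted_fset_lt_pairwise n0 srt.
  (* A decomposition of [E] is pulled back along [q] and pushed forward by [u], piece by piece;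
     [q i <= u i] preserves the bound on the number of pieces. *)
  pose T (Q : {fset nat}) := (u @` [fset i in I | q i \in Q])%fset.
  have inT (Q : {fset nat}) (y : nat) : reflect (exists2 i, [/\ i \in I & q i \in Q] & y = u i) (y \in T Q).
    apply: (iffP (imfsetP _ _ _ _)) => /= [[i + ->]|[i [iI iQ] ->]].
      by rewrite !inE => /andP[iI iQ]; exists i.
    by exists i; rewrite // !inE iI.
  have -> : (u @` I)%fset = fcups (map T s).
    apply/fsetP => y; apply/imfsetP/in_fcups => /= [[i iI ->]|[_ /mapP[Q Qs ->]]].
      have /in_fcups[Q Qs qQ] := qE i iI.
      by exists (T Q); [apply: map_f|apply/inT; exists i].
    by move=> /inT[i [iI _] ->]; exists i.
  apply: Schreier_pairwise => [_ /mapP[Q Qs ->]||y].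
  + apply: (IH Q) => // [i|i j|i j|i]; rewrite !inE /=.
    * by case/andP.
    * by move=> /andP[iI _] /andP[jI _]; apply: qI.
    * by move=> /andP[iI _] /andP[jI _]; apply: uI.
    * by move=> /andP[iI _]; apply: qu.
  + rewrite pairwise_map; apply: sub_pairwise pw => Q Q' /fset_ltP QQ'.
    apply/fset_ltP => _ _ /inT[i [iI iQ] ->] /inT[j [jI jQ] ->].
    apply: uI => //; have ij := QQ' _ _ iQ jQ.
    by case: (ltngtP i j) => // [/qI|E]; [move/(_ jI iI); lia|rewrite E ltnn in ij].
  + move=> /in_fcups[_ /mapP[Q Qs ->] /inT[i [iI iQ] ->]]; rewrite size_map.
    have sz' := fcups_head_size n0 pw sz.
    by apply: leq_trans (sz' (q i) (qE _ iI)) _; rewrite ltnS qu.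
- apply: (@Schreier_lim _ _ n) => //; last exact: IH.
  by move=> _ /imfsetP[i /= iI ->]; apply: leq_trans (nE _ (qE _ iI)) (qu _ iI).
Qed.

Lemma Schreier_sub x E F : S x E -> (F `<=` E)%fset -> S x F.
Proof.
move=> h /fsubsetP FE; have <- : (id @` F)%fset = F.
  by apply/fsetP => y; apply/imfsetP/idP => /= [[i iF ->]//|yF]; exists y.
exact: (Schreier_spread (u := id) (q := id) h).
Qed.

Lemma Schreier_single x n : S x [fset n]%fset.
Proof.
elim/omega1_ind: x => x IH.
have [x0|y xy|lim] := ordinal_kindP x; first exact: Schreier0.
- rewrite xy -[[fset n]%fset]/([fset n]%fset) (_ : [fset n]%fset = fcups [:: [fset n]%fset]).
    apply: Schreier_pairwise => // E; rewrite inE => /eqP->; apply: IH.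
    by rewrite xy osucc_gt.
  by rewrite fcups_cons fcups_nil fsetU0.
(* The first term of the sequence puts no restriction on the minimum. *)
- apply: (@Schreier_lim _ _ 0%N) => //; apply: IH; apply: olimit_succ => //.
  have [inc [ub _] _] := fsP lim.
  by apply: lt_le_trans (inc _) _; apply: ub; exists 1%N.
Qed.

Lemma Schreier_succ x : S x `<=` S (osucc x).
Proof.
move=> E h; rewrite (_ : E = fcups [:: E]); last by rewrite fcups_cons fcups_nil fsetU0.
by apply: Schreier_pairwise => // F; rewrite inE => /eqP->.
Qed.

Lemma fs_lt x n : is_olimit x -> (fs x n < x)%O.
Proof.
move=> lim; have [inc [ub _] _] := fsP lim.
by apply: lt_le_trans (inc _) _; apply: ub; exists n.+1.
Qed.

Lemma fs_cofinal x y : is_olimit x -> (y < x)%O -> exists n, (y < fs x n)%O.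
Proof.
move=> lim yx; have [_ sup _] := fsP lim.
by have [_ [n _ <-] ?] := osup_gt sup yx; exists n.
Qed.

Lemma fs_sub x n p : is_olimit x -> (n < p)%N ->
  S (osucc (fs x n)) `<=` S (fs x p).
Proof.
move=> lim; have [_ _ inc] := fsP lim.
elim: p => // p IH; rewrite ltnS leq_eqVlt => /predU1P[->|/IH h]; first exact: inc.
by move=> E /h /Schreier_succ; apply: inc.
Qed.

(** A threshold is unavoidable: at a limit [y] one passes to a term [fs y n] above [x], and that
    term serves only sets starting at [n] or later. *)
Lemma Schreier_lt x y : (x < y)%O -> exists N, forall E,
  (forall i, i \in E -> (N <= i)%N) -> S x E -> S y E.
Proof.
elim/omega1_ind: y => y IH xy.
have [y0|z yz|lim] := ordinal_kindP y; first by move: xy; rewrite ltNge y0.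
- move: xy; rewrite yz lt_osucc le_eqVlt => /predU1P[->|xz].
    by exists 0%N => E _; apply: Schreier_succ.
  have [|N h] := IH z _ xz; first by rewrite yz osucc_gt.
  by exists N => E NE /(h _ NE); apply: Schreier_succ.
- have [n xn] := fs_cofinal lim xy.
  have [N h] := IH _ (fs_lt n lim) xn.
  exists (maxn N n) => E NE xE; apply: (@Schreier_lim _ _ n) => //.
    by move=> i /NE; rewrite geq_max => /andP[].
  apply: Schreier_succ; apply: h xE => i /NE.
  by rewrite geq_max => /andP[].
Qed.

Lemma Schreier_le x y : (x <= y)%O -> exists N, forall E,
  (forall i, i \in E -> (N <= i)%N) -> S x E -> S y E.
Proof. by rewrite le_eqVlt => /predU1P[->|/Schreier_lt//]; exists 0%N. Qed.

(** Only the size of a set before its last element constrains it, so the last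
    element may be moved down as well as up. *)
Lemma Schreier_last x (G : {fset nat}) e f : S x (e |` G)%fset ->
  (forall i, i \in G -> (i < e)%N) -> (forall i, i \in G -> (i < f)%N) ->
  S x (f |` G)%fset.
Proof.
elim/omega1_ind: x G => x IH G h Ge Gf.
have [->|/fset0Pn[g gG]] := eqVneq G fset0.
  by rewrite fsetU0; apply: Schreier_single.
have eG : e \in (e |` G)%fset by rewrite !inE eqxx.
have gG' : g \in (e |` G)%fset by rewrite !inE gG orbT.
have [x0|z xz|lim] := ordinal_kindP x.
- have [E0|[n En]] := Schreier_zero_inv x0 h; first by rewrite E0 inE in eG.
  move: eG gG' (Ge _ gG); rewrite En !inE => /eqP-> /eqP->.
  by rewrite ltnn.
- move: h; rewrite xz => /Schreier_succ_inv[s [Es n0 sS pw sz]].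
  (* Only the piece containing [e] changes, and induction applies to it. The number of pieces is
     still allowed at [f] because it is allowed at [g], an element of [G] below [f]. *)
  pose T (Q : {fset nat}) := if e \in Q then (f |` (Q `\ e))%fset else Q.
  have inG (Q : {fset nat}) (y : nat) : Q \in s -> y \in Q -> y != e -> y \in G.
    move=> Qs yQ ye; have : y \in (e |` G)%fset by rewrite Es; apply/in_fcups; exists Q.
    by rewrite !inE (negPf ye).
  have inT (Q : {fset nat}) (y : nat) : y \in T Q -> (y \in Q /\ y != e) \/ (y = f /\ e \in Q).
    rewrite /T; case: ifPn => eQ; rewrite ?inE; last first.
      by move=> yQ; left; split => //; apply: contraNneq eQ => <-.
    by case/predU1P => [->|/andP[]]; [right|left].
  have -> : (f |` G)%fset = fcups (map T s).
    apply/fsetP => y; apply/idP/in_fcups => [|[_ /mapP[Q Qs ->]]].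
      have : e \in fcups s by rewrite -Es.
      move=> /in_fcups[Q Qs eQ]; rewrite !inE => /predU1P[->|yG].
        by exists (T Q); [apply: map_f|rewrite /T eQ !inE eqxx].
      have /in_fcups[Q' Q's yQ] : y \in fcups s by rewrite -Es !inE yG orbT.
      exists (T Q'); first exact: map_f.
      rewrite /T; case: ifP => // _; rewrite !inE yQ andbT.
      by have := Ge _ yG; rewrite ltn_neqAle => /andP[-> _]; rewrite orbT.
    move=> /inT[[yQ ye]|[-> _]]; last by rewrite !inE eqxx.
    by rewrite !inE (inG Q) ?orbT.
  apply: Schreier_pairwise => [_ /mapP[Q Qs ->]||y].
  + rewrite /T; case: ifPn => eQ; last exact: sS.
    apply: IH => [||i|i]; first by rewrite xz osucc_gt.
    * by rewrite fsetD1K //; apply: sS.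
    * by rewrite !inE => /andP[ie iQ]; apply/Ge/(inG Q).
    * by rewrite !inE => /andP[ie iQ]; apply/Gf/(inG Q).
  + rewrite pairwise_map.
    have : {in s &, forall Q Q', fset_lt Q Q' -> relpre T fset_lt Q Q'}.
      move=> Q Q' Qs Q's /fset_ltP QQ'; apply/fset_ltP => i j.
      move=> /inT[[iQ ie]|[-> eQ]] /inT[[jQ je]|[-> eQ']]; first exact: QQ'.
      * by apply/Gf/(inG Q).
      * by have := QQ' _ _ eQ jQ; have := Ge _ (inG _ _ Q's jQ je); lia.
      * by have := QQ' _ _ eQ eQ'; rewrite ltnn.
    by move=> sub; apply: (sub_in_pairwise sub _ pw); apply/allP.
  + move=> /in_fcups[_ /mapP[Q Qs ->]]; rewrite size_map => /inT[[yQ ye]|[-> _]].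
      by apply: sz; rewrite Es; apply/in_fcups; exists Q.
    by apply: leq_trans (sz _ gG') _; rewrite ltnS ltnW ?Gf.
- have [E0|[n [nE h']]] := Schreier_limit_inv lim h; first by rewrite E0 inE in eG.
  apply: (@Schreier_lim _ _ n) => // [i|].
    rewrite !inE => /predU1P[->|iG]; last by apply: nE; rewrite !inE iG orbT.
    by apply: leq_trans (nE _ gG') _; rewrite ltnW ?Gf.
  by apply: IH h' Ge Gf; apply: olimit_succ => //; apply: fs_lt.
Qed.

End Schreier_families.

(** * Unions of sets of a family *)

Lemma not_sorted_split (T : Type) (r : rel T) (s : seq T) : ~~ sorted r s ->
  exists s1 a b s2, s = s1 ++ a :: b :: s2 /\ ~~ r a b.
Proof.
case: s => // a s /=; elim: s a => // b s IH a /=.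
rewrite negb_and; have [rab /= /IH[s1 [c [d [s2 [-> ncd]]]]]|nab _] := boolP (r a b).
  by exists (a :: s1), c, d, s2.
by exists [::], a, b, s.
Qed.

(** The length of the integer interval spanned by [E] ([0] if [E] is empty). *)
Definition span_size (E : {fset nat}) : nat := \max_(i <- E) \max_(j <- E) (i - j).+1.

Lemma span_size0 : span_size fset0 = 0%N.
Proof. by rewrite /span_size big_seq_fset0. Qed.

Lemma span_sizeE (E : {fset nat}) m M : m \in E -> M \in E ->
  (forall x, x \in E -> m <= x <= M)%N -> span_size E = (M - m).+1.
Proof.
move=> mE ME h; apply/eqP; rewrite eqn_leq; apply/andP; split.
  apply/bigmax_leqP_seq => i iE _; apply/bigmax_leqP_seq => j jE _.
  by have := h i iE; have := h j jE; lia.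
apply: leq_trans (_ : (\max_(j <- E) (M - j).+1 <= _)%N).
  exact: (@leq_bigmax_seq _ _ xpredT (fun j => (M - j).+1)).
exact: (@leq_bigmax_seq _ _ xpredT (fun i => \max_(j <- E) (i - j).+1)%N).
Qed.

Lemma span_size_le (E : {fset nat}) m M :
  (forall x, x \in E -> m <= x <= M)%N -> (span_size E <= (M - m).+1)%N.
Proof.
move=> h; apply/bigmax_leqP_seq => i iE _; apply/bigmax_leqP_seq => j jE _.
by have := h i iE; have := h j jE; lia.
Qed.

(** Compares the minima without giving the empty set a minimum. *)
Definition starts_before (A B : {fset nat}) := has (fun a => all (leq a) B) A.

(** The spans of [T] and [U] are disjoint intervals inside the hull of [A] and [B], whereas the
    spans of [A] and [B] cover this hull and overlap at the minimum of [B] or beyond. *)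
Lemma span_size_uncross (A B T U : {fset nat}) : starts_before A B -> B != fset0 ->
  ~~ fset_lt A B -> (T `|` U)%fset = (A `|` B)%fset -> fset_lt T U ->
  (span_size T + span_size U < span_size A + span_size B)%N.
Proof.
move=> /hasP[a0 a0A /allP a0B] B0 /fset_ltP nAB TU /fset_ltP ltTU.
have A0 : A != fset0 by apply/fset0Pn; exists a0.
have [a aA amin] := fset_minP A0; have [a' a'A amax] := fset_maxP A0.
have [b bB bmin] := fset_minP B0; have [b' b'B bmax] := fset_maxP B0.
have ab : (a <= b)%N by apply: leq_trans (amin _ a0A) (a0B _ bB).
have ba' : (b <= a')%N.
  rewrite leqNgt; apply/negP => a'b; apply: nAB => i j /amax ia' /bmin bj.
  by lia.
have aa' := amax _ aA; have bb' := bmax _ bB.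
rewrite (span_sizeE aA a'A) ?(span_sizeE bB b'B); first last.
- by move=> x xA; rewrite amin ?amax.
- by move=> x xB; rewrite bmin ?bmax.
have inTU x : (x \in T) || (x \in U) -> (a <= x <= maxn a' b')%N.
  move=> xTU; have : x \in (T `|` U)%fset by rewrite inE.
  rewrite TU inE => /orP[xA|xB].
    by rewrite amin //= leq_max amax.
  by rewrite (leq_trans ab) ?bmin //= leq_max bmax ?orbT.
have [T0|T0] := eqVneq T fset0.
  have : (span_size U <= (maxn a' b' - a).+1)%N.
    by apply: span_size_le => x xU; apply: inTU; rewrite xU orbT.
  by rewrite T0 span_size0; lia.
have [U0|U0] := eqVneq U fset0.
  have : (span_size T <= (maxn a' b' - a).+1)%N.
    by apply: span_size_le => x xT; apply: inTU; rewrite xT.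
  by rewrite U0 span_size0; lia.
have [t tT tmax] := fset_maxP T0; have [u uU umin] := fset_minP U0.
have tu := ltTU _ _ tT uU.
have hT : (span_size T <= (t - a).+1)%N.
  by apply: span_size_le => x xT; rewrite tmax // andbT; have := inTU x; rewrite xT => /(_ isT)/andP[].
have hU : (span_size U <= (maxn a' b' - u).+1)%N.
  by apply: span_size_le => x xU; rewrite umin //=; have := inTU x; rewrite xU orbT => /(_ isT)/andP[].
have /andP[a_t _] : (a <= t <= maxn a' b')%N by apply: inTU; rewrite tT.
have /andP[_ u_max] : (a <= u <= maxn a' b')%N by apply: inTU; rewrite uU orbT.
clear - aa' bb' ba' ab hT hU tu a_t u_max; lia.
Qed.

Section merging.
Variable fs : omega1 -> nat -> omega1.
Hypothesis fsP : fundamental_system fs.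
Local Notation S := (Schreier fs).

Definition mergeable2 x := forall E F, S x E -> S x F ->
  exists T U, [/\ S x T, S x U, (T `|` U)%fset = (E `|` F)%fset & fset_lt T U].

Definition mergeable x := forall s, (forall E, E \in s -> S x E) ->
  exists t, [/\ fcups t = fcups s, forall E, E \in t -> S x E, pairwise fset_lt t &
    (size t <= size s)%N].

(** Replacing two crossing sets by two successive ones shortens the total span. *)
Lemma mergeable2P x : mergeable2 x -> mergeable x.
Proof.
move=> m2 s; have [n] := ubnP (\sum_(E <- s) span_size E)%N.
elim: n s => // n IH s; rewrite ltnS => sn sS.
(* Sorted by minima, a list that is not successive has two neighbours that cross in the sense of
   [span_size_uncross]. *)
set s0 := sort starts_before [seq E <- s | E != fset0].
have in_s0 E : (E \in s0) = (E != fset0) && (E \in s) by rewrite mem_sort mem_filter.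
have s0n : (\sum_(E <- s0) span_size E <= n)%N.
  rewrite (perm_big _ (permEl (perm_sort _ _))) /= big_filter.
  by apply: leq_trans sn; rewrite [leqRHS](bigID (fun E => E != fset0)) /= leq_addr.
have cups0 : fcups s0 = fcups s.
  rewrite -[RHS]fcups_filter; apply/fsetP => x0.
  by apply/in_fcups/in_fcups => -[E Es xE]; exists E => //; rewrite mem_sort in Es *.
have size0 : (size s0 <= size s)%N by rewrite size_sort size_filter count_size.
have srt : sorted starts_before s0.
  apply: (sort_sorted_in (P := [pred E | E != fset0])); last exact: filter_all.
  move=> A B /= A0 B0; have [a aA amin] := fset_minP A0; have [b bB bmin] := fset_minP B0.
  have [ab|ba] := leqP a b; apply/orP; [left|right]; apply/hasP.
    by exists a => //; apply/allP => i /bmin; apply: leq_trans.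
  by exists b => //; apply/allP => i /amin; apply: leq_trans; apply: ltnW.
have [lts|] := boolP (sorted fset_lt s0).
  exists s0; split => // [E|]; first by rewrite in_s0 => /andP[_ /sS].
  by apply: sorted_fset_lt_pairwise => // E; rewrite in_s0 => /andP[/eqP].
move=> /not_sorted_split[s1 [A [B [s2 [Es0 nAB]]]]].
have AB : starts_before A B.
  by move: srt; rewrite Es0 => /cat_sorted2[_ /andP[]].
have [sA sB] : S x A /\ S x B.
  split; apply: sS.
    by have : A \in s0; [rewrite Es0 mem_cat !inE eqxx !orbT|rewrite in_s0 => /andP[]].
  by have : B \in s0; [rewrite Es0 mem_cat !inE eqxx !orbT|rewrite in_s0 => /andP[]].
have B0 : B != fset0.
  by have : B \in s0; [rewrite Es0 mem_cat !inE eqxx !orbT|rewrite in_s0 => /andP[]].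
have [T [U [sT sU TU ltTU]]] := m2 A B sA sB.
have lt := span_size_uncross AB B0 nAB TU ltTU.
have [||t [ts tS pw sz]] := IH (s1 ++ T :: U :: s2).
- apply: leq_trans s0n; rewrite Es0 !big_cat !big_cons /=; lia.
- move=> E; rewrite mem_cat !inE => /or4P[Es1|/eqP->|/eqP->|Es2] //; apply: sS.
    by have : E \in s0; [rewrite Es0 mem_cat Es1|rewrite in_s0 => /andP[]].
  by have : E \in s0; [rewrite Es0 mem_cat !inE Es2 !orbT|rewrite in_s0 => /andP[]].
exists t; split => //.
  rewrite ts -cups0 Es0 !fcups_cat !fcups_cons.
  by congr (_ `|` _)%fset; rewrite !fsetUA TU.
by apply: leq_trans sz _; apply: leq_trans size0; rewrite Es0 !size_cat.
Qed.

Let below (b : nat) (E : {fset nat}) := [fset i in E | (i < b)%N]%fset.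
Let above (b : nat) (E : {fset nat}) := [fset i in E | (b < i)%N]%fset.

Lemma Schreier_above x b E : S x E -> S x (above b E).
Proof. by move=> /Schreier_sub; apply; apply/fsubsetP => i; rewrite !inE => /andP[]. Qed.

(** Drop the elements of [E] other than [e] from [b] on; [e] is then the last element and may be
    moved down to [b], which need not belong to [E]. *)
Lemma Schreier_cut x b e E : S x E -> e \in E -> (b <= e)%N -> S x (b |` below b E)%fset.
Proof.
move=> h eE be; apply: (@Schreier_last _ fsP _ _ e) => [|i|i]; rewrite ?inE.
- apply: Schreier_sub h _; apply/fsubsetP => i; rewrite !inE.
  by case/predU1P => [->|/andP[]].
- by move=> /andP[_ ib]; apply: leq_trans be.
- by case/andP.
Qed.

(** The pieces of [F] and one more set, all beyond [b <= F], number at most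
    [b.+2] and so still form a set of the next family. *)
Lemma merge_beyond x b E F : mergeable x -> S x E -> S (osucc x) F ->
  b \in F -> (forall i, i \in E -> b < i)%N ->
  S (osucc x) (E `|` above b F)%fset.
Proof.
move=> mg sE /Schreier_succ_inv[s [-> _ sS _ sz]] bF bE.
have [E'|t [ts tS pw szt]] := mg (E :: map (above b) s).
  by rewrite inE => /predU1P[->//|/mapP[Q Qs ->]]; apply: Schreier_above; apply: sS.
have Et : fcups t = (E `|` above b (fcups s))%fset.
  rewrite ts fcups_cons; congr (_ `|` _)%fset.
  apply/fsetP => i; rewrite !inE; apply/in_fcups/andP => [[_ /mapP[Q Qs ->]]|[]].
    by rewrite !inE => /andP[iQ bi]; split => //; apply/in_fcups; exists Q.
  move=> /in_fcups[Q Qs iQ] bi; exists (above b Q); first exact: map_f.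
  by rewrite !inE iQ.
rewrite -Et; apply: Schreier_pairwise => // i; rewrite Et !inE => h.
apply: leq_trans szt _; rewrite /= size_map ltnS.
apply: leq_trans (sz b bF) _.
by case/orP: h => [/bE|/andP[]].
Qed.

(** Let [E] start first, and let it reach the minimum [b] of [F]. Then [b] is given to the first new
    set, in place of a later element of [E], by [Schreier_cut]. The second new set starts strictly
    after [b], so it has room for one piece more than [F], which is exactly what the cut piece of
    [E] requires. *)
Lemma mergeable_all x : mergeable x.
Proof.
elim/omega1_ind: x => x IH; apply: mergeable2P => E F sE sF.
have [E0|En0] := eqVneq E fset0.
  by exists fset0, F; rewrite E0; split => //; exact: Schreier_empty.
have [F0|Fn0] := eqVneq F fset0.
  exists E, fset0; rewrite F0; split => //; first exact: Schreier_empty.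
  by apply/fset_ltP => i j _; rewrite inE.
have [a aE amin] := fset_minP En0; have [b bF bmin] := fset_minP Fn0.
wlog ab : E F sE sF a b aE amin bF bmin En0 Fn0 / (a <= b)%N => [wl|].
  have [ab|/ltnW ba] := leqP a b; first exact: (wl E F _ _ a b).
  have [T [U [sT sU TU ltTU]]] := wl F E sF sE b a bF bmin aE amin Fn0 En0 ba.
  by exists T, U; split => //; rewrite TU fsetUC.
have [ltEF|] := boolP (fset_lt E F); first by exists E, F.
move=> nEF; have {nEF}[e eE be] : exists2 e, e \in E & (b <= e)%N.
  apply: contrapT => nex; move/negP: nEF; apply; apply/fset_ltP => i j iE /bmin bj.
  apply: leq_trans bj; rewrite ltnNge; apply/negP => bi; apply: nex.
  by exists i.
have splitF : F = (b |` above b F)%fset.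
  apply/fsetP => i; rewrite !inE; have [->//|ib /=] := eqVneq i b.
  by case: (boolP (i \in F)) => //= /bmin; rewrite leq_eqVlt eq_sym (negPf ib).
have [x0|z xz|lim] := ordinal_kindP x.
- have [E0|[n En]] := Schreier_zero_inv x0 sE; first by rewrite E0 eqxx in En0.
  have [F0|[m Fm]] := Schreier_zero_inv x0 sF; first by rewrite F0 eqxx in Fn0.
  have -> : E = F.
    move: aE eE bF ab be; rewrite En Fm !inE => /eqP-> /eqP-> /eqP-> nm mn.
    by congr [fset _]%fset; apply/eqP; rewrite eqn_leq nm mn.
  exists F, fset0; split => //; first exact: Schreier_empty.
    by rewrite fsetU0 fsetUid.
  by apply/fset_ltP => i j _; rewrite inE.
- have zx : (z < x)%O by rewrite xz osucc_gt.
  move: (sE); rewrite xz => /Schreier_succ_inv[s [Es s0 sS pw sz]].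
  (* [P] will be the first piece of [E] with an element at or beyond [b]; all pieces before it lie
     below [b]. *)
  pose reach (P : {fset nat}) := has (leq b) P.
  have hs : has reach s.
    move: eE; rewrite Es => /in_fcups[P Ps eP]; apply/hasP; exists P => //.
    by apply/hasP; exists e.
  case/split_find: hs Es pw sS sz => P s1 s2 /hasP[p pP bp] ns1 Es pw sS sz.
  have s1b Q i : Q \in s1 -> i \in Q -> (i < b)%N.
    move=> Qs iQ; rewrite ltnNge; apply: contra ns1 => bi.
    by apply/hasP; exists Q => //; apply/hasP; exists i.
  move: (sF); rewrite xz => /Schreier_succ_inv[r [Er r0 rS pwr szr]].
  have [|t [ts tS pwt szt]] := IH z zx ([:: above b P] ++ map (above b) s2 ++ map (above b) r).
    move=> Q; rewrite !mem_cat inE => /or3P[/eqP->|/mapP[Q' Qs ->]|/mapP[Q' Qs ->]];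
      apply: Schreier_above.
    + by apply: sS; rewrite cat_rcons mem_cat inE eqxx orbT.
    + by apply: sS; rewrite cat_rcons mem_cat inE Qs !orbT.
    + exact: rS.
  have bt i : i \in fcups t -> (b < i)%N.
    rewrite ts => /in_fcups[Q]; rewrite !mem_cat inE.
    by move=> /or3P[/eqP->|/mapP[Q' Qs ->]|/mapP[Q' Qs ->]]; rewrite !inE => /andP[].
  pose A := (b |` below b P)%fset.
  (* The first set gets as many pieces as [E] had. Besides the pieces before [P] and the cut piece
     [A], it takes [size s2] of the merged pieces beyond [b]; the others go to the second set. *)
  pose u := s1 ++ A :: take (size s2) t.
  pose v := drop (size s2) t.
  have PS : P \in (rcons s1 P ++ s2) by rewrite mem_cat mem_rcons inE eqxx.
  have pwt' : pairwise fset_lt (take (size s2) t ++ v) by rewrite cat_take_drop.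
  have Ab i : i \in A -> (i <= b)%N.
    by rewrite !inE => /predU1P[->//|/andP[_ /ltnW]].
  have tin Q i : Q \in take (size s2) t ++ v -> i \in Q -> (b < i)%N.
    by rewrite cat_take_drop => Qt iQ; apply: bt; apply/in_fcups; exists Q.
  have ga i : i \in E -> (size (s1 ++ P :: s2) <= i.+1)%N.
    by move=> iE; rewrite -cat_rcons; apply: sz.
  exists (fcups u), (fcups v); split.
  + apply: Schreier_pairwise => [Q||i].
    * rewrite mem_cat inE => /or3P[Qs|/eqP->|/mem_take Qt]; last exact: tS.
        by apply: sS; rewrite mem_cat mem_rcons inE Qs orbT.
      by apply: Schreier_cut pP bp; apply: sS.
    * move: pw; rewrite cat_rcons pairwise_cat => /and3P[/allrelP s1r pw1 _].
      rewrite pairwise_cat pw1 /=; move: pwt'; rewrite pairwise_cat => /and3P[_ -> _].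
      rewrite !andbT; apply/andP; split.
        apply/allrelP => Q Q' Qs; rewrite inE => /predU1P[->|Q't]; apply/fset_ltP => i j iQ.
          rewrite !inE => /predU1P[->|/andP[jP _]]; first exact: s1b iQ.
          have /fset_ltP : fset_lt Q P by apply: s1r; rewrite // inE eqxx.
          by apply.
        move=> jQ; apply: ltn_trans (s1b _ _ Qs iQ) (tin _ _ _ jQ).
        by rewrite mem_cat Q't.
      apply/allP => Q Qt; apply/fset_ltP => i j /Ab ib jQ.
      by apply: leq_ltn_trans ib (tin _ _ _ jQ); rewrite mem_cat Qt.
    * move=> iu.
      have szu : (size u <= size (s1 ++ P :: s2))%N.
        by rewrite /u !size_cat /= leq_add2l ltnS size_take; case: ltnP.
      apply: leq_trans szu _.
      move: iu => /in_fcups[Q]; rewrite mem_cat inE => /or3P[Qs iQ|/eqP-> |Qt iQ].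
      - by apply: ga; rewrite Es; apply/in_fcups; exists Q; rewrite // mem_cat mem_rcons inE Qs orbT.
      - rewrite !inE => /predU1P[->|/andP[iP _]].
          by apply: leq_trans (ga _ aE) _.
        by apply: ga; rewrite Es; apply/in_fcups; exists P.
      - apply: leq_trans (ga _ aE) _; rewrite ltnS.
        apply: leq_trans ab (ltnW (tin _ _ _ iQ)).
        by rewrite mem_cat Qt.
  + apply: Schreier_pairwise => [Q /mem_drop /tS //||i].
      by move: pwt'; rewrite pairwise_cat => /and3P[].
    move=> /in_fcups[Q Qv iQ]; have bi := tin _ _ _ iQ.
    have {}bi : (b < i)%N by apply: bi; rewrite mem_cat Qv orbT.
    (* At most [1 + size r] pieces remain, and [size r <= b.+1] since [b] is in [F]; hence at most
       [b.+2], which is allowed at every [i > b]. *)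
    move: (szr b bF) szt bi; rewrite /v size_drop !size_cat !size_map /=.
    by clear; lia.
  + have -> : (fcups u `|` fcups v)%fset = (fcups s1 `|` (A `|` fcups t))%fset.
      by rewrite /u fcups_cat fcups_cons -!fsetUA -fcups_cat cat_take_drop.
    rewrite ts !fcups_cat fcups_cons fcups_nil fsetU0 Es cat_rcons fcups_cat fcups_cons.
    have mapE l : fcups (map (above b) l) = above b (fcups l).
      apply/fsetP => i; rewrite !inE; apply/in_fcups/andP => [[_ /mapP[Q Qs ->]]|[]].
        by rewrite !inE => /andP[iQ bi]; split => //; apply/in_fcups; exists Q.
      move=> /in_fcups[Q Qs iQ] bi; exists (above b Q); first exact: map_f.
      by rewrite !inE iQ.
    rewrite !mapE -Er {2}splitF.
    have ab2 i : i \in fcups s2 -> (b < i)%N.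
      move=> /in_fcups[Q Qs iQ].
      move: pw; rewrite cat_rcons pairwise_cat => /and3P[_ _ /= /andP[/allP Ps2 _]].
      by have /fset_ltP/(_ p i pP iQ) := Ps2 Q Qs; apply: leq_ltn_trans.
    apply/fsetP => i; rewrite !inE; have [->|ib] := eqVneq i b; first by rewrite !orbT.
    rewrite /=; case: (boolP (i \in fcups s2)) => [/ab2 ->|_]; first by rewrite !orbT.
    case: (i \in fcups s1) => //=; case: (i \in P) => //=.
    by case: ltngtP ib.
  + apply/fset_ltP => i j /in_fcups[Q]; rewrite mem_cat inE => QU iQ /in_fcups[Q' Qv jQ].
    have bj : (b < j)%N by apply: tin jQ; rewrite mem_cat Qv orbT.
    case/or3P: QU iQ => [Qs iQ|/eqP->/Ab|Qt iQ].
    - exact: ltn_trans (s1b _ _ Qs iQ) bj.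
    - by move: bj; clear; lia.
    - move: pwt'; rewrite pairwise_cat => /and3P[/allrelP h _ _].
      by have /fset_ltP := h _ _ Qt Qv; apply.
- have below_x n : (osucc (fs x n) < x)%O by apply: olimit_succ => //; apply: fs_lt.
  (* The families along the sequence increase, so the largest term permitted by the minimum [a] may
     be taken. *)
  have sE' : S (osucc (fs x a)) E.
    have [E0|[n [nE h]]] := Schreier_limit_inv lim sE; first by rewrite E0 eqxx in En0.
    have := nE a aE; rewrite leq_eqVlt => /predU1P[<-//|na].
    by apply: Schreier_succ; apply: fs_sub h.
  have sF' : S (osucc (fs x b)) F.
    have [F0|[n [nF h]]] := Schreier_limit_inv lim sF; first by rewrite F0 eqxx in Fn0.
    have := nF b bF; rewrite leq_eqVlt => /predU1P[<-//|na].
    by apply: Schreier_succ; apply: fs_sub h.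
  move: ab; rewrite leq_eqVlt => /predU1P[Eab|ltab].
    have [|t [ts tS pw sz]] := IH _ (below_x b) [:: E; F].
      by move=> G; rewrite !inE => /orP[]/eqP-> //; rewrite -Eab.
    rewrite !fcups_cons fcups_nil fsetU0 in ts.
    have up G : G \in t -> S x G.
      move=> Gt; apply: (@Schreier_lim _ _ b) => //; last exact: tS.
      move=> i iG; have : i \in fcups t by apply/in_fcups; exists G.
      by rewrite ts inE => /orP[/amin|/bmin //]; rewrite Eab.
    case: t ts tS pw sz up => [|T [|U [|? ?]]] //= ts _ pw _ up.
    - exists fset0, fset0; split; try exact: Schreier_empty.
        by rewrite -ts fcups_nil fsetU0.
      by apply/fset_ltP => i j _; rewrite inE.
    - exists T, fset0; split; [by apply: up; rewrite inE|exact: Schreier_empty| |].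
        by rewrite -ts fcups_cons fcups_nil.
      by apply/fset_ltP => i j _; rewrite inE.
    - exists T, U; split; [by apply: up; rewrite !inE eqxx|by apply: up; rewrite !inE eqxx orbT| |].
        by rewrite -ts !fcups_cons fcups_nil fsetU0.
      by move: pw; rewrite !andbT.
  (* Since [a < b], the set [E] lies in the family [fs x b], one step below that of [F]; its part
     beyond [b] counts as a single extra piece in [merge_beyond]. *)
  exists (b |` below b E)%fset, (above b E `|` above b F)%fset; split.
  + apply: (@Schreier_lim _ _ a) => // [i|]; last exact: Schreier_cut eE be.
    by rewrite !inE => /predU1P[->|/andP[/amin]] //; apply: ltnW.
  + apply: (@Schreier_lim _ _ b) => // [i|].
      by rewrite !inE => /orP[]/andP[_ /ltnW].
    apply: merge_beyond => // [||i].
    * by apply: IH; apply: fs_lt.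
    * by apply: Schreier_above; apply: fs_sub sE'.
    * by rewrite !inE => /andP[].
  + rewrite {2}splitF; apply/fsetP => i; rewrite !inE.
    have [->|ib] := eqVneq i b; first by rewrite !orbT.
    by rewrite /= orbA; case: (i \in E) => //=; case: ltngtP ib.
  + apply/fset_ltP => i j; rewrite !inE => iT jU.
    have : (b < j)%N by case/orP: jU => /andP[].
    by case/predU1P: iT => [->//|/andP[_ ib]]; apply: ltn_trans.
Qed.

End merging.

(** * Families of index [iota + rho] *)

(** Diagonal domination. At a limit ordinal a set using the term [n] has all its elements [e >= n],
    so one function can replace the whole sequence [h n]. *)
Lemma dominating_incr (h : nat -> nat -> nat) :
  exists phi : nat -> nat, {homo phi : a b / (a < b)%N} /\
    forall n e, (n <= e)%N -> (h n e <= phi e)%N.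
Proof.
pose G e := (\sum_(n < e.+1) h n e).+1.
exists (fun e => \sum_(i < e.+1) G i)%N; split.
  apply: homo_ltn => // [y x z|i]; first exact: ltn_trans.
  by rewrite [ltnRHS]big_ord_recr /= -[ltnLHS]addn0 ltn_add2l.
move=> n e ne; rewrite big_ord_recr /=; apply: leq_trans (leq_addl _ _).
by rewrite /G leqW // (bigD1 (Ordinal (ne : (n < e.+1)%N))) //= leq_addr.
Qed.

Lemma incr_ge (phi : nat -> nat) : {homo phi : a b / (a < b)%N} ->
  forall n, (n <= phi n)%N.
Proof. by move=> h; elim=> // n IH; apply: leq_ltn_trans IH (h _ _ _). Qed.

Lemma incr_inj (phi : nat -> nat) : {homo phi : a b / (a < b)%N} -> injective phi.
Proof. by move=> h a b E; case: (ltngtP a b) => // /h; rewrite E ltnn. Qed.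

Lemma pairwise_mem (T : eqType) (r : rel T) (s : seq T) x y :
  pairwise r s -> x \in s -> y \in s -> [\/ x = y, r x y | r y x].
Proof.
elim: s => //= a s IH /andP[/allP ras pw]; rewrite !inE.
move=> /predU1P[->|xs] /predU1P[->|ys]; [|constructor 2|constructor 3|exact: IH].
- by constructor 1.
- exact: ras.
- exact: ras.
Qed.

Lemma card_fcups (s : seq {fset nat}) : (forall Q, Q \in s -> #|` Q| <= 1)%N ->
  (#|` fcups s| <= size s)%N.
Proof.
elim: s => [_|Q s IH h]; first by rewrite fcups_nil cardfs0.
rewrite fcups_cons; apply: leq_trans (_ : #|` Q| + #|` fcups s| <= _)%N.
  by rewrite -cardfsUI leq_addr.
rewrite /= -add1n leq_add ?h ?inE ?eqxx // IH // => P Ps.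
by apply: h; rewrite inE Ps orbT.
Qed.

Section composition.
Variable fs : omega1 -> nat -> omega1.
Hypothesis fsP : fundamental_system fs.
Local Notation S := (Schreier fs).

(** [A] plays the role of the set of first elements of the pieces of index [i]. The last clause
    states this without listing pieces: a subset of [E] lying in one gap between points of [A]
    belongs to the family [i]. The function [phi] compensates for the unrelated sequences at
    limits. *)
Lemma Schreier_decompose i r x : oadd i r x ->
  exists phi : nat -> nat, {homo phi : a b / (a < b)%N} /\
  forall E, S x E -> exists A : {fset nat}, [/\ (A `<=` E)%fset, S r (phi @` A)%fset,
    (forall y, y \in E -> exists2 a, a \in A & (a <= y)%N) &
    forall G, (G `<=` E)%fset ->
      (forall a y z, a \in A -> y \in G -> z \in G -> y < a -> z < a)%N -> S i G].
Proof.
elim=> {r x} [z z0|b c _ [phi [phi_incr IH]]|b c g lim h IH sup].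
- exists id; split => // E sE; have [->|En0] := eqVneq E fset0.
    exists fset0; split => // [|G]; first by rewrite imfset0; apply: Schreier_empty.
    by rewrite fsubset0 => /eqP-> _; apply: Schreier_empty.
  have [a aE amin] := fset_minP En0; exists [fset a]%fset; split.
  + by rewrite fsub1set.
  + rewrite (_ : _ @` _ = [fset a])%fset; first exact: Schreier_single.
    by apply/fsetP => y; apply/imfsetP/idP => /= [[j ja ->//]|ya]; exists y.
  + by move=> y /amin ay; exists a; rewrite ?inE.
  + by move=> G GE _; apply: Schreier_sub GE.
- exists phi; split => // E /Schreier_succ_inv[s [Es _ sS pw sz]].
  pose good (F A : {fset nat}) := [/\ (A `<=` F)%fset, S b (phi @` A)%fset,
      (forall y, y \in F -> exists2 a, a \in A & (a <= y)%N) &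
      forall G, (G `<=` F)%fset ->
      (forall a y z, a \in A -> y \in G -> z \in G -> y < a -> z < a)%N -> S i G].
  have /choice[A AP] : forall F, exists A, F \in s -> good F A.
    move=> F; have [Fs|nFs] := boolP (F \in s); last by exists fset0.
    by have [A ?] := IH F (sS F Fs); exists A.
  have AF F y : F \in s -> y \in A F -> y \in F.
    by move=> /AP[/fsubsetP + _ _ _]; apply.
  have inA y : reflect (exists2 F, F \in s & y \in A F) (y \in fcups (map A s)).
    by apply: (iffP (in_fcups _ _)) => [[_ /mapP[F Fs ->]]|[F Fs]];
      [exists F|exists (A F); rewrite ?map_f].
  have inE' F y : F \in s -> y \in F -> y \in E by move=> Fs yF; rewrite Es; apply/in_fcups; exists F.
  exists (fcups (map A s)); split.
  + by apply/fsubsetP => y /inA[F Fs yA]; apply: (inE' F) => //; apply: AF yA.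
  + have -> : (phi @` fcups (map A s))%fset = fcups [seq (phi @` A F)%fset | F <- s].
      apply/fsetP => y; apply/imfsetP/in_fcups => /= [[j /inA[F Fs jA] ->]|[_ /mapP[F Fs ->]]].
        by exists (phi @` A F)%fset; [apply/mapP; exists F|apply: in_imfset].
      by move=> /imfsetP[j /= jA ->]; exists j => //; apply/inA; exists F.
    apply: Schreier_pairwise => [_ /mapP[F Fs ->]||y].
    * by have [] := AP F Fs.
    * rewrite pairwise_map.
      have sub : {in s &, forall F G, fset_lt F G ->
          relpre (fun F => phi @` A F)%fset fset_lt F G}.
        move=> F G Fs Gs /fset_ltP FG; apply/fset_ltP => u v.
        move=> /imfsetP[j /= /(AF _ _ Fs) jF ->] /imfsetP[k /= /(AF _ _ Gs) kG ->].
        by apply: phi_incr; apply: FG.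
      by apply: (sub_in_pairwise sub _ pw); apply/allP.
    * move=> /in_fcups[_ /mapP[F Fs ->] /imfsetP[j /= /(AF _ _ Fs) jF ->]].
      rewrite size_map; apply: leq_trans (sz j _) _; first exact: inE' jF.
      by rewrite ltnS incr_ge.
  + move=> y; rewrite {1}Es => /in_fcups[F Fs yF]; have [_ _ h _] := AP F Fs.
    by have [a aA ay] := h y yF; exists a => //; apply/inA; exists F.
  + move=> G /fsubsetP GE sep; have [->|/fset0Pn[y0 y0G]] := eqVneq G fset0.
      exact: Schreier_empty.
    move: (GE _ y0G); rewrite {1}Es => /in_fcups[F Fs y0F].
    have [_ _ hF hF'] := AP F Fs; apply: hF' => [|a y z aA]; last first.
      by apply: sep; apply/inA; exists F.
    (* If [z] were in another piece than [y0], a point of [A] in the later of the two pieces would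
       separate them. *)
    apply/fsubsetP => z zG; move: (GE _ zG); rewrite {1}Es => /in_fcups[F' F's zF'].
    have [->//|/fset_ltP lt|/fset_ltP lt] := pairwise_mem pw Fs F's.
      have [_ _ hF2 _] := AP F' F's; have [a aA az] := hF2 z zF'.
      have y0a : (y0 < a)%N by apply: lt => //; apply: AF aA.
      have : (z < a)%N by apply: (sep a y0 z) => //; apply/inA; exists F'.
      by rewrite ltnNge az.
    have [a aA ay] := hF y0 y0F.
    have za : (z < a)%N by apply: lt => //; apply: AF aA.
    have : (y0 < a)%N by apply: (sep a z y0) => //; apply/inA; exists F.
    by rewrite ltnNge ay.
- have limc := oadd_limit lim (oadd_lim lim h sup).
  have /choice[d dP] : forall n, exists d, (d < b)%O /\ (osucc (fs c n) < g d)%O.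
    move=> n; have lt : (osucc (fs c n) < c)%O.
      by apply: olimit_succ => //; apply: fs_lt.
    by have [_ [d db <-] lt'] := osup_gt sup lt; exists d.
  have [phi_ phi_P] := choice (fun n => IH _ (dP n).1).
  have [N NP] := choice (fun n => Schreier_lt fsP (dP n).2).
  have [N' N'P] := choice (fun n => Schreier_lt fsP (olimit_succ lim (dP n).1)).
  (* The values of [phi] must make room for [N n] singletons besides one set, pass the threshold
     [N' n] of the family [b], and dominate [phi_ n]. *)
  have [phi [phi_incr phiP]] :=
    dominating_incr (fun n e => maxn (maxn (N n).+1 (N' n)) (phi_ n e)).
  exists phi; split => // E sE.
  have [->|[n [nE sE']]] := Schreier_limit_inv limc sE.
    exists fset0; split => // [|G]; first by rewrite imfset0; apply: Schreier_empty.
    by rewrite fsubset0 => /eqP-> _; apply: Schreier_empty.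
  have [phi_n_incr IHn] := phi_P n.
  have le_phi e : e \in E -> [/\ N n < phi e, N' n <= phi e & phi_ n e <= phi e]%N.
    by move=> /nE /phiP; rewrite !geq_max => /andP[/andP[]].
  pose E1 := [fset e in E | (N n <= e)%N]%fset.
  have inE1 e : (e \in E1) = (e \in E) && (N n <= e)%N by rewrite !inE.
  have [|A1 [/fsubsetP A1E sA1 startA1 sepA1]] := IHn E1.
    apply: NP => [j|]; first by rewrite inE1 => /andP[].
    by apply: Schreier_sub sE' _; apply/fsubsetP => j; rewrite inE1 => /andP[].
  (* The elements before the threshold [N n] escape the induction hypothesis and all become points
     of [A]. *)
  pose E0 := [fset e in E | (e < N n)%N]%fset.
  have inE0 e : (e \in E0) = (e \in E) && (e < N n)%N by rewrite !inE.
  have AE e : e \in (A1 `|` E0)%fset -> e \in E.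
    by rewrite in_fsetU inE0 => /orP[/A1E|/andP[]//]; rewrite inE1 => /andP[].
  exists (A1 `|` E0)%fset; split.
  + by apply/fsubsetP.
  + apply: (N'P n) => [_ /imfsetP[e /= /AE /le_phi[_ + _] ->] //|].
    (* At most [1 + N n] sets of the family [d n], all beyond [N n]; after merging they form a set
       of the next family. *)
    pose L := (phi @` A1)%fset :: [seq [fset phi e]%fset | e <- [seq e <- iota 0 (N n) | e \in E]].
    have LS Q : Q \in L -> S (d n) Q.
      rewrite inE => /predU1P[->|/mapP[e _ ->]]; last exact: Schreier_single.
      apply: (Schreier_spread (q := phi_ n) sA1) => [e eA|e f _ _|e f _ _|e /A1E].
      * by apply: in_imfset.
      * exact: phi_n_incr.
      * exact: phi_incr.
      * by rewrite inE1 => /andP[/le_phi[]].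
    have [t [tL tS pw sz]] := mergeable_all fsP LS.
    have -> : (phi @` (A1 `|` E0))%fset = fcups t.
      rewrite tL /L fcups_cons imfsetU; congr (_ `|` _)%fset.
      apply/fsetP => y; apply/imfsetP/in_fcups => /= [[e eE0 ->]|[_ /mapP[e eE ->]]].
        exists [fset phi e]%fset; last by rewrite inE.
        apply/mapP; exists e => //; move: eE0.
        by rewrite inE0 mem_filter mem_iota.
      rewrite inE => /eqP->; exists e => //; rewrite inE0.
      by move: eE; rewrite mem_filter mem_iota.
    apply: Schreier_pairwise => // y; rewrite tL => /in_fcups[Q QL yQ].
    have [e eE ->] : exists2 e, e \in E & y = phi e.
      move: QL yQ; rewrite inE => /predU1P[->|/mapP[e eE ->]].
        by move=> /imfsetP[e /= /A1E eE ->]; exists e => //; move: eE; rewrite inE1 => /andP[].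
      by rewrite inE => /eqP->; exists e => //; move: eE; rewrite mem_filter => /andP[].
    apply: leq_trans sz _; rewrite /= size_map ltnS.
    have [lt _ _] := le_phi e eE; apply: leq_trans (ltnW lt).
    by rewrite size_filter; apply: leq_trans (count_size _ _) _; rewrite size_iota.
  + move=> y yE; have [yN|Ny] := ltnP y (N n).
      by exists y => //; rewrite in_fsetU inE0 yE yN orbT.
    have [|a aA ay] := startA1 y; first by rewrite inE1 yE.
    by exists a => //; rewrite in_fsetU aA.
  + move=> G /fsubsetP GE sep.
    have [[y yG yN]|nG] := pselect (exists2 y, y \in G & (y < N n)%N); last first.
      apply: sepA1 => [|a y z aA]; last by apply: sep; rewrite in_fsetU aA.
      apply/fsubsetP => y yG; rewrite inE1 GE //= leqNgt; apply/negP => yN.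
      by apply: nG; exists y.
    (* As [y] is itself a point of [A], nothing else can share its gap. *)
    suff -> : G = [fset y]%fset by apply: Schreier_single.
    apply/fsetP => z; rewrite inE; apply/idP/eqP => [zG|->//].
    have yA : y \in (A1 `|` E0)%fset by rewrite in_fsetU inE0 GE ?yN ?orbT.
    case: (ltngtP z y) => // [zy|yz].
      by have := sep y z y yA zG yG zy; rewrite ltnn.
    have [zN|Nz] := ltnP z (N n).
      have zA : z \in (A1 `|` E0)%fset by rewrite in_fsetU inE0 GE ?zN ?orbT.
      by have := sep z y z zA yG zG yz; rewrite ltnn.
    have [|a aA az] := startA1 z; first by rewrite inE1 GE.
    have ya : (y < a)%N by move: (A1E _ aA); rewrite inE1 => /andP[_]; apply: leq_trans.
    have aA' : a \in (A1 `|` E0)%fset by rewrite in_fsetU aA.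
    by have := sep a y z aA' yG zG ya; rewrite ltnNge az.
Qed.

(** Converse of the decomposition, with up to [m] sets of the family [i] for each element of [F].
    The factor [m] is absorbed when the induction on [r] reaches index one; for [r] zero nothing
    absorbs it. *)
Lemma Schreier_compose m i r x : oadd i r x -> m = 1%N \/ ~ is_ozero r ->
  exists psi : nat -> nat, forall (F : {fset nat}) (E : nat -> {fset nat}), S r F ->
    (forall j, j \in F -> exists s, [/\ E j = fcups s, (size s <= m)%N &
       forall Q, Q \in s -> S i Q]) ->
    (forall j y, j \in F -> y \in E j -> (psi j <= y)%N) ->
    (forall j k, j \in F -> k \in F -> (j < k)%N -> fset_lt (E j) (E k)) ->
    S x (fcups [seq E j | j <- F]).
Proof.
elim=> {r x} [z z0|b c hbc IH|b c g lim h IH sup] mr.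
- exists id => F E sF EF _ _.
  have {mr} m1 : m = 1%N by case: mr.
  have [->|[n Fn]] := Schreier_zero_inv z0 sF.
    by rewrite fcups_nil; apply: Schreier_empty.
  have [|s [En sz sS]] := EF n; first by rewrite Fn inE.
  have -> : fcups [seq E j | j <- F] = E n.
    apply/fsetP => y; rewrite Fn; apply/in_fcups/idP => [[_ /mapP[j jn ->]]|yE].
      by move: jn; rewrite inE => /eqP->.
    by exists (E n) => //; apply/mapP; exists n; rewrite ?inE.
  rewrite En; case: s sz sS {En} => [|Q [|? ?]]; rewrite m1 // => _ sS.
    by rewrite fcups_nil; apply: Schreier_empty.
  by rewrite fcups_cons fcups_nil fsetU0; apply: sS; rewrite inE.
- have [mb|nmb] := pselect (m = 1%N \/ ~ is_ozero b).
    have [psi psiP] := IH mb.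
    exists (fun j => maxn (psi j) j) => F E /Schreier_succ_inv[s [Fs _ sS pw sz]] EF psiE lt.
    have inF Q j : Q \in s -> j \in Q -> j \in F.
      by move=> Qs jQ; rewrite Fs; apply/in_fcups; exists Q.
    have -> : fcups [seq E j | j <- F] = fcups [seq fcups [seq E j | j <- Q] | Q : {fset nat} <- s].
      apply/fsetP => y; apply/in_fcups/in_fcups => [[_ /mapP[j jF ->] yE]|[_ /mapP[Q Qs ->]]].
        move: jF; rewrite /= {1}Fs => /in_fcups[Q Qs jQ].
        exists (fcups [seq E j | j <- Q]); first by apply/mapP; exists Q.
        by apply/in_fcups; exists (E j) => //; apply/mapP; exists j.
      move=> /in_fcups[_ /mapP[j jQ ->] yE]; exists (E j) => //; apply/mapP; exists j => //.
      exact: inF jQ.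
    apply: Schreier_pairwise => [_ /mapP[Q Qs ->]||y].
    + apply: psiP => [|j jQ|j y jQ yE|j k jQ kQ]; first exact: sS.
      * by apply: EF; apply: inF jQ.
      * by have := psiE j y (inF _ _ Qs jQ) yE; rewrite geq_max => /andP[].
      * by apply: lt; [apply: inF jQ|apply: inF kQ].
    + rewrite pairwise_map.
      have sub : {in s &, forall Q P, fset_lt Q P ->
          relpre (fun Q : {fset nat} => fcups [seq E j | j <- Q]) fset_lt Q P}.
        move=> Q P Qs Ps /fset_ltP QP; apply/fset_ltP => y z.
        move=> /in_fcups[_ /mapP[j jQ ->] yE] /in_fcups[_ /mapP[k kP ->] zE].
        have /fset_ltP : fset_lt (E j) (E k).
          by apply: lt; [apply: inF jQ|apply: inF kP|apply: QP].
        by apply.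
      by apply: (sub_in_pairwise sub _ pw); apply/allP.
    + move=> /in_fcups[_ /mapP[Q Qs ->] /in_fcups[_ /mapP[j jQ ->] yE]].
      have jF := inF _ _ Qs jQ.
      rewrite size_map; apply: leq_trans (sz j jF) _; rewrite ltnS.
      by have := psiE j y jF yE; rewrite geq_max => /andP[].
  have b0 : is_ozero b by apply: contrapT => nb; apply: nmb; right.
  (* Index one: [F] has at most [j.+1] elements for each [j] in [F], so at most [m * j.+1] sets have
     to be merged. *)
  exists (fun j => m * j.+1)%N => F E /Schreier_succ_inv[s [Fs _ sS pw sz]] EF psiE lt.
  have /choice[e eP] : forall j, exists s', j \in F ->
      [/\ E j = fcups s', (size s' <= m)%N & forall Q, Q \in s' -> S i Q].
    move=> j; have [jF|] := boolP (j \in F); last by exists [::].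
    by have [s' ?] := EF j jF; exists s'.
  pose L := flatten [seq e j | j <- F].
  have [|t [tL tS pwt szt]] := mergeable_all fsP (x := i) (s := L).
    by move=> Q /flattenP[_ /mapP[j jF ->]]; have [_ _] := eP j jF; apply.
  have -> : fcups [seq E j | j <- F] = fcups t.
    rewrite tL; apply/fsetP => y; apply/in_fcups/in_fcups => [[_ /mapP[j jF ->]]|[Q]].
      have [-> _ _] := eP j jF; move=> /in_fcups[Q Qe yQ]; exists Q => //.
      by apply/flattenP; exists (e j) => //; apply/mapP; exists j.
    move=> /flattenP[_ /mapP[j jF ->] Qe] yQ; exists (E j); first by apply/mapP; exists j.
    by have [-> _ _] := eP j jF; apply/in_fcups; exists Q.
  rewrite (oadd_zero b0 hbc); apply: Schreier_pairwise => // y.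
  rewrite tL => /in_fcups[Q /flattenP[_ /mapP[j jF ->] Qe] yQ].
  apply: leq_trans szt _; apply: leqW; apply: leq_trans (psiE j y jF _); last first.
    by have [-> _ _] := eP j jF; apply/in_fcups; exists Q.
  apply: leq_trans (_ : m * #|` F| <= _)%N.
    rewrite size_flatten /shape -map_comp sumnE big_map.
    rewrite -[#|` F|]/(size F) -sum1_size big_distrr /=.
    rewrite big_seq [leqRHS]big_seq; apply: leq_sum => k kF.
    by rewrite muln1; have [] := eP k kF.
  rewrite leq_mul2l; apply/orP; right; apply: leq_trans (sz j jF).
  rewrite Fs; apply: card_fcups => P Ps.
  have [->|[n ->]] := Schreier_zero_inv b0 (sS P Ps); first by rewrite cardfs0.
  by rewrite cardfs1.
- have limc := oadd_limit lim (oadd_lim lim h sup).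
  (* The indices used below the limit are successors, hence nonzero, so the induction hypothesis
     applies for any [m]. *)
  have db n : (osucc (fs b n) < b)%O by apply: olimit_succ => //; apply: fs_lt.
  have dc n : (g (osucc (fs b n)) < c)%O.
    exact: oadd_lt (h _ (db n)) (oadd_lim lim h sup) (db n).
  have [psi psiP] := choice (fun n => IH _ (db n) (or_intror (@not_ozero_succ _))).
  have [N NP] := choice (fun n => Schreier_lt fsP (dc n)).
  have [phi [_ phiP]] := dominating_incr (fun n e => maxn (N n) (psi n e)).
  exists phi => F E sF EF phiE lt.
  have [->|[n [nF sF']]] := Schreier_limit_inv lim sF.
    by rewrite fcups_nil; apply: Schreier_empty.
  have hE j y : j \in F -> y \in E j -> (N n <= y /\ psi n j <= y)%N.
    move=> jF yE; have := leq_trans (phiP n j (nF j jF)) (phiE j y jF yE).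
    by rewrite geq_max => /andP[].
  apply: (NP n) => [y /in_fcups[_ /mapP[j jF ->] yE]|].
    by have [] := hE j y jF yE.
  by apply: psiP => // j y jF yE; have [] := hE j y jF yE.
Qed.

End composition.

(** * Weights on the integers *)

Lemma eventually_all (P : nat -> nat -> Prop) :
  (forall n, exists N, forall i, (N <= i)%N -> P n i) ->
  forall M, exists N, forall i, (N <= i)%N -> forall n, (n <= M)%N -> P n i.
Proof.
move=> /choice[N NP] M; exists (\max_(n < M.+1) N n)%N => i Ni n nM.
apply: NP; apply: leq_trans Ni.
exact: (@leq_bigmax _ (fun n : 'I_M.+1 => N n) (Ordinal (nM : (n < M.+1)%N))).
Qed.

(** A subsequence [m] with codes [J], built by alternately choosing [J l] beyond
    the blocks already used and [m l] far enough for [Q]. *)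
Lemma thin_subsequence (phi hi : nat -> nat) (Q : nat -> nat -> nat -> nat -> Prop) :
  (forall l j M N, exists2 i, (N <= i)%N & Q l j M i) ->
  exists m J : nat -> nat, [/\ {homo m : a b / (a < b)%N}, {homo J : a b / (a < b)%N},
    forall l, (phi (hi (m l)) <= J l.+1)%N, exists M, Q 0%N (J 0%N) M (m 0%N) &
    forall l, Q l.+1 (J l.+1) (hi (m l)) (m l.+1)].
Proof.
move=> QP.
have /choice[i iP] : forall z : nat * nat * nat * nat, exists i,
    (z.2 <= i)%N /\ Q z.1.1.1 z.1.1.2 z.1.2 i.
  by move=> [[[l j] M] N]; have [p Np Qp] := QP l j M N; exists p.
pose nextJ (z : nat * nat) := maxn z.2.+1 (phi (hi z.1)).
pose next l (z : nat * nat) := (i (l.+1, nextJ z, hi z.1, z.1.+1), nextJ z).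
pose st := fix st l := if l is l'.+1 then next l' (st l') else (i (0, 0, 0, 0), 0)%N.
exists (fun l => (st l).1), (fun l => (st l).2); split.
- apply: homo_ltn => [y x z|l /=]; first exact: ltn_trans.
  exact: (iP (l.+1, nextJ (st l), hi (st l).1, (st l).1.+1)).1.
- by apply: homo_ltn => [y x z|l /=]; [exact: ltn_trans|rewrite leq_max leqnn].
- by move=> l /=; rewrite leq_max leqnn orbT.
- by exists 0%N; exact: (iP (0, 0, 0, 0)%N).2.
- by move=> l; exact: (iP (l.+1, nextJ (st l), hi (st l).1, (st l).1.+1)).2.
Qed.

Section mass.
Variable R : realType.
Implicit Types (w y : nat -> R) (E F : {fset nat}).

Definition mass E w : R := \sum_(i <- E) w i.

Definition nonneg w := forall i, 0 <= w i.

Definition cutoff E w : nat -> R := fun l => if l \in E then w l else 0.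

Lemma cutoff_nonneg E w : nonneg w -> nonneg (cutoff E w).
Proof. by move=> w0 l; rewrite /cutoff; case: ifP. Qed.

Lemma mass0 w : mass fset0 w = 0.
Proof. by rewrite /mass big_seq_fset0. Qed.

Lemma mass1 w n : mass [fset n]%fset w = w n.
Proof. by rewrite /mass big_seq_fset1. Qed.

Lemma mass_ge0 E w : nonneg w -> 0 <= mass E w.
Proof. by move=> w0; apply: sumr_ge0. Qed.

Lemma ler_mass E w y : (forall i, i \in E -> w i <= y i) -> mass E w <= mass E y.
Proof. by move=> h; rewrite /mass big_seq [leRHS]big_seq; apply: ler_sum. Qed.

Lemma mass_split (P : pred nat) E w :
  mass E w = mass [fset i in E | P i]%fset w + mass [fset i in E | ~~ P i]%fset w.
Proof. by rewrite /mass (big_fsetID _ P). Qed.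

Lemma mass_cutoff E F w : mass E (cutoff F w) = mass (E `&` F)%fset w.
Proof.
rewrite (mass_split (mem F)) -[RHS]addr0; congr (_ + _).
  rewrite (_ : [fset i in E | mem F i]%fset = (E `&` F)%fset); last first.
    by apply/fsetP => i; rewrite !inE.
  by apply: eq_big_seq => i; rewrite !inE /cutoff => /andP[_ ->].
by rewrite /mass big_seq big1 // => i; rewrite !inE /cutoff => /andP[_ /negPf ->].
Qed.

Lemma massS E F w : nonneg w -> (E `<=` F)%fset -> mass E w <= mass F w.
Proof.
move=> w0 EF; rewrite [leRHS](mass_split (mem E)).
rewrite (_ : [fset i in F | mem E i]%fset = E) ?lerDl ?mass_ge0 //.
by apply/fsetP => i; rewrite !inE andb_idl // => /(fsubsetP EF).
Qed.

Lemma massU E F w : [disjoint E & F]%fset -> mass (E `|` F)%fset w = mass E w + mass F w.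
Proof.
move=> dEF; rewrite (mass_split (mem E)); congr (mass _ _ + mass _ _); apply/fsetP => i.
  by rewrite !inE; case: (i \in E); rewrite ?andbF.
rewrite !inE; have [iE /=|iE /=] := boolP (i \in E); last by rewrite andbT.
by rewrite (negPf (fdisjointP dEF i iE)) ?andbF.
Qed.

Lemma mass_leU E F w : nonneg w -> mass (E `|` F)%fset w <= mass E w + mass F w.
Proof.
move=> w0; rewrite (_ : (E `|` F) = E `|` (F `\` E))%fset; last first.
  by apply/fsetP => i; rewrite !inE; case: (i \in E).
rewrite massU ?lerD2l ?massS ?fsubsetDl //.
by apply/fdisjointP => i iE; rewrite !inE iE.
Qed.

Lemma mass_fcups_le (s : seq {fset nat}) w c : nonneg w ->
  (forall Q, Q \in s -> mass Q w <= c) -> mass (fcups s) w <= (size s)%:R * c.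
Proof.
move=> w0; elim: s => [_|Q s IH h]; first by rewrite fcups_nil mass0 mul0r.
rewrite fcups_cons; apply: le_trans (mass_leU _ _ w0) _.
rewrite /= -[(size s).+1]add1n natrD mulrDl mul1r lerD //.
  by apply: h; rewrite inE eqxx.
by apply: IH => P Ps; apply: h; rewrite inE Ps orbT.
Qed.

Lemma mass_fcups (s : seq nat) (E : nat -> {fset nat}) w : uniq s ->
  (forall j k, j \in s -> k \in s -> (j < k)%N -> fset_lt (E j) (E k)) ->
  mass (fcups [seq E j | j <- s]) w = \sum_(j <- s) mass (E j) w.
Proof.
elim: s => [_ _|a s IH /= /andP[as_ us] lt]; first by rewrite fcups_nil mass0 big_nil.
rewrite fcups_cons big_cons massU ?IH //.
  by move=> j k js ks; apply: lt; rewrite inE ?js ?ks orbT.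
apply/fdisjointP => i iE; apply/in_fcups => -[_ /mapP[j js ->] iEj].
have aj : a != j by apply: contraNneq as_ => ->.
have [ltaj|ltja] := ltnP a j.
  have /fset_ltP : fset_lt (E a) (E j) by apply: lt; rewrite ?inE ?eqxx ?js ?orbT.
  by move=> /(_ i i iE iEj); rewrite ltnn.
have /fset_ltP : fset_lt (E j) (E a).
  apply: lt; rewrite ?inE ?eqxx ?js ?orbT //.
  by rewrite ltn_neqAle ltja eq_sym aj.
by move=> /(_ i i iEj iE); rewrite ltnn.
Qed.

Lemma sum_fset_ord n (F : {fset nat}) (b : nat -> R) : (forall i, i \in F -> i < n)%N ->
  \sum_(i < n) (if val i \in F then b i else 0) = \sum_(i <- F) b i.
Proof.
move=> Fn; rewrite -(big_mkord xpredT (fun i => if i \in F then b i else 0)).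
rewrite -big_mkcond -big_filter; apply: perm_big; apply: uniq_perm.
- by rewrite filter_uniq ?iota_uniq.
- exact: fset_uniq.
- move=> i; rewrite mem_filter mem_index_iota /=; case: (boolP (i \in F)) => //= iF.
  exact: Fn.
Qed.

Lemma exists_argmax (T : eqType) (s : seq T) (f : T -> R) : s != [::] ->
  exists2 x, x \in s & forall z, z \in s -> f z <= f x.
Proof.
elim: s => // a [|b s] IH _.
  by exists a; rewrite ?inE // => z; rewrite inE => /eqP->.
have [//|x xs xmax] := IH; have [ax|xa] := leP (f a) (f x).
  by exists x => [|z]; rewrite inE ?xs ?orbT // => /predU1P[->//|/xmax].
exists a => [|z]; rewrite inE ?eqxx // => /predU1P[->//|/xmax].
by move=> zx; apply: le_trans zx (ltW xa).
Qed.

Lemma sum_half n : \sum_(i < n) (1/2%:R) ^+ i.+1 <= 1 :> R.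
Proof.
suff -> : \sum_(i < n) (1/2%:R) ^+ i.+1 = 1 - (1/2%:R) ^+ n :> R.
  by rewrite gerBl exprn_ge0 // divr_ge0.
elim: n => [|n IH]; first by rewrite big_ord0 expr0 subrr.
by rewrite big_ord_recr /= IH exprS; lra.
Qed.

End mass.

(** * The upper estimate *)

Section weights.
Variables (R : realType) (fs : omega1 -> nat -> omega1).
Hypothesis fsP : fundamental_system fs.
Local Notation S := (Schreier fs).
Implicit Types (w : nat -> R) (E F : {fset nat}) (hi J : nat -> nat).

(** For [w] the moduli of the coordinates of a vector, this says that its norm in the space of index
    [x] is at most [t]. The relational form needs no supremum and applies to weights that are not
    finitely supported. *)
Definition sle x w (t : R) := forall E, S x E -> mass E w <= t.

Lemma sle_ge0 x w t : sle x w t -> 0 <= t.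
Proof. by move=> /(_ fset0); rewrite mass0; apply; apply: Schreier_empty. Qed.

Lemma sle_mono x w (y : nat -> R) t : (forall l, w l <= y l) -> sle x y t -> sle x w t.
Proof. by move=> wy yt E /yt; apply: le_trans; apply: ler_mass. Qed.

Lemma sle_le x w t u : t <= u -> sle x w t -> sle x w u.
Proof. by move=> tu wt E /wt /le_trans; apply. Qed.

Lemma sle_cutoff x w t F : nonneg w -> sle x w t -> sle x (cutoff F w) t.
Proof.
move=> w0; apply: sle_mono => l; rewrite /cutoff; case: ifP => // _; exact: w0.
Qed.

Lemma sle_scale x w t c : 0 <= c -> sle x w t -> sle x (fun l => c * w l) (c * t).
Proof.
by move=> c0 wt E /wt h; rewrite /mass -mulr_sumr ler_wpM2l.
Qed.

Lemma sle_mass x w F : nonneg w -> sle x (cutoff F w) (mass F w).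
Proof.
by move=> w0 E _; rewrite mass_cutoff massS //; apply: fsubsetIr.
Qed.

(** The [i]-th weight lives in the integer interval from [hi i.-1] (excluded)
    to [hi i]. *)
Definition blocks hi (v : nat -> nat -> R) := forall i l, v i l != 0 ->
  (l <= hi i)%N /\ forall k, (k < i)%N -> (hi k < l)%N.

Lemma blocks_sub hi (v : nat -> nat -> R) (m : nat -> nat) :
  {homo m : a b / (a < b)%N} -> blocks hi v -> blocks (hi \o m) (v \o m).
Proof. by move=> mh b i l /b[lh hl]; split => // k /mh /hl. Qed.

Lemma blocks_escape hi (v : nat -> nat -> R) M : {homo hi : a b / (a < b)%N} ->
  blocks hi v -> exists N, forall i, (N <= i)%N -> forall l, v i l != 0 -> (M <= l)%N.
Proof.
move=> hh b; exists M.+1 => i Mi l /b[_ /(_ M Mi)].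
by apply: leq_trans; apply: leqW; apply: incr_ge.
Qed.

(** A set of the family [iota] that starts early is made of a bounded number
    of sets of earlier families. *)
Lemma thin_blocks (iota : omega1) hi (v : nat -> nat -> R) : {homo hi : a b / (a < b)%N} ->
  blocks hi v -> (forall i, nonneg (v i)) ->
  (forall eta eps, (eta < iota)%O -> 0 < eps -> exists N, forall i, (N <= i)%N ->
     sle eta (v i) eps) ->
  forall M eps, 0 < eps -> exists N, forall i, (N <= i)%N -> forall G a, S iota G ->
    a \in G -> (a <= M)%N -> mass G (v i) <= eps.
Proof.
move=> hh b v0 small M eps e0.
have [i0|eta Ei|lim] := ordinal_kindP iota.
- have [N NP] := blocks_escape M.+1 hh b; exists N => i Ni G a sG aG aM.
  have [G0|[n Gn]] := Schreier_zero_inv i0 sG; first by rewrite G0 inE in aG.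
  move: aG; rewrite Gn inE => /eqP an; rewrite mass1 -an.
  have [->|/(NP i Ni)] := eqVneq (v i a) 0; first exact: ltW.
  by rewrite ltnNge aM.
- have [||N NP] := small eta (eps / M.+1%:R).
  + by rewrite Ei osucc_gt.
  + by rewrite divr_gt0.
  exists N => i Ni G a; rewrite Ei => /Schreier_succ_inv[s [-> _ sS _ sz]] aG aM.
  have h := mass_fcups_le (v0 i) (fun Q Qs => NP i Ni Q (sS Q Qs)).
  apply: le_trans h _; rewrite mulrA ler_pdivrMr // [leLHS]mulrC ler_pM2l // ler_nat.
  by apply: leq_trans (sz a aG) _; rewrite ltnS.
- have [|N NP] := @eventually_all (fun n i => sle (osucc (fs iota n)) (v i) eps) _ M.
    by move=> n; apply: small => //; apply: olimit_succ => //; apply: fs_lt.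
  exists N => i Ni G a sG aG aM.
  have [G0|[n [nG sG']]] := Schreier_limit_inv lim sG; first by rewrite G0 inE in aG.
  by apply: (NP i Ni n) => //; apply: leq_trans (nG a aG) aM.
Qed.

(** The exponent is shifted so that block [j] costs the [j]-th term of the series summed in
    [sum_half]. *)
Definition thin iota hi (v : nat -> nat -> R) := forall i G a, S iota G -> a \in G ->
  (a <= hi i)%N -> mass G (v i.+1) <= (1/2%:R) ^+ i.+2.

(** One half of condition (iv), in terms of moduli: [t] bounds the norm of
    [sum_i b_i e_(J i)] in [X_rho]. *)
Definition upper x rho J (v : nat -> nat -> R) C := forall n (b : nat -> R) t,
  nonneg b -> (forall F, (forall i, i \in F -> i < n)%N -> S rho (J @` F)%fset ->
    \sum_(i <- F) b i <= t) ->
  forall E, S x E -> \sum_(i < n) b i * mass E (v i) <= C * t.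

(** If no point of [A] falls in block [i], then [E] meets the block inside a set of the family
    [iota] that starts in an earlier block, and thinness makes the mass negligible. The other blocks
    are counted by points of [A], that is, by a set of the family [rho]. The constant 3 is 2 for the
    latter and 1 for the geometric series. *)
Lemma upperP (iota rho x : omega1) phi hi J (v : nat -> nat -> R) :
  {homo phi : a b / (a < b)%N} ->
  (forall E, S x E -> exists A : {fset nat}, [/\ (A `<=` E)%fset, S rho (phi @` A)%fset,
    (forall y, y \in E -> exists2 a, a \in A & (a <= y)%N) &
    forall G, (G `<=` E)%fset ->
      (forall a y z, a \in A -> y \in G -> z \in G -> y < a -> z < a)%N -> S iota G]) ->
  {homo hi : a b / (a < b)%N} -> {homo J : a b / (a < b)%N} ->
  (forall i, phi (hi i) <= J i.+1)%N -> blocks hi v -> (forall i, nonneg (v i)) ->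
  (forall i, sle x (v i) 1) -> thin iota hi v -> upper x rho J v 3%:R.
Proof.
move=> phih dec hh Jh phiJ bv v0 v1 thv n b t b0 bt E sE.
have [A [/fsubsetP AE sA startA sepA]] := dec E sE.
have t0 : 0 <= t.
  have := bt fset0; rewrite big_seq_fset0; apply => //.
  by rewrite imfset0; apply: Schreier_empty.
have bit i : (i < n)%N -> b i <= t.
  move=> i_n; have := bt [fset i]%fset; rewrite big_seq_fset1; apply.
    by move=> j; rewrite inE => /eqP->.
  rewrite (_ : _ @` _ = [fset J i])%fset; first exact: Schreier_single.
  by apply/fsetP => y; rewrite inE; apply/imfsetP/eqP => /= [[j]|->];
    [rewrite inE => /eqP->|exists i; rewrite ?inE].
(* The point [a] lies in the integer interval of block [i]. *)
pose reg i a := (a <= hi i)%N && all (fun k => hi k < a)%N (seq.iota 0 i).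
have regP i a : reflect ((a <= hi i)%N /\ forall k, (k < i)%N -> (hi k < a)%N) (reg i a).
  apply: (iffP andP) => -[ahi h]; split => //.
    by move=> k ki; move/allP: h; apply; rewrite mem_iota.
  by apply/allP => k; rewrite mem_iota; apply: h.
have [I0 inI0] : exists I0 : {fset nat}, forall i, (i \in I0) = (i < n)%N && has (reg i) A.
  by exists [fset i in seq.iota 0 n | has (reg i) A]%fset => i; rewrite !inE mem_iota.
have off i : (i < n)%N -> i \notin I0 -> mass E (v i) <= (1/2%:R) ^+ i.+1.
  move=> i_n; rewrite inI0 i_n /= => /hasPn noA.
  have [[y yE vy]|none] := pselect (exists2 y, y \in E & v i y != 0); last first.
    rewrite /mass big_seq big1 ?exprn_ge0 // => y yE.
    by apply/eqP; apply: contrapT => /negP vy; apply: none; exists y.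
  have [a0 a0A a0y] := startA y yE.
  (* The last point of [A] up to [y] lies before block [i], so the part of [E] from [a] to the end
     of the block is in one gap of [A]. *)
  have [|a] := @fset_maxP [fset a in A | (a <= y)%N]%fset.
    by apply/fset0Pn; exists a0; rewrite !inE a0A.
  rewrite !inE => /andP[aA ay] amax; have [yhi yk] := bv i y vy.
  have [k ki ak] : exists2 k, (k < i)%N & (a <= hi k)%N.
    apply: contrapT => nk; have := noA a aA; move/negP; apply; apply/regP; split.
      exact: leq_trans ay yhi.
    by move=> k ki; rewrite ltnNge; apply/negP => ak; apply: nk; exists k.
  case: i ki i_n noA vy yhi yk => // i; rewrite ltnS => ki i_n noA vy yhi yk.
  have {ak ki}ai : (a <= hi i)%N.
    by move: ki; rewrite leq_eqVlt => /predU1P[<-//|/hh]; lia.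
  pose G := [fset z in E | (a <= z <= hi i.+1)%N]%fset.
  have -> : mass E (v i.+1) = mass G (v i.+1).
    rewrite (mass_split (fun z => a <= z <= hi i.+1)%N) [X in _ + X](_ : _ = 0) ?addr0 //.
    rewrite /mass big_seq big1 // => z; rewrite !inE => /andP[_ nz].
    apply/eqP; apply: contraNT nz => /bv[-> /(_ i (leqnn _)) iz].
    by rewrite andbT; apply: leq_trans ai (ltnW iz).
  apply: (thv i G a) => //; last by rewrite !inE AE // leqnn /= (leq_trans ay yhi).
  apply: sepA => [|a' y' z' a'A]; first by apply/fsubsetP => z; rewrite !inE => /andP[].
  rewrite !inE => /and3P[_ ay' _] /and3P[_ _ z'hi] y'a'; rewrite ltnNge; apply/negP => a'z'.
  have := noA a' a'A; move/negP; apply; apply/regP; split.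
    exact: leq_trans a'z' z'hi.
  move=> k' ki; apply: ltn_trans (yk k' ki) _; rewrite ltnNge; apply/negP => a'y.
  have := amax a'; rewrite !inE a'A a'y => /(_ isT).
  by rewrite leqNgt (leq_ltn_trans ay' y'a').
(* The least index costs one [t] and is put aside, because the code [J i] is large only compared
   with blocks preceding [i]. *)
have on : \sum_(i <- I0) b i <= t + t.
  have [->|I0n] := eqVneq I0 fset0; first by rewrite big_seq_fset0 addr_ge0.
  have [m mI0 mmin] := fset_minP I0n.
  rewrite (big_fsetD1 m) //= lerD //; first by apply: bit; move: mI0; rewrite inI0 => /andP[].
  apply: bt => [i|]; first by rewrite in_fsetD1 inI0 => /and3P[].
  have /choice[aa aaP] : forall i, exists a, i \in I0 -> a \in A /\ reg i a.
    move=> i; have [|_] := boolP (i \in I0); last by exists 0%N.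
    by rewrite inI0 => /andP[_ /hasP[a aA ra]]; exists a.
  (* Each remaining [i] is charged to a point of [A] in the preceding block [pr i] of [I0]; its
     image under [phi] is at most [J i], so spreading applies. *)
  have /choice[pr prP] : forall i, exists k, i \in (I0 `\ m)%fset ->
      [/\ k \in I0, (k < i)%N & forall j, j \in I0 -> (j < i)%N -> (j <= k)%N].
    move=> i; have [|_] := boolP (i \in (I0 `\ m)%fset); last by exists 0%N.
    rewrite in_fsetD1 => /andP[im iI0].
    have [|k] := @fset_maxP [fset k in I0 | (k < i)%N]%fset.
      by apply/fset0Pn; exists m; rewrite !inE mI0 ltn_neqAle eq_sym im mmin.
    rewrite !inE => /andP[kI0 ki] kmax; exists k; split => // j jI0 ji.
    by apply: kmax; rewrite !inE jI0.
  apply: (Schreier_spread (u := J) (q := phi \o aa \o pr) sA) => [i|i j|i j _ _ /Jh //|i] /=.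
  - by move=> /prP[/aaP[aA _] _ _]; apply: in_imfset.
  - move=> iI jI ij; apply: phih; have [pi pii _] := prP i iI; have [pj _ pjmax] := prP j jI.
    have ipj : (i <= pr j)%N by apply: pjmax => //; move: iI; rewrite in_fsetD1 => /andP[].
    have [_ /regP[hi1 _]] := aaP _ pi; have [_ /regP[_ hi2]] := aaP _ pj.
    by apply: leq_ltn_trans hi1 (hi2 _ _); apply: leq_trans pii ipj.
  - move=> iI; have [pi pii _] := prP i iI; have [_ /regP[hi1 _]] := aaP _ pi.
    apply: (@leq_trans (phi (hi (pr i)))).
      by move: hi1; rewrite leq_eqVlt => /predU1P[->//|/phih/ltnW].
    apply: leq_trans (phiJ _) _.
    by move: pii; rewrite leq_eqVlt => /predU1P[->//|/Jh/ltnW].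
apply: (@le_trans _ _ (\sum_(i < n) ((if val i \in I0 then b i else 0) + t * (1/2%:R) ^+ i.+1))).
  apply: ler_sum => i _; have [iI0|iI0] := boolP (val i \in I0).
    apply: (@le_trans _ _ (b i)); last by rewrite lerDl mulr_ge0 ?exprn_ge0.
    by rewrite ler_piMr // v1.
  rewrite add0r; apply: ler_pM => //; first exact: mass_ge0.
    exact: bit.
  exact: off.
rewrite big_split /= sum_fset_ord => [|i]; last by rewrite inI0 => /andP[].
rewrite -mulr_sumr; have := ler_wpM2l t0 (sum_half R n).
by move: on; rewrite mulr1; lra.
Qed.

(** A finite pairing; it is used with [H = (hi i).+1], which exceeds the support of block [i]. *)
Definition dot H w (y : nat -> R) : R := \sum_(l < H) w l * y l.

(** The lower estimate: [y |-> sum_i (dot (w i) y) e_(J i)] is bounded on [X_x]. *)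
Definition lower x rho hi J (w : nat -> nat -> R) C := forall (y : nat -> R) t, nonneg y ->
  sle x y t -> forall F, S rho (J @` F)%fset ->
  \sum_(i <- F) dot (hi i).+1 (w i) y <= C * t.

End weights.

(** * Block sequences *)

Lemma inv_nat_small (R : realType) (eps : R) : 0 < eps ->
  exists N, forall i, (N <= i)%N -> (i.+1%:R)^-1 <= eps.
Proof.
move=> e0; exists (Num.bound eps^-1) => i Ni.
rewrite invf_ple ?posrE //; apply: ltW.
apply: lt_le_trans (archi_boundP _) _; first by rewrite invr_ge0 ltW.
by rewrite ler_nat leqW.
Qed.

Lemma Schreier_compose_coded fs : fundamental_system fs ->
  forall m i r x, oadd i r x -> m = 1%N \/ ~ is_ozero r ->
  exists psi : nat -> nat, forall (J : nat -> nat) (F : {fset nat}) (E : nat -> {fset nat}),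
    {homo J : a b / (a < b)%N} -> Schreier fs r (J @` F)%fset ->
    (forall j, j \in F -> exists s, [/\ E j = fcups s, (size s <= m)%N &
       forall Q, Q \in s -> Schreier fs i Q]) ->
    (forall j y, j \in F -> y \in E j -> (psi (J j) <= y)%N) ->
    (forall j k, j \in F -> k \in F -> (j < k)%N -> fset_lt (E j) (E k)) ->
    Schreier fs x (fcups [seq E j | j <- F]).
Proof.
move=> fsP m i r x h mr; have [psi psiP] := Schreier_compose fsP h mr.
exists psi => J F E Jh sF EF psiE lt.
(* [K] is a left inverse of [J], with the irrelevant value 0 off its range. *)
have /choice[K KP] : forall j, exists k, forall l, J l = j -> l = k.
  move=> j; have [[k <-]|nk] := pselect (exists k, J k = j).
    by exists k => l /(incr_inj Jh).
  by exists 0%N => l Jl; case: nk; exists l.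
have JK l : K (J l) = l by rewrite -(KP (J l) l).
have -> : fcups [seq E j | j <- F] = fcups [seq E (K j) | j <- (J @` F)%fset].
  apply/fsetP => y; apply/in_fcups/in_fcups => -[_ /mapP[j jF ->]] yE.
    exists (E j) => //; apply/mapP; exists (J j); last by rewrite JK.
    exact: in_imfset.
  move: jF yE => /imfsetP[l /= lF ->]; rewrite JK => yE.
  by exists (E l) => //; apply/mapP; exists l.
apply: psiP => // [j|j y|j k].
- by move=> /imfsetP[l /= lF ->]; rewrite JK; apply: EF.
- by move=> /imfsetP[l /= lF ->]; rewrite JK; apply: psiE.
- move=> /imfsetP[l /= lF ->] /imfsetP[l' /= l'F ->]; rewrite !JK => ll'.
  apply: lt => //; case: (ltngtP l l') ll' => // [/Jh|->]; last by rewrite ltnn.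
  by move=> ll'; rewrite ltnNge (ltnW ll').
Qed.

Section block_sequences.
Variables (R : realType) (fs : omega1 -> nat -> omega1).
Hypothesis fsP : fundamental_system fs.
Local Notation S := (Schreier fs).
Local Notation sle := (@sle R fs).
Local Notation upper := (@upper R fs).
Local Notation lower := (@lower R fs).

Lemma dot_ind H (E : {fset nat}) (y : nat -> R) : (forall l, l \in E -> l < H)%N ->
  dot H (fun l => (l \in E)%:R) y = mass E y.
Proof.
move=> EH; rewrite /mass -(sum_fset_ord y EH) /dot.
by apply: eq_bigr => l _; case: ifP; rewrite ?mul1r ?mul0r.
Qed.

Lemma blocks_lt hi (v : nat -> nat -> R) (E : nat -> {fset nat}) : blocks hi v ->
  (forall i l, l \in E i -> v i l != 0) ->
  forall j k, (j < k)%N -> fset_lt (E j) (E k).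
Proof.
move=> b Ev j k jk; apply/fset_ltP => l l' /Ev/b[lh _] /Ev/b[_ /(_ _ jk)].
exact: leq_ltn_trans.
Qed.

(** The core of (1) for moduli. The threshold 1/2 expresses that the norms stay away from zero,
    which makes [xi] itself an index whose norm does not tend to zero. *)
Theorem block_core xi hi (v : nat -> nat -> R) : {homo hi : a b / (a < b)%N} ->
  blocks hi v -> (forall i, nonneg (v i)) -> (forall i, sle xi (v i) 1) ->
  (forall i, ~ sle xi (v i) (1/2%:R)) ->
  exists (m J : nat -> nat) rho (E : nat -> {fset nat}) (delta : R),
    [/\ {homo m : a b / (a < b)%N}, {homo J : a b / (a < b)%N}, remainders xi rho &
        0 < delta] /\
    [/\ forall i, S xi (E i), forall i l, l \in E i -> v (m i) l != 0,
        forall i, delta <= mass (E i) (v (m i)), upper xi rho J (v \o m) 3%:R &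
        lower xi rho (hi \o m) J (fun i l => (l \in E i)%:R) 1].
Proof.
move=> hh bv v0 v1 vhalf.
pose big eta := exists2 eps : R, 0 < eps & forall N, exists2 i, (N <= i)%N & ~ sle eta (v i) eps.
have [|iota [[eps e0 ibig] imin]] := @omega1_min [set eta | big eta].
  by exists xi, (1/2%:R) => [|N]; [rewrite divr_gt0|exists N].
have ixi : (iota <= xi)%O.
  by apply: imin; exists (1/2%:R) => [|N]; [rewrite divr_gt0|exists N].
have small eta e : (eta < iota)%O -> 0 < e -> exists N, forall i, (N <= i)%N -> sle eta (v i) e.
  move=> lt e1; apply: contrapT => nN; have /imin : big eta; last by rewrite leNgt lt.
  exists e => // N; apply: contrapT => ni; apply: nN; exists N => i Ni.
  by apply: contrapT => nsle; apply: ni; exists i.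
have [rho hrho] := remainder_exists ixi.
have [phi [phih dec]] := Schreier_decompose fsP hrho.
have [psi psiP] := Schreier_compose_coded fsP hrho (or_introl (erefl 1%N)).
have [N0 N0P] := Schreier_le fsP ixi.
(* Three demands on a block: a set of the family [iota] with mass above [eps]; support past [psi j]
   for the lower estimate and past [N0], where this family enters the family [xi]; thinness relative
   to the end [M] of the preceding block. *)
pose Q l j M i := [/\ exists2 G, S iota G & eps < mass G (v i),
  forall l', v i l' != 0 -> (maxn (psi j) N0 <= l')%N &
  forall G a, S iota G -> a \in G -> (a <= M)%N -> mass G (v i) <= (1/2%:R) ^+ l.+1].
have [|m [J [mh Jh phiJ [M Q0] QS]]] := @thin_subsequence phi hi Q.
  move=> l j M N.
  have [N1 N1P] := blocks_escape (maxn (psi j) N0) hh bv.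
  have [|N2 N2P] := thin_blocks fsP hh bv v0 small M (eps := (1/2%:R) ^+ l.+1).
    by rewrite exprn_gt0 ?divr_gt0.
  have [i + ns] := ibig (maxn N (maxn N1 N2)); rewrite !geq_max => /and3P[Ni N1i N2i].
  exists i => //; split; [|exact: N1P|exact: N2P].
  apply: contrapT => nG; apply: ns => G sG; rewrite leNgt; apply/negP => lt.
  by apply: nG; exists G.
have Qall i : exists M', Q i (J i) M' (m i).
  by case: i => [|i]; [exists M|exists (hi (m i))].
have /choice[G GP] : forall i, exists G, S iota G /\ eps < mass G (v (m i)).
  by move=> i; have [M' [[G sG lt] _ _]] := Qall i; exists G.
(* Cutting [G i] down to the support makes the sets successive, as required for composition. *)
pose E i := [fset l in G i | v (m i) l != 0]%fset.
have inE' i l : l \in E i -> v (m i) l != 0 by rewrite !inE => /andP[].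
have sE i : S iota (E i).
  have [sG _] := GP i; apply: Schreier_sub sG _.
  by apply/fsubsetP => l; rewrite !inE => /andP[].
have supE i l : l \in E i -> (maxn (psi (J i)) N0 <= l)%N.
  by move=> /inE' vl; have [M' [_ + _]] := Qall i; apply.
exists m, J, rho, E, eps; split; split => //.
- by exists iota.
- move=> i; apply: N0P (sE i) => l /supE; apply: leq_trans; exact: leq_maxr.
- move=> i; have [_ /ltW lt] := GP i; apply: le_trans lt _.
  rewrite (mass_split (fun l => v (m i) l != 0)) -[leRHS]addr0 lerD2l.
  rewrite /mass big_seq big1 // => l; rewrite !inE negbK => /andP[_ /eqP] //.
- apply: (upperP fsP phih dec (hi := hi \o m)) => //.
  + by move=> a b /mh/hh.
  + exact: blocks_sub bv.
  + by move=> i; exact: v0.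
  + by move=> i; exact: v1.
  + by move=> i G' a sG' aG' ahi; have [_ _ h] := QS i; apply: h ahi.
- move=> y t y0 yt F sF; rewrite mul1r.
  under eq_bigr => i _.
    rewrite dot_ind; last first.
      by move=> l /inE' /bv[lh _]; rewrite ltnS.
    over.
  rewrite -mass_fcups ?fset_uniq //.
    apply: yt; apply: (psiP J) => // [j jF|j l jF /supE|j k _ _].
    + by exists [:: E j]; rewrite fcups_cons fcups_nil fsetU0; split => // Q'; rewrite inE => /eqP->.
    + by apply: leq_trans; exact: leq_maxl.
    + exact: blocks_lt (blocks_sub mh bv) inE' _ _.
  by move=> j k _ _; exact: blocks_lt (blocks_sub mh bv) inE' _ _.
Qed.

End block_sequences.

(** * Block sequences of functionals *)

Section telescoping.
Variables (R : realType) (fs : omega1 -> nat -> omega1).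
Hypothesis fsP : fundamental_system fs.
Local Notation S := (Schreier fs).
Local Notation sle := (@sle R fs).

Lemma dot_mono H (w y z : nat -> R) : nonneg w -> (forall l, y l <= z l) ->
  dot H w y <= dot H w z.
Proof. by move=> w0 yz; apply: ler_sum => l _; rewrite ler_wpM2l. Qed.

Lemma dotD H (w y z : nat -> R) : dot H w (fun l => y l + z l) = dot H w y + dot H w z.
Proof. by rewrite -big_split; apply: eq_bigr => l _; rewrite mulrDr. Qed.

Lemma dotZ H (w y : nat -> R) c : dot H w (fun l => c * y l) = c * dot H w y.
Proof. by rewrite /dot mulr_sumr; apply: eq_bigr => l _; rewrite mulrCA. Qed.

(** Greedily remove [m] sets of maximal mass. *)
Lemma greedy_removal eta (D : {fset nat}) (y : nat -> R) m : nonneg y ->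
  exists s, [/\ (size s <= m)%N, forall Q, Q \in s -> S eta Q, (fcups s `<=` D)%fset &
    forall E, S eta E -> (E `<=` D `\` fcups s)%fset -> m%:R * mass E y <= mass (fcups s) y].
Proof.
move=> y0; elim: m => [|m [s [sz sS sD smax]]].
  exists [::]; rewrite fcups_nil; split => // E _ _.
  by rewrite mul0r mass0.
have [|Q] := @exists_argmax R _
    [seq Q : {fset nat} <- fpowerset (D `\` fcups s)%fset | `[< S eta Q >]] (fun Q => mass Q y).
  rewrite -has_filter; apply/hasP; exists fset0; last by apply/asboolP; apply: Schreier_empty.
  by rewrite fpowersetE fsub0set.
rewrite mem_filter fpowersetE => /andP[/asboolP sQ QD] Qmax.
have dQ : [disjoint Q & fcups s]%fset.
  by apply/fdisjointP => i /(fsubsetP QD); rewrite !inE => /andP[].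
exists (Q :: s); rewrite fcups_cons; split => //.
- by move=> P; rewrite inE => /predU1P[->//|]; apply: sS.
- by rewrite fsubUset sD (fsubset_trans QD) ?fsubsetDl.
- move=> E sE ED; rewrite massU // -natr1 mulrDl mul1r addrC lerD //.
    apply: Qmax; rewrite mem_filter fpowersetE; apply/andP; split; first exact/asboolP.
    by apply/fsubsetP => i /(fsubsetP ED); rewrite !inE negb_or => /andP[/andP[_ ->] ->].
  apply: smax => //; apply/fsubsetP => i /(fsubsetP ED).
  by rewrite !inE negb_or => /andP[/andP[_ ->] ->].
Qed.

(** If vectors small for [eta n] are negligible for [w] up to [2 ^- n], then
    [w] is a series of functionals with geometrically small coefficients, the
    [n]-th being controlled by unions of [m n] sets of the family [eta n].
    The greedy sets [G n] telescope: [y] restricted to [G n.+1 \ G n] is small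
    for [eta n]. *)
Lemma dot_telescope xi H (w : nat -> R) N (eta : nat -> omega1) (eps : nat -> R)
    (m : nat -> nat) : nonneg w ->
  (forall y t, nonneg y -> sle xi y t -> dot H w y <= t) ->
  (forall n, 1 <= (m n)%:R * eps n) ->
  (forall n, (n <= N)%N -> forall y, nonneg y -> sle xi y 1 -> sle (eta n) y (eps n) ->
     dot H w y <= (1/2%:R) ^+ n) ->
  forall y t, nonneg y -> sle xi y t ->
  exists G : nat -> {fset nat},
    [/\ forall n, exists s, [/\ G n = fcups s, (size s <= m n)%N &
          forall Q, Q \in s -> S (eta n) Q],
        forall n l, l \in G n -> w l != 0 &
        dot H w y <= \sum_(n < N.+1) 3%:R * (1/2%:R) ^+ n * mass (G n) y + (1/2%:R) ^+ N * t].
Proof.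
move=> w0 dual meps negl y t y0 yt.
pose D := [fset l in seq.iota 0 H | w l != 0]%fset.
have /choice[s sP] := fun n => greedy_removal (eta n) D (m n) y0.
pose G n := fcups (s n).
have meps_gt0 n : 0 < (m n)%:R :> R /\ 0 < eps n.
  have h : 0 < (m n)%:R * eps n by apply: lt_le_trans (meps n).
  have m0 : 0 < (m n)%:R :> R.
    by rewrite lt_neqAle ler0n andbT; apply: contraTneq h => <-; rewrite mul0r ltxx.
  by split => //; rewrite -(pmulr_rgt0 _ m0).
(* Negligibility is assumed on the unit ball only and extends by homogeneity; a zero bound [T] is
   settled by [dual]. *)
have scaled n x T : (n <= N)%N -> nonneg x -> 0 <= T -> sle xi x T ->
    sle (eta n) x (T * eps n) -> dot H w x <= (1/2%:R) ^+ n * T.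
  move=> nN x0; rewrite le_eqVlt => /predU1P[<-|T0] xT xe.
    by rewrite mulr0; apply: dual.
  have -> : x = fun l => T * (T^-1 * x l).
    by apply/funext => l; rewrite mulrA divff ?mul1r // gt_eqF.
  have Ti : 0 <= T^-1 by rewrite invr_ge0 ltW.
  rewrite dotZ mulrC ler_pM2r //; apply: negl => //.
  - by move=> l; rewrite mulr_ge0.
  - by have := sle_scale Ti xT; rewrite mulVf // gt_eqF.
  - by have := sle_scale Ti xe; rewrite mulrA mulVf ?mul1r // gt_eqF.
(* Outside [G n] a set of the family [eta n] has at most a fraction [1 / m n] of the mass of [G n],
   and [1 <= m n * eps n]. *)
have rest n E F : (E `<=` D)%fset -> (forall l, l \in F -> l \in E /\ l \notin G n) ->
    sle (eta n) (cutoff F y) (mass (G n) y * eps n).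
  move=> /fsubsetP ED FE Q sQ; rewrite mass_cutoff.
  have [_ _ _ smax] := sP n; have [m0 e0] := meps_gt0 n.
  have := smax (Q `&` F)%fset; rewrite -/(G n) => h.
  apply: le_trans (_ : (m n)%:R * eps n * mass (Q `&` F)%fset y <= _).
    by rewrite ler_peMl ?mass_ge0.
  rewrite mulrAC ler_pM2r //; apply: h; first exact: Schreier_sub sQ (fsubsetIl _ _).
  by apply/fsubsetP => l; rewrite !inE => /andP[_ /FE[/ED + nG]]; rewrite nG !inE.
have GD n : (G n `<=` D)%fset by have [] := sP n.
have G0 n : 0 <= mass (G n) y by apply: mass_ge0.
have half_ge0 n : 0 <= (1/2%:R) ^+ n :> R by rewrite exprn_ge0 ?divr_ge0.
(* Passing from [G n] to [G n.+1] costs [(1/2) ^+ n] times the sum of both masses. The carried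
   coefficient 2 of the mass of [G n] thus becomes the final 3, and the new mass gets [(1/2) ^+ n],
   which is twice [(1/2) ^+ n.+1]. *)
have partial n : (n <= N)%N -> dot H w (cutoff (G n) y) <=
    \sum_(k < n) 3%:R * (1/2%:R) ^+ k * mass (G k) y + 2%:R * (1/2%:R) ^+ n * mass (G n) y.
  elim: n => [_|n IH nN].
    rewrite big_ord0 expr0 add0r mulr1; apply: le_trans (_ : mass (G 0%N) y <= _).
      by apply: dual; [apply: cutoff_nonneg|apply: sle_mass].
    by rewrite ler_peMl // ler1n.
  have {IH} := IH (ltnW nN); rewrite big_ord_recr /= => IH.
  pose F := (G n.+1 `\` G n)%fset.
  have step : dot H w (cutoff F y) <= (1/2%:R) ^+ n * (mass (G n) y + mass (G n.+1) y).
    apply: scaled; [exact: ltnW|exact: cutoff_nonneg|exact: addr_ge0| |].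
    - apply: (sle_le _ (sle_mass F y0)); apply: le_trans (massS y0 (fsubsetDl _ _)) _.
      by rewrite lerDr.
    - apply: (sle_le _ (rest n (G n.+1) F (GD _) _)) => [|l].
        by rewrite ler_wpM2r ?lerDl // ltW //; case: (meps_gt0 n).
      by rewrite !inE => /andP[].
  apply: le_trans (_ : dot H w (cutoff (G n) y) + dot H w (cutoff F y) <= _).
    rewrite -dotD; apply: dot_mono => // l; rewrite /cutoff !inE.
    case: (l \in G n) => /=; case: (l \in G n.+1) => //=; rewrite ?addr0 ?add0r //.
  have e2 : 2%:R * (1/2%:R) ^+ n.+1 * mass (G n.+1) y = (1/2%:R) ^+ n * mass (G n.+1) y.
    by rewrite exprS mulrA mul1r divff // mul1r.
  by rewrite e2; move: IH step; rewrite mulrDr; lra.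
exists G; split.
- by move=> n; exists (s n); have [] := sP n.
- by move=> n l /(fsubsetP (GD n)); rewrite !inE => /andP[].
have t0 := sle_ge0 yt.
(* The part outside [G N] adds one more mass of [G N], completing the last coefficient to 3. *)
have tail : dot H w (cutoff (D `\` G N)%fset y) <= (1/2%:R) ^+ N * (t + mass (G N) y).
  apply: scaled => //; [exact: cutoff_nonneg|exact: addr_ge0| |].
    by apply: (sle_le _ (sle_cutoff _ y0 yt)); rewrite lerDl.
  apply: (sle_le _ (rest N D _ (fsubset_refl _) _)) => [|l].
    by rewrite ler_wpM2r ?lerDr // ltW //; case: (meps_gt0 N).
  by rewrite !inE => /andP[].
have split_y : dot H w y <= dot H w (cutoff (G N) y) + dot H w (cutoff (D `\` G N)%fset y).
  rewrite -dotD; apply: ler_sum => l _; have [->|wl] := eqVneq (w l) 0.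
    by rewrite !mul0r.
  rewrite ler_wpM2l // /cutoff !inE mem_iota /= add0n ltn_ord wl.
  by case: (val l \in G N); rewrite ?addr0 ?add0r.
by rewrite big_ord_recr /=; move: (partial N (leqnn _)) tail split_y; rewrite mulrDr; lra.
Qed.

End telescoping.

(** * Tested indices and the lower estimate for functionals *)

Section dual_core.
Variables (R : realType) (fs : omega1 -> nat -> omega1).
Hypothesis fsP : fundamental_system fs.
Local Notation S := (Schreier fs).
Local Notation sle := (@sle R fs).
Local Notation upper := (@upper R fs).
Local Notation lower := (@lower R fs).

Variables (xi : omega1) (hi : nat -> nat) (w : nat -> nat -> R).
Hypothesis hi_incr : {homo hi : a b / (a < b)%N}.
Hypothesis wblocks : blocks hi w.
Hypothesis w0 : forall i, nonneg (w i).
Local Notation dotw i := (dot (hi i).+1 (w i)).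
Hypothesis dotw_le : forall i y t, nonneg y -> sle xi y t -> dotw i y <= t.
Hypothesis dotw_ge : forall i, exists y, [/\ nonneg y, sle xi y 1 & 1/2%:R <= dotw i y].

(** The support condition lets the test vectors inherit the blocks of the functionals, so that
    [thin_blocks] and [upperP] apply to them. *)
Definition test_vectors zeta (m : nat -> nat) (delta : R) (v : nat -> nat -> R) :=
  [/\ {homo m : a b / (a < b)%N}, 0 < delta, forall i, nonneg (v i) &
      forall i l, v i l != 0 -> w (m i) l != 0] /\
  [/\ forall i, sle xi (v i) 1, forall i, delta <= dotw (m i) (v i) &
      forall eta eps, (eta < zeta)%O -> 0 < eps ->
        exists N, forall i, (N <= i)%N -> sle eta (v i) eps].

Definition tested zeta := exists m delta v, test_vectors zeta m delta v.

(** This restriction leaves the pairing with [w i] unchanged and increases no norm; it turns an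
    arbitrary witness into a test vector. *)
Definition on_support i (y : nat -> R) : nat -> R := fun l => if w i l == 0 then 0 else y l.

Lemma on_support_nonneg i y : nonneg y -> nonneg (on_support i y).
Proof. by move=> y0 l; rewrite /on_support; case: ifP. Qed.

Lemma on_support_le i y l : nonneg y -> on_support i y l <= y l.
Proof. by move=> y0; rewrite /on_support; case: ifP. Qed.

Lemma dot_on_support i y : dotw i (on_support i y) = dotw i y.
Proof.
apply: eq_bigr => l _; rewrite /on_support.
by case: eqVneq => // ->; rewrite !mul0r.
Qed.

Lemma on_support_neq0 i y l : on_support i y l != 0 -> w i l != 0.
Proof. by rewrite /on_support; case: (eqVneq (w i l) 0) => // _; rewrite eqxx. Qed.

Lemma tested_zero z : is_ozero z -> tested z.
Proof.
move=> z0; have /choice[y yP] := dotw_ge.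
exists id, (1/2%:R), (fun i => on_support i (y i)); split; split => //.
- by move=> i; apply: on_support_nonneg; have [] := yP i.
- by move=> i l; apply: on_support_neq0.
- move=> i; have [y0 y1 _] := yP i; apply: sle_mono y1 => l.
  exact: on_support_le.
- by move=> i; rewrite dot_on_support; have [] := yP i.
- by move=> eta eps; rewrite ltNge z0.
Qed.

(** Along an enumeration of the countable ordinal [kappa], the norms of the
    first [l] indices are dominated by a single one. *)
Lemma dominating_index (g : omega1 -> nat) iota kappa : (iota < kappa)%O ->
  {in [set b | (b <= kappa)%O] &, injective g} ->
  forall l, exists eta N, [/\ (iota <= eta)%O, (eta < kappa)%O &
    forall b, (b < kappa)%O -> (g b < l)%N ->
    forall E, (forall i, i \in E -> (N <= i)%N) -> S b E -> S eta E].
Proof.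
move=> ik ginj; elim=> [|l [eta [N [ie ek NP]]]]; first by exists iota, 0%N.
have [[c ck gc]|nc] := pselect (exists2 c, (c < kappa)%O & g c = l); last first.
  exists eta, N; split => // b bk; rewrite ltnS leq_eqVlt => /predU1P[gb|]; last exact: NP.
  by case: nc; exists b.
have [N1 N1P] : exists N1, forall E, (forall i, i \in E -> (N1 <= i)%N) -> S eta E ->
    S (Order.max eta c) E by apply: Schreier_le; rewrite // le_max lexx.
have [N2 N2P] : exists N2, forall E, (forall i, i \in E -> (N2 <= i)%N) -> S c E ->
    S (Order.max eta c) E by apply: Schreier_le; rewrite // le_max lexx orbT.
exists (Order.max eta c), (maxn N (maxn N1 N2)); split.
- by rewrite le_max ie.
- by rewrite gt_max ek.
- move=> b bk; rewrite ltnS leq_eqVlt => /predU1P[gb|gb] E NE.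
    have -> : b = c by apply: ginj; [apply: mem_set; exact: ltW|apply: mem_set; exact: ltW|rewrite gb gc].
    by apply: N2P => i /NE; rewrite !geq_max => /and3P[].
  have {}NE i : i \in E -> [/\ (N <= i)%N, (N1 <= i)%N & (N2 <= i)%N].
    by move=> /NE; rewrite !geq_max => /and3P[].
  move=> /(NP b bk gb) h; apply: N1P; first by move=> i /NE[].
  by apply: h => i /NE[].
Qed.

Lemma not_tested_negligible iota kappa (m0 : nat -> nat) : (iota < kappa)%O ->
  ~ tested kappa -> {homo m0 : a b / (a < b)%N} ->
  forall n, exists eta (eps : R) N, [/\ (iota <= eta)%O, (eta < kappa)%O, 0 < eps &
    forall i, (N <= i)%N -> forall y, nonneg y -> sle xi y 1 -> sle eta y eps ->
      dotw (m0 i) y <= (1/2%:R) ^+ n].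
Proof.
move=> ik nt m0h n; apply: contrapT => none; apply: nt.
have bad eta eps N : (iota <= eta)%O -> (eta < kappa)%O -> 0 < eps -> exists i y,
    [/\ (N <= i)%N, nonneg y, sle xi y 1, sle eta y eps & (1/2%:R) ^+ n < dotw (m0 i) y].
  move=> ie ek e0; apply: contrapT => nbad; apply: none; exists eta, eps, N.
  split => // i Ni y y0 y1 ye; rewrite leNgt; apply/negP => lt.
  by apply: nbad; exists i, y.
have /countable_injP[g ginj] := omega1_countable kappa.
have /choice[eta] := dominating_index ik ginj.
move=> /choice[N NP].
(* The family [eta l] dominates the earlier ones beyond [N l] only, so the supports must lie
   there. *)
pose Q (l j M i : nat) := (forall l', w (m0 i) l' != 0 -> (N l <= l')%N) /\
  exists y, [/\ nonneg y, sle xi y 1, sle (eta l) y (l.+1%:R)^-1 &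
    (1/2%:R) ^+ n < dotw (m0 i) y].
have [|m [J [mh _ _ [M Q0] QS]]] := @thin_subsequence id id Q.
  move=> l j M N0; have [ie ek _] := NP l.
  have hm0 : {homo hi \o m0 : a b / (a < b)%N} by move=> a b /m0h/hi_incr.
  have [N1 N1P] := blocks_escape (N l) hm0 (blocks_sub m0h wblocks).
  have [|i [y [Ni y0 y1 ye lt]]] := bad (eta l) (l.+1%:R)^-1 (maxn N0 N1) ie ek.
    by rewrite invr_gt0.
  move: Ni; rewrite geq_max => /andP[N0i N1i].
  by exists i => //; split; [exact: N1P|exists y].
have Qall l : (forall l', w (m0 (m l)) l' != 0 -> (N l <= l')%N) /\
  exists y, [/\ nonneg y, sle xi y 1, sle (eta l) y (l.+1%:R)^-1 &
    (1/2%:R) ^+ n < dotw (m0 (m l)) y].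
  by case: l => [|l]; [exact: Q0|exact: (QS l)].
have /choice[y yP] := fun l => (Qall l).2.
exists (m0 \o m), ((1/2%:R) ^+ n), (fun l => on_support (m0 (m l)) (y l)); split; split.
- by move=> a b /mh/m0h.
- by rewrite exprn_gt0 ?divr_gt0.
- by move=> l; apply: on_support_nonneg; have [] := yP l.
- by move=> l l'; apply: on_support_neq0.
- move=> l; have [y0 y1 _ _] := yP l; apply: sle_mono y1 => l'.
  exact: on_support_le.
- by move=> l; rewrite dot_on_support; have [_ _ _ /ltW] := yP l.
- move=> b e bk e0; have [N1 N1P] := inv_nat_small e0.
  exists (maxn N1 (g b).+1) => l; rewrite geq_max => /andP[N1l gl].
  have [y0 y1 ye _] := yP l; have [_ _ dom] := NP l; have [suppN _] := Qall l.
  move=> E sE; apply: le_trans (N1P l N1l).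
  pose E' := [fset l' in E | w (m0 (m l)) l' != 0]%fset.
  have -> : mass E (on_support (m0 (m l)) (y l)) = mass E' (y l).
    rewrite (mass_split (fun l' => w (m0 (m l)) l' != 0)) -[RHS]addr0; congr (_ + _).
      apply: eq_big_seq => l'; rewrite !inE /on_support => /andP[_].
      by case: eqVneq.
    rewrite /mass big_seq big1 // => l'; rewrite !inE negbK /on_support => /andP[_ ->] //.
  apply: ye; apply: dom gl _ _ _ => // [i|].
    by rewrite !inE => /andP[_ /suppN].
  by apply: Schreier_sub sE _; apply/fsubsetP => i; rewrite !inE => /andP[].
Qed.

Lemma sum_half_le2 K : \sum_(n < K) (1/2%:R) ^+ n <= 2%:R :> R.
Proof.
have := sum_half R K; rewrite (eq_bigr (fun n : 'I_K => 1/2%:R * (1/2%:R) ^+ n)).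
  by rewrite -mulr_sumr; lra.
by move=> n _; rewrite exprS.
Qed.

(** For [rho] zero and injective [J] the set [F] has at most one element, so the bound on one
    functional suffices; 8 is taken to agree with the other case. *)
Lemma tested_lower_top rho (m : nat -> nat) J : is_ozero rho -> {homo J : a b / (a < b)%N} ->
  lower xi rho (hi \o m) J (w \o m) 8%:R.
Proof.
move=> r0 Jh y t y0 yt F sF; have t0 := sle_ge0 yt.
have [->|/fset0Pn[i iF]] := eqVneq F fset0; first by rewrite big_seq_fset0 mulr_ge0.
have -> : F = [fset i]%fset.
  have [J0|[n Jn]] := Schreier_zero_inv r0 sF.
    by have : J i \in (J @` F)%fset; [exact: in_imfset|rewrite J0 inE].
  have Jin j : j \in F -> J j = n.
    by move=> jF; have : J j \in (J @` F)%fset; [exact: in_imfset|rewrite Jn inE => /eqP].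
  apply/fsetP => j; rewrite inE; apply/idP/eqP => [jF|->//].
  by apply: (incr_inj Jh); rewrite !Jin.
rewrite big_seq_fset1; apply: le_trans (dotw_le _ y0 yt) _.
by rewrite ler_peMl // ler1n.
Qed.

(** The subsequence is not chosen here: [Q] records what it must satisfy, and all late indices do,
    so thinness of the test vectors can be imposed in the same selection. *)
Lemma tested_lower : exists iota rho m0 delta v0 (Q : nat -> nat -> nat -> Prop),
  [/\ oadd iota rho xi, test_vectors iota m0 delta v0,
    forall l j, exists N, forall i, (N <= i)%N -> Q l j i &
    forall m J, {homo m : a b / (a < b)%N} -> {homo J : a b / (a < b)%N} ->
      (forall l, Q l (J l) (m l)) ->
      lower xi rho (hi \o (m0 \o m)) J (w \o (m0 \o m)) 8%:R].
Proof.
have [[m0 [delta [v0 tv]]]|ntop] := pselect (tested xi).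
  have [z z0] := ozero_exists.
  exists xi, z, m0, delta, v0, (fun _ _ _ => True); split => //; first exact: oadd0.
    by move=> l j; exists 0%N.
  by move=> m J mh Jh _; apply: tested_lower_top.
have [|kappa [nk kmin]] := @omega1_min [set z | ~ tested z]; first by exists xi.
have kxi : (kappa <= xi)%O by apply: kmin.
have [z z0] := ozero_exists.
have zk : (z < kappa)%O.
  rewrite lt_neqAle z0 andbT; apply/eqP => zk; apply: nk.
  by rewrite -zk; apply: tested_zero.
have rem eta : (eta < kappa)%O -> exists r, oadd eta r xi.
  by move=> ek; apply: remainder_exists; apply: ltW; apply: lt_le_trans ek kxi.
(* The least remainder over indices below [kappa], attained at [iota]; by monotonicity it is the
   remainder of every index from [iota] up to [kappa]. *)
have [|rho [[iota ik hrho] rmin]] := @omega1_min [set r | exists2 eta, (eta < kappa)%O & oadd eta r xi].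
  by have [r hr] := rem z zk; exists r, z.
have [m0 [delta [v0 tv]]] : tested iota.
  by apply: contrapT => nt; have := kmin _ nt; rewrite leNgt ik.
have m0h : {homo m0 : a b / (a < b)%N} by case: tv => -[].
have rho0 : ~ is_ozero rho.
  move=> r0; have := lt_le_trans ik kxi.
  by rewrite (oadd_zero r0 hrho) ltxx.
have /choice[eta] := not_tested_negligible ik nk m0h.
move=> /choice[eps] /choice[N NP].
have hrho_n n : oadd (eta n) rho xi.
  have [ie ek _ _] := NP n; have [r hr] := rem _ ek.
  suff <- : r = rho by [].
  by apply/le_anti; rewrite (remainder_anti ie hrho hr) rmin //; exists (eta n).
have /choice[M Meps] : forall n, exists M : nat, 1 <= M%:R * eps n.
  move=> n; have [_ _ e0 _] := NP n; exists (Num.bound (eps n)^-1).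
  rewrite -ler_pdivrMr // div1r; apply: ltW; apply: archi_boundP.
  by rewrite invr_ge0 ltW.
(* Unions of [M n] sets are allowed because [rho] is nonzero. *)
have /choice[psi psiP] := fun n => Schreier_compose_coded fsP (m := M n) (hrho_n n) (or_intror rho0).
(* Only [n <= l] is constrained: the functional in position [l] is expanded to depth [l], so
   finitely many conditions bear on it. *)
pose Q l j i := forall n, (n <= l)%N -> (N n <= i)%N /\
  forall l', w (m0 i) l' != 0 -> (psi n j <= l')%N.
exists iota, rho, m0, delta, v0, Q; split => //.
  move=> l j; have hm0 : {homo hi \o m0 : a b / (a < b)%N} by move=> a b /m0h/hi_incr.
  have [|K KP] := @eventually_all (fun n i => (N n <= i)%N /\
      forall l', w (m0 i) l' != 0 -> (psi n j <= l')%N) _ l.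
    move=> n; have [N1 N1P] := blocks_escape (psi n j) hm0 (blocks_sub m0h wblocks).
    by exists (maxn (N n) N1) => i; rewrite geq_max => /andP[? ?]; split => //; apply: N1P.
  by exists K.
move=> m J mh Jh QP y t y0 yt F sF; have t0 := sle_ge0 yt.
(* Stopping the expansion at depth [l] leaves an error [(1/2) ^+ l * t], summable over [l]. *)
have /choice[G GP] l := @dot_telescope R fs xi (hi (m0 (m l))).+1 (w (m0 (m l))) l eta eps M
  (w0 _) (@dotw_le (m0 (m l))) Meps
  (fun n nl => let: And4 _ _ _ h := NP n in h (m l) (QP l n nl).1) y t y0 yt.
pose K := (\max_(l <- F) l).+1.
have FK l : l \in F -> (l < K)%N.
  by move=> lF; rewrite ltnS; apply: (@leq_bigmax_seq _ _ xpredT id).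
pose half n : R := (1/2%:R) ^+ n.
have half_ge0 n : 0 <= half n by rewrite exprn_ge0 ?divr_ge0.
apply: (@le_trans _ _ (\sum_(l <- F) (\sum_(n < K)
    (if (val n <= l)%N then 3%:R * half n * mass (G l n) y else 0) + half l * t))).
  rewrite big_seq [leRHS]big_seq; apply: ler_sum => l lF; have [_ _ h] := GP l.
  apply: le_trans h _; rewrite lerD2r -big_mkcond /=.
  by rewrite (big_ord_widen K (fun n => 3%:R * half n * mass (G l n) y)) ?FK.
have sum_l : \sum_(l <- F) half l * t <= 2%:R * t.
  rewrite -mulr_suml ler_wpM2r // -(sum_fset_ord half FK).
  apply: le_trans (sum_half_le2 K); apply: ler_sum => l _.
  by case: ifP.
have Glt n j k : (j < k)%N -> fset_lt (G j n) (G k n).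
  apply: (blocks_lt (E := fun j => G j n) (blocks_sub mh (blocks_sub m0h wblocks))).
  by move=> l l'; have [_ + _] := GP l; apply.
(* For fixed [n] the sets [G l n], with [l >= n] in [F], are successive and together form a set of
   the family [xi], whose mass is at most [t]. *)
have sum_n n : \sum_(l <- F) (if (n <= l)%N then 3%:R * half n * mass (G l n) y else 0)
    <= 3%:R * half n * t.
  rewrite -big_mkcond big_fset_condE -mulr_sumr ler_wpM2l ?mulr_ge0 //.
  rewrite -mass_fcups ?fset_uniq //; last first.
    by move=> j k _ _; exact: Glt.
  apply: yt; apply: (psiP n J) => // [|j|j l|j k _ _].
  - apply: Schreier_sub sF _; apply/fsubsetP => _ /imfsetP[l /= + ->].
    by rewrite !inE => /andP[lF _]; apply: in_imfset.
  - by move=> _; have [+ _ _] := GP j; apply.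
  - rewrite !inE => /andP[_ nj] lG; have [_ supp _] := GP j.
    by have [_] := QP j n nj; apply; apply: supp lG.
  - exact: Glt.
rewrite big_split /= exchange_big /=.
have : \sum_(n < K) \sum_(l <- F) (if (val n <= l)%N then 3%:R * half n * mass (G l n) y else 0)
    <= 6%:R * t.
  apply: (@le_trans _ _ (\sum_(n < K) 3%:R * half n * t)).
    by apply: ler_sum => n _; exact: sum_n.
  rewrite -mulr_suml -mulr_sumr ler_wpM2r //.
  by have := sum_half_le2 K; rewrite /half; lra.
(* The constant 8 is 6 from the geometric series with factor 3 and 2 from the errors. *)
by move: sum_l; lra.
Qed.

Theorem dual_core :
  exists (m J : nat -> nat) rho (v : nat -> nat -> R) (delta : R),
    [/\ {homo m : a b / (a < b)%N}, {homo J : a b / (a < b)%N}, remainders xi rho &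
        0 < delta] /\
    [/\ forall i, nonneg (v i), forall i l, v i l != 0 -> w (m i) l != 0,
        forall i, sle xi (v i) 1 & forall i, delta <= dotw (m i) (v i)] /\
    upper xi rho J v 3%:R /\ lower xi rho (hi \o m) J (w \o m) 8%:R.
Proof.
have [iota [rho [m0 [delta [v0 [Q [hrho tv QP low]]]]]]] := tested_lower.
have [[m0h d0 v0_ge0 v0_supp] [v0_le v0_ge small]] := tv.
have [phi [phih dec]] := Schreier_decompose fsP hrho.
have bv0 : blocks (hi \o m0) v0.
  move=> i l /v0_supp wl; have [lh hl] := wblocks wl; split => // k /m0h.
  exact: hl.
have him0 : {homo hi \o m0 : a b / (a < b)%N} by move=> a b /m0h/hi_incr.
(* One selection serves both estimates: [Q] for the functionals, thinness for the test vectors. *)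
pose P l j M i := Q l j i /\
  forall G a, S iota G -> a \in G -> (a <= M)%N -> mass G (v0 i) <= (1/2%:R) ^+ l.+1.
have [|m [J [mh Jh phiJ [M P0] PS]]] := @thin_subsequence phi (hi \o m0) P.
  move=> l j M N; have [N1 N1P] := QP l j.
  have [|N2 N2P] := thin_blocks fsP him0 bv0 v0_ge0 small M (eps := (1/2%:R) ^+ l.+1).
    by rewrite exprn_gt0 ?divr_gt0.
  exists (maxn N (maxn N1 N2)); first exact: leq_maxl.
  split; first by apply: N1P; rewrite !leq_max leqnn !orbT.
  by apply: N2P; rewrite !leq_max leqnn !orbT.
have QJ l : Q l (J l) (m l).
  by case: l => [|l]; [case: P0|case: (PS l)].
exists (m0 \o m), J, rho, (v0 \o m), delta; split; [split|split; [split|split]] => //.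
- by move=> a b /mh/m0h.
- by exists iota; split => //; have [] := oadd_ge hrho.
- by move=> i; exact: v0_ge0.
- by move=> i l; exact: v0_supp.
- by move=> i; exact: v0_le.
- by move=> i; exact: v0_ge.
- apply: (upperP fsP phih dec (hi := hi \o m0 \o m)) => //.
  + by move=> a b /mh/him0.
  + exact: (blocks_sub mh bv0).
  + by move=> i; exact: v0_ge0.
  + by move=> i; exact: v0_le.
  + by move=> i G a sG aG ahi; have [_ h] := PS i; apply: h ahi.
- exact: low.
Qed.

End dual_core.

(** * Scalars and norms *)

Section scalar_theory.
Variables (R : realType) (k : scalar_kind).
Local Notation K := (scalars R k).

Definition toK : R -> K :=
  match k return R -> scalars R k with
  | RealScalars => id
  | ComplexScalars => fun r => Complex r 0
  end.

Lemma re_toK r : scalar_re (toK r) = r.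
Proof. by rewrite /toK; case: k. Qed.

Lemma toKD r s : toK (r + s) = toK r + toK s.
Proof. by rewrite /toK; case: k => //; apply/eqP; rewrite eq_complex /= addr0 !eqxx. Qed.

Lemma toKM r s : toK (r * s) = toK r * toK s.
Proof.
rewrite /toK; case: k => //; apply/eqP; rewrite eq_complex /=.
by rewrite !mulr0 mul0r addr0 subr0 !eqxx.
Qed.

Lemma toK1 : toK 1 = 1.
Proof. by rewrite /toK; case: k. Qed.

Lemma toK0 : toK 0 = 0.
Proof. by rewrite /toK; case: k. Qed.

Lemma ler_toK r s : (toK r <= toK s) = (r <= s).
Proof. by rewrite /toK; case: k => //; rewrite lecE /= eqxx. Qed.

Lemma ltr_toK r s : (toK r < toK s) = (r < s).
Proof. by rewrite /toK; case: k => //; rewrite ltcE /= eqxx. Qed.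

Lemma toK_re (a : K) : 0 <= a -> toK (scalar_re a) = a.
Proof.
rewrite /toK; case: k a => //= -[x y]; rewrite lecE /= => /andP[/eqP-> _] //.
Qed.

Lemma norm_toK r : 0 <= r -> `|toK r| = toK r.
Proof. by move=> r0; rewrite ger0_norm // -toK0 ler_toK. Qed.

Section rnorm.
Variable V : normedModType K.
Implicit Types v w : V.

Lemma rnormE v : `|v| = toK (rnorm v).
Proof. by rewrite /rnorm toK_re. Qed.

Lemma rnorm_ge0 v : 0 <= rnorm v.
Proof. by rewrite -ler_toK -rnormE toK0. Qed.

Lemma rnorm0 : rnorm (0 : V) = 0.
Proof. by rewrite /rnorm normr0 -toK0 re_toK. Qed.

Lemma rnorm_eq0 v : rnorm v = 0 -> v = 0.
Proof. by move=> h; apply/normr0_eq0; rewrite rnormE h toK0. Qed.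

Lemma rnormD v w : rnorm (v + w) <= rnorm v + rnorm w.
Proof. by rewrite -ler_toK toKD -!rnormE ler_normD. Qed.

Lemma rnormN v : rnorm (- v) = rnorm v.
Proof. by rewrite /rnorm normrN. Qed.

Lemma rnormB v w : rnorm (v - w) = rnorm (w - v).
Proof. by rewrite -rnormN opprB. Qed.

Lemma rnorm_dist v w u : rnorm (v - w) <= rnorm (v - u) + rnorm (u - w).
Proof. by apply: le_trans (rnormD _ _); rewrite addrA subrK. Qed.

Lemma rnormZ (a : K^o) v : rnorm (a *: v) = rnorm a * rnorm v.
Proof.
have Ea : (`|a| : K) = toK (rnorm a) by rewrite -[LHS]toK_re.
by rewrite {1}/rnorm normrZ [X in X * _]Ea rnormE -toKM re_toK.
Qed.

Lemma rnorm_sum (I : Type) (s : seq I) (v : I -> V) :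
  rnorm (\sum_(i <- s) v i) <= \sum_(i <- s) rnorm (v i).
Proof.
elim/big_ind2: _ => [|x r y q xr yq|//]; first by rewrite rnorm0.
by apply: le_trans (rnormD _ _) _; apply: lerD.
Qed.

End rnorm.

Lemma rnorm_toK r : 0 <= r -> rnorm (toK r : K^o) = r.
Proof. by move=> r0; rewrite /rnorm norm_toK // re_toK. Qed.

Lemma rnorm1 : rnorm (1 : K^o) = 1.
Proof. by rewrite /rnorm normr1 -toK1 re_toK. Qed.

Lemma rnormM (a b : K^o) : rnorm (a * b : K^o) = rnorm a * rnorm b.
Proof. exact: rnormZ. Qed.

Lemma rnormV (a : K^o) : rnorm (a^-1 : K^o) = (rnorm a)^-1.
Proof.
have [->|a0] := eqVneq a 0; first by rewrite invr0 rnorm0 invr0.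
apply: (@mulIf _ (rnorm a)).
  by apply: contra_neq a0; apply: rnorm_eq0.
rewrite -rnormM mulVf // rnorm1 mulVf //.
by apply: contra_neq a0; apply: rnorm_eq0.
Qed.

Lemma real_complete (z : nat -> R) :
  (forall e, 0 < e -> exists N, forall i j, (N <= i)%N -> (N <= j)%N -> `|z i - z j| <= e) ->
  exists l, forall e, 0 < e -> exists N, forall i, (N <= i)%N -> `|z i - l| <= e.
Proof.
move=> zc; have : cvg (z @ \oo).
  apply: cauchy_cvg; apply: cauchy_exP => e e0.
  have [|N NP] := zc (e / 2%:R); first by rewrite divr_gt0.
  exists (z N); exists N => // i /= Ni; rewrite /ball /=.
  by apply: le_lt_trans (NP N i (leqnn _) Ni) _; lra.
move=> /cvg_ex[l] /cvgrPdist_le zl; exists l => e e0.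
by have [N _ NP] := zl e e0; exists N => i Ni; rewrite distrC; apply: NP.
Qed.

Lemma scalars_complete (z : nat -> K^o) :
  (forall e, 0 < e -> exists N, forall i j, (N <= i)%N -> (N <= j)%N -> rnorm (z i - z j) <= e) ->
  exists l, forall e, 0 < e -> exists N, forall i, (N <= i)%N -> rnorm (z i - l) <= e.
Proof.
rewrite /rnorm; case: k z => /= z zc; first exact: real_complete.
have le_re (a : R[i]) : `|complex.Re a| <= complex.Re `|a|.
  by case: a => x y; rewrite normc_def /= -sqrtr_sqr ler_wsqrtr // lerDl sqr_ge0.
have le_im (a : R[i]) : `|complex.Im a| <= complex.Re `|a|.
  by case: a => x y; rewrite normc_def /= -sqrtr_sqr ler_wsqrtr // lerDr sqr_ge0.
have le_sum (a : R[i]) : complex.Re `|a| <= `|complex.Re a| + `|complex.Im a|.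
  case: a => x y; rewrite normc_def /=.
  rewrite -[leRHS]ger0_norm ?addr_ge0 // -sqrtr_sqr ler_wsqrtr // sqrrD !real_normK ?num_real //.
  by rewrite addrAC lerDl mulrn_wge0 ?mulr_ge0.
have [e e0|x xl] := real_complete (z := fun i => complex.Re (z i)).
  have [N NP] := zc e e0; exists N => i j Ni Nj; apply: le_trans (NP i j Ni Nj).
  by apply: le_trans (le_re _); case: (z i) (z j) => a b [].
have [e e0|y yl] := real_complete (z := fun i => complex.Im (z i)).
  have [N NP] := zc e e0; exists N => i j Ni Nj; apply: le_trans (NP i j Ni Nj).
  by apply: le_trans (le_im _); case: (z i) (z j) => a b [].
exists (Complex x y) => e e0.
have [|N NP] := xl (e / 2%:R); first by rewrite divr_gt0.
have [|M MP] := yl (e / 2%:R); first by rewrite divr_gt0.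
exists (maxn N M) => i; rewrite geq_max => /andP[/NP zx /MP zy].
apply: le_trans (le_sum _) _; case: (z i) zx zy => a b /=.
by move=> ? ?; lra.
Qed.

End scalar_theory.

(** * Finitely supported sequences *)

Section c00_theory.
Variables (R : realType) (k : scalar_kind).
Local Notation K := (scalars R k).
Implicit Types c d u v : c00 K.

Definition supp c : {fset nat} := fset_set (Defs.support c).

Lemma finite_support c : finite_set (Defs.support c).
Proof. by have := valP c => /asboolP. Qed.

Lemma in_supp c l : (l \in supp c) = (c l != 0).
Proof.
rewrite /supp in_fset_set; last exact: finite_support.
by apply/idP/idP; rewrite in_setE.
Qed.

Lemma c00_scaleD (a : K) u v l : (a *: u + v) l = a * u l + v l.
Proof. by []. Qed.

Lemma c00B u v l : (u - v) l = u l - v l.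
Proof. by []. Qed.

Lemma c00Z (a : K) u l : (a *: u) l = a * u l.
Proof. by []. Qed.

Lemma c00_unitE j l : c00_unit K j l = (l == j)%:R.
Proof. by []. Qed.

Lemma c00_sum (I : Type) (s : seq I) (P : pred I) (F : I -> c00 K) l :
  (\sum_(i <- s | P i) F i) l = \sum_(i <- s | P i) F i l.
Proof. by elim/big_rec2: _ => // i x y _ <-. Qed.

Lemma c00_ext u v : (forall l, u l = v l) -> u = v.
Proof. by move=> uv; apply/val_inj/funext. Qed.

Lemma c00_expansion c : c = \sum_(j <- supp c) c j *: c00_unit K j.
Proof.
apply: c00_ext => l; rewrite c00_sum.
have [lc|] := boolP (l \in supp c).
  rewrite (big_fsetD1 l) // c00Z c00_unitE eqxx mulr1 big_seq big1 => [|j]; first by rewrite /= addr0.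
  by rewrite in_fsetD1 c00Z c00_unitE => /andP[jl _]; rewrite eq_sym (negPf jl) mulr0.
rewrite in_supp negbK => /eqP cl; rewrite cl big_seq big1 // => j.
rewrite c00Z c00_unitE in_supp; have [<-|] := eqVneq l j; last by rewrite mulr0.
by rewrite cl eqxx.
Qed.

Lemma restricted_finitely_nonzero (E : {fset nat}) (h : nat -> K^o) :
  (fun l => if l \in E then h l else 0) \in @finitely_nonzero K.
Proof.
apply/asboolP; apply: (@sub_finite_set _ _ [set` E]) => // l /=.
by case: ifP => //; rewrite eqxx.
Qed.

Definition c00_of (E : {fset nat}) (h : nat -> K^o) : c00 K :=
  C00 (restricted_finitely_nonzero E h).

Definition absw c : nat -> R := fun l => rnorm (c l).

Lemma absw_nonneg c : nonneg (absw c).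
Proof. by move=> l; apply: rnorm_ge0. Qed.

Lemma absw_neq0 c l : (absw c l != 0) = (c l != 0).
Proof.
apply/idP/idP; first by apply: contra_neq => cl; rewrite /absw cl rnorm0.
by apply: contra_neq => /rnorm_eq0.
Qed.

Lemma mass_absw_le (E : {fset nat}) c : mass E (absw c) <= mass (supp c) (absw c).
Proof.
rewrite (mass_split (fun l => l \in supp c)) -[leRHS]addr0; apply: lerD.
  apply: massS; first exact: absw_nonneg.
  by apply/fsubsetP => l; rewrite !inE => /andP[].
rewrite /mass big_seq big1 // => l; rewrite !inE in_supp negbK => /andP[_ /eqP cl].
by rewrite /absw cl rnorm0.
Qed.

Section norm.
Variables (fs : omega1 -> nat -> omega1) (x : omega1).
Local Notation N := (@schreier_norm R k fs x).

Lemma schreier_norm_sle c : sle fs x (absw c) (N c).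
Proof.
move=> E sE; apply: ub_le_sup; last by exists E.
(* Boundedness above must be shown for [sup] to be an upper bound; the total mass of the support
   provides it. *)
by exists (mass (supp c) (absw c)) => _ [F sF <-]; apply: mass_absw_le.
Qed.

Lemma schreier_norm_le c t : sle fs x (absw c) t -> N c <= t.
Proof.
move=> ct; apply: ge_sup; last by move=> _ [F sF <-]; apply: ct.
by exists (mass fset0 (absw c)), fset0 => //; apply: Schreier_empty.
Qed.

Lemma schreier_norm_ge0 c : 0 <= N c.
Proof. exact: sle_ge0 (schreier_norm_sle c). Qed.

Lemma schreier_norm_mono c d M : 0 <= M -> (forall l, absw c l <= M * absw d l) ->
  N c <= M * N d.
Proof.
move=> M0 cd; apply: schreier_norm_le.
exact: sle_mono cd (sle_scale M0 (schreier_norm_sle d)).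
Qed.

Hypothesis fsP : fundamental_system fs.

Lemma coef_le_schreier_norm c l : rnorm (c l) <= N c.
Proof.
by have := schreier_norm_sle c (Schreier_single fsP x l); rewrite mass1.
Qed.

Lemma schreier_norm_unit l : N (c00_unit K l) = 1.
Proof.
apply/le_anti; apply/andP; split.
  apply: schreier_norm_le => E _; apply: le_trans (mass_absw_le _ _) _.
  have -> : supp (c00_unit K l) = [fset l]%fset.
    apply/fsetP => j; rewrite in_supp inE /=.
    by case: (j == l); rewrite ?eqxx ?oner_eq0.
  by rewrite mass1 /absw /= eqxx rnorm1.
by apply: le_trans (coef_le_schreier_norm _ l); rewrite /= eqxx rnorm1.
Qed.

End norm.
End c00_theory.

(** * Operator norms *)

Section operators.
Variables (R : realType) (k : scalar_kind).
Local Notation K := (scalars R k).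
Variables (V W : normedModType K).

Definition bounded_by (T : V -> W) (C : R) := forall v, rnorm (T v) <= C * rnorm v.

Lemma opnorm_le (T : V -> W) C : 0 <= C -> bounded_by T C -> opnorm T <= C.
Proof.
move=> C0 TC; apply: ge_sup => [|_ [v /= v1 <-]].
  by exists (rnorm (T 0)), 0 => //=; rewrite rnorm0.
by apply: le_trans (TC v) _; rewrite ler_piMr.
Qed.

(** The constant [C] certifies that the set of values is bounded, so that its [sup] is an upper
    bound. *)
Lemma opnorm_ub (T : V -> W) C v : 0 <= C -> bounded_by T C -> rnorm v <= 1 ->
  rnorm (T v) <= opnorm T.
Proof.
move=> C0 TC v1; apply: ub_le_sup; last by exists v.
by exists C => _ [u /= u1 <-]; apply: le_trans (TC u) _; rewrite ler_piMr.
Qed.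

Lemma le_opnorm (T : V -> W) C : 0 <= C -> bounded_by T C ->
  (forall (a : K) v, T (a *: v) = a *: T v) -> bounded_by T (opnorm T).
Proof.
move=> C0 TC TZ v; have [v0|vn0] := eqVneq (rnorm v) 0.
  by apply: le_trans (TC v) _; rewrite v0 !mulr0.
have vp : 0 < rnorm v by rewrite lt_neqAle eq_sym vn0 rnorm_ge0.
pose u := toK k (rnorm v)^-1 *: v.
have u1 : rnorm u <= 1.
  by rewrite rnormZ rnorm_toK ?invr_ge0 ?rnorm_ge0 // mulVf.
have {1}-> : v = toK k (rnorm v) *: u.
  by rewrite scalerA -toKM divff // toK1 scale1r.
rewrite TZ rnormZ rnorm_toK ?rnorm_ge0 // mulrC ler_pM2r //.
exact: opnorm_ub C0 TC u1.
Qed.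

End operators.

(** * The completion and its coordinate functionals *)

Lemma dual_linear (K : numFieldType) (X : normedModType K) (f : dual X) : linear f.
Proof. by have := valP f => /asboolP[]. Qed.

Lemma dual_continuous (K : numFieldType) (X : normedModType K) (f : dual X) : continuous f.
Proof. by have := valP f => /asboolP[]. Qed.

Lemma dual0 (K : numFieldType) (X : normedModType K) (f : dual X) : f 0 = 0.
Proof.
by apply: (addrI (f 0)); have := dual_linear f 1 0 0; rewrite !scale1r !addr0 => <-.
Qed.

Lemma dualD (K : numFieldType) (X : normedModType K) (f : dual X) x y : f (x + y) = f x + f y.
Proof. by have := dual_linear f 1 x y; rewrite !scale1r. Qed.

Lemma dualZ (K : numFieldType) (X : normedModType K) (f : dual X) a x : f (a *: x) = a *: f x.
Proof. by have := dual_linear f a x 0; rewrite dual0 !addr0. Qed.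

Lemma dualB (K : numFieldType) (X : normedModType K) (f : dual X) x y : f (x - y) = f x - f y.
Proof. by rewrite dualD -scaleN1r dualZ scaleN1r. Qed.

Lemma dual_sum (K : numFieldType) (X : normedModType K) (f : dual X) (I : Type) (s : seq I)
  (F : I -> X) : f (\sum_(i <- s) F i) = \sum_(i <- s) f (F i).
Proof. by elim/big_rec2: _ => [|i a b _ <-]; [exact: dual0|exact: dualD]. Qed.

Lemma sum_dual (K : numFieldType) (X : normedModType K) (I : Type) (s : seq I)
  (F : I -> dual X) x : (\sum_(i <- s) F i) x = \sum_(i <- s) F i x.
Proof. by elim/big_rec2: _ => // i a b _ <-. Qed.

Lemma dual_eps_delta (R : realType) (k : scalar_kind) (X : normedModType (scalars R k))
    (f : dual X) y e : 0 < e ->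
  exists2 d, 0 < d & forall z, rnorm (z - y) < d -> rnorm (f z - f y) < e.
Proof.
move=> e0; have /cvgrPdist_lt/(_ (toK k e)) := @dual_continuous _ _ f y.
rewrite -toK0 ltr_toK => /(_ e0) /nbhs_normP[d /= d0 dP].
exists (scalar_re d); first by rewrite -(ltr_toK k) toK_re ?toK0 ?ltW.
move=> z zy; rewrite -(ltr_toK k) -rnormE distrC; apply: dP => /=.
by rewrite distrC rnormE -(toK_re (ltW d0)) ltr_toK.
Qed.

Section completion.
Variables (R : realType) (k : scalar_kind) (fs : omega1 -> nat -> omega1).
Hypothesis fsP : fundamental_system fs.
Local Notation K := (scalars R k).
Variables (xi : omega1) (X : completion (@schreier_norm R k fs xi)).
Local Notation N := (@schreier_norm R k fs xi).
Local Notation em := (embed X).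

Lemma rnorm_embed v : rnorm (em v) = N v.
Proof. exact: embed_isometric. Qed.

Lemma embed_approx (y : X) e : 0 < e -> exists v, rnorm (em v - y) < e.
Proof.
move=> e0; have e0' : 0 < toK k e by rewrite -toK0 ltr_toK.
have [||z [yz [v _ vz]]] := @embed_dense _ _ _ _ X (ball y (toK k e)).
- by exists y; apply: ballxx.
- exact: ball_open.
exists v; rewrite -(ltr_toK k) -rnormE vz.
by move: yz; rewrite -ball_normE /ball_ /= distrC.
Qed.

(** A coordinate is 1-Lipschitz on the dense image of the embedding, so its values along
    approximations of [y] converge. Stating the inequality for all [v] determines [z] and already
    contains the continuity and linearity of the extension. *)
Lemma coordinate_value j (y : X) : exists z : K^o, forall v : c00 K, rnorm (v j - z) <= rnorm (em v - y).
Proof.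
have /choice[v vP] : forall n : nat, exists v, rnorm (em v - y) < (n.+1%:R)^-1.
  by move=> n; apply: embed_approx; rewrite invr_gt0.
have lip (u w : c00 K) : rnorm (u j - w j) <= rnorm (em u - em w).
  by rewrite -linearB rnorm_embed -c00B; apply: coef_le_schreier_norm.
have [e e0|l lP] := scalars_complete (z := fun n => v n j).
  have [|M MP] := inv_nat_small (eps := e / 2%:R); first by rewrite divr_gt0.
  exists M => a b Ma Mb; apply: le_trans (lip _ _) _.
  apply: le_trans (rnorm_dist _ _ y) _.
  have ha := lt_le_trans (vP a) (MP a Ma); have hb := lt_le_trans (vP b) (MP b Mb).
  by rewrite (rnormB y); lra.
exists l => u; apply/ler_addgt0Pr => e e0.
have [|M MP] := inv_nat_small (eps := e / 2%:R); first by rewrite divr_gt0.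
have [|M' M'P] := lP (e / 2%:R); first by rewrite divr_gt0.
pose n := maxn M M'.
apply: le_trans (rnorm_dist _ _ (v n j)) _.
have h1 := M'P n (leq_maxr _ _); have h2 := MP n (leq_maxl _ _).
have h3 := le_trans (lip u (v n)) (rnorm_dist _ _ y).
have h4 := lt_le_trans (vP n) h2.
by rewrite (rnormB y) in h3; move: h1 h3 h4; lra.
Qed.

Lemma coordinate_exists j : exists f : dual X, forall v, f (em v) = v j.
Proof.
have [g gP] := choice (coordinate_value j).
have gE v : g (em v) = v j.
  apply/esym/eqP; rewrite -subr_eq0; apply/eqP/rnorm_eq0/le_anti.
  by rewrite rnorm_ge0 andbT; have := gP (em v) v; rewrite subrr rnorm0.
have glin : linear g.
  move=> a x y; apply/eqP; rewrite -subr_eq0; apply/eqP/rnorm_eq0/le_anti.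
  rewrite rnorm_ge0 andbT; apply/ler_addgt0Pr => e e0; rewrite add0r.
  (* Each of the two errors below is at most [(rnorm a + 1) * D], whence the choice of [A] and
     [D]. *)
  pose A : R := 2%:R * (rnorm (a : K^o) + 1).
  have A0 : 0 < A by rewrite mulr_gt0 // ltr_wpDl ?rnorm_ge0.
  pose D := e / A; have D0 : 0 < D by rewrite divr_gt0.
  have [u ux] := embed_approx x D0; have [w wy] := embed_approx y D0.
  apply: le_trans (rnorm_dist _ _ ((a *: u + w) j)) _.
  have h1 : rnorm (g (a *: x + y) - (a *: u + w) j) <= rnorm (a : K^o) * rnorm (em u - x) + rnorm (em w - y).
    rewrite rnormB; apply: le_trans (gP _ _) _; rewrite linearP.
    rewrite (_ : _ - _ = a *: (em u - x) + (em w - y)); last first.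
      by rewrite scalerBr opprD addrACA.
    by apply: le_trans (rnormD _ _) _; rewrite rnormZ.
  have h2 : rnorm ((a *: u + w) j - (a *: g x + g y)) <= rnorm (a : K^o) * rnorm (em u - x) + rnorm (em w - y).
    rewrite c00_scaleD (_ : _ - _ = a *: (u j - g x) + (w j - g y)); last first.
      by rewrite scalerBr opprD addrACA.
    apply: le_trans (rnormD _ _) _; rewrite rnormZ; apply: lerD; last exact: gP.
    by rewrite ler_wpM2l ?rnorm_ge0 // gP.
  apply: le_trans (lerD h1 h2) _.
  have a0 := rnorm_ge0 (a : K^o).
  have h3 : rnorm (a : K^o) * rnorm (em u - x) <= rnorm (a : K^o) * D.
    by rewrite ler_wpM2l // ltW.
  have h4 : e = A * D by rewrite mulrC divfK // gt_eqF.
  rewrite [leRHS]h4 /A; move: (ltW wy) h3; move: D {D0 h4 ux wy} => D; clear => ? ?.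
  lra.
have gcont : continuous g.
  move=> x; apply/cvgrPdist_lt => e e0; near=> t.
  have -> : g x - g t = g (x - t).
    by have := glin (-1) t x; rewrite !scaleN1r => h; rewrite [x - t]addrC h addrC.
  apply: (@le_lt_trans _ _ `|x - t|).
    have h : rnorm (0 - g (x - t)) <= rnorm (em 0 - (x - t)) := gP (x - t) 0.
    by move: h; rewrite linear0 !sub0r !rnormN !rnormE ler_toK.
  by near: t; apply: cvgr_dist_lt.
have gd : g \in @continuous_functional _ X by apply/asboolP.
by exists (Dual gd).
Unshelve. all: by end_near.
Qed.

(** Any functional biorthogonal to the basis takes these values, by expanding [v];
    [coordinate_exists] rules out the default value of [xget]. *)
Lemma coordinate_embed j v : coordinate X j (em v) = v j.
Proof.
rewrite /coordinate; case: xgetP => [f _ fP|none].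
  transitivity ((\sum_(i <- supp v) v i *: c00_unit K i) j); last by rewrite -c00_expansion.
  rewrite {1}(c00_expansion v) linear_sum dual_sum c00_sum.
  by apply: eq_bigr => i _; rewrite linearZ dualZ fP c00Z c00_unitE eq_sym.
have [f fP] := coordinate_exists j; case: (none f) => i.
by rewrite fP c00_unitE eq_sym.
Qed.

Lemma combination_basis c : combination (Defs.basis X) c = em c.
Proof.
rewrite /combination fsbig_finite; last exact: finite_support.
by rewrite [in RHS](c00_expansion c) linear_sum; apply: eq_bigr => j _; rewrite linearZ.
Qed.

Lemma combination_coordinate d v :
  combination (coordinate X) d (em v) = \sum_(j <- supp d) d j * v j.
Proof.
rewrite /combination fsbig_finite; last exact: finite_support.
rewrite sum_dual; apply: eq_bigr => j _.
by rewrite -(coordinate_embed j v).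
Qed.

Lemma embed_inj : injective em.
Proof.
move=> u v uv; apply: c00_ext => l.
by rewrite -!coordinate_embed uv.
Qed.

Lemma coefficients_basis c : coefficients (Defs.basis X) (em c) = c.
Proof.
rewrite /coefficients; case: xgetP => [c' _ /=|/(_ c)/=].
  by rewrite combination_basis => /embed_inj.
by rewrite combination_basis.
Qed.

Lemma combination_coordinate_unit d l :
  combination (coordinate X) d (em (c00_unit K l)) = d l.
Proof.
rewrite combination_coordinate; have [ld|] := boolP (l \in supp d).
  rewrite (big_fsetD1 l) // c00_unitE eqxx mulr1 big_seq big1 => [|j]; first by rewrite /= addr0.
  by rewrite in_fsetD1 c00_unitE => /andP[/negPf-> _]; rewrite mulr0.
rewrite in_supp negbK => /eqP dl; rewrite dl big_seq big1 // => j.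
rewrite in_supp c00_unitE; have [->|] := eqVneq j l; last by rewrite mulr0.
by rewrite dl eqxx.
Qed.

Lemma coefficients_coordinate d :
  coefficients (coordinate X) (combination (coordinate X) d) = d.
Proof.
rewrite /coefficients; case: xgetP => [d' _ /= dd'|none]; last by case: (none d).
apply: c00_ext => l; have := congr1 (fun f : dual X => f (em (c00_unit K l))) dd'.
by rewrite !combination_coordinate_unit.
Qed.

(** The source of clause (ii): with matching phases, replacing both arguments by their moduli
    changes no term of the pairing. *)
Lemma modulus_eval (c d : c00 K) : (forall j, d j * c j = `|d j| * `|c j|) ->
  modulus (coordinate X) (combination (coordinate X) d) (modulus (Defs.basis X) (em c)) =
  combination (coordinate X) d (em c).
Proof.
move=> al; rewrite combination_coordinate /modulus coefficients_basis coefficients_coordinate.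
rewrite (fsbig_finite _ _ (finite_support d)) sum_dual; apply: eq_bigr => j _.
rewrite al (fsbig_finite _ _ (finite_support c)).
have -> : \sum_(i <- fset_set (Defs.support c)) `|c i| *: Defs.basis X i =
    em (\sum_(i <- supp c) `|c i| *: c00_unit K i).
  by rewrite linear_sum; apply: eq_bigr => i _; rewrite linearZ.
change (`|d j| *: (coordinate X j (em (\sum_(i <- supp c) `|c i| *: c00_unit K i)) : K^o) =
  `|d j| * `|c j|).
rewrite coordinate_embed c00_sum; congr (_ * _).
have [jc|] := boolP (j \in supp c).
  rewrite (big_fsetD1 j) // c00Z c00_unitE eqxx mulr1 big_seq big1 => [|i]; first by rewrite /= addr0.
  by rewrite in_fsetD1 c00Z c00_unitE eq_sym => /andP[/negPf-> _]; rewrite mulr0.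
rewrite in_supp negbK => /eqP cj; rewrite cj normr0 big_seq big1 // => i.
rewrite in_supp c00Z c00_unitE; have [<-|] := eqVneq j i; last by rewrite mulr0.
by rewrite cj eqxx.
Qed.

(** The constant [L] is used for continuity and is absent from the conclusion: an approximation
    within [e / (L + C + 1)] perturbs both sides by at most [e] in total. *)
Lemma lipschitz_dense (W : normedModType K) (T : X -> W) L C : 0 <= L -> 0 <= C ->
  (forall y z, rnorm (T y - T z) <= L * rnorm (y - z)) ->
  (forall v, rnorm (T (em v)) <= C * N v) -> bounded_by T C.
Proof.
move=> L0 C0 TL TC y; apply/ler_addgt0Pr => e e0.
have D0 : 0 < L + C + 1 by rewrite ltr_wpDl // addr_ge0.
have [|v vy] := embed_approx y (e := e / (L + C + 1)); first by rewrite divr_gt0.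
have h1 : rnorm (T y) <= rnorm (T y - T (em v)) + rnorm (T (em v)).
  by rewrite -[X in rnorm X <= _](subrK (T (em v))) rnormD.
apply: le_trans h1 _.
have h2 := TL y (em v); have h3 := TC v.
have h4 : N v <= rnorm y + rnorm (em v - y).
  by rewrite -rnorm_embed -[X in rnorm X <= _](subrK y) addrC rnormD.
have h5 : C * N v <= C * (rnorm y + rnorm (em v - y)) by rewrite ler_wpM2l.
have h6 : (L + C + 1) * rnorm (em v - y) <= e.
  by rewrite mulrC -ler_pdivlMr // ltW.
rewrite (rnormB y) in h2; have h7 := rnorm_ge0 (em v - y).
by move: h2 h3 h5 h6 h7; rewrite !mulrDl mulrDr; lra.
Qed.

(** A member of the dual is only given as continuous, with no Lipschitz constant, so the
    approximating vector is chosen by continuity at [y]. *)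
Lemma dual_bounded_dense (f : dual X) C : 0 <= C ->
  (forall v, rnorm (f (em v)) <= C * N v) -> bounded_by (f : X -> K^o) C.
Proof.
move=> C0 fC y; apply/ler_addgt0Pr => e e0.
have e2 : 0 < e / 2%:R by rewrite divr_gt0.
have [d d0 dP] := dual_eps_delta f y e2.
have D0 : 0 < e / (2%:R * (C + 1)) by rewrite divr_gt0 // mulr_gt0 // ltr_wpDl.
have [|v] := embed_approx y (e := Num.min d (e / (2%:R * (C + 1)))); first by rewrite lt_min d0.
rewrite lt_min => /andP[/dP h1 /ltW h2].
have h0 : rnorm (f y) <= rnorm (f y - f (em v)) + rnorm (f (em v)).
  by rewrite -[X in rnorm X <= _](subrK (f (em v))) rnormD.
apply: le_trans h0 _.
have h3 := fC v.
have h4 : N v <= rnorm y + rnorm (em v - y).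
  by rewrite -rnorm_embed -[X in rnorm X <= _](subrK y) addrC rnormD.
have h5 : C * N v <= C * (rnorm y + rnorm (em v - y)) by rewrite ler_wpM2l.
have h6 : rnorm (em v - y) * (2%:R * (C + 1)) <= e.
  by rewrite -ler_pdivlMr // mulr_gt0 // ltr_wpDl.
rewrite (rnormB (f y)); have h7 := rnorm_ge0 (em v - y).
by move: (ltW h1) h3 h5 h6 h7; rewrite !mulrDr; lra.
Qed.

End completion.

(** * Schreier pairs *)

Section unit_combinations.
Variables (R : realType) (k : scalar_kind) (fs : omega1 -> nat -> omega1).
Local Notation K := (scalars R k).
Variables (rho : omega1) (Y : completion (@schreier_norm R k fs rho)).
Variables (J : nat -> nat) (Jh : {homo J : a b / (a < b)%N}).
Local Notation N := (@schreier_norm R k fs rho).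
Local Notation S := (Schreier fs).

Definition unit_sum n (a : nat -> K) : c00 K := \sum_(i < n) a i *: c00_unit K (J i).

Lemma embed_unit_sum n a : embed Y (unit_sum n a) = \sum_(i < n) a i *: Defs.basis Y (J i).
Proof. by rewrite /unit_sum linear_sum; apply: eq_bigr => i _; rewrite linearZ. Qed.

Lemma unit_sumE n a i : (i < n)%N -> unit_sum n a (J i) = a i.
Proof.
move=> i_n; rewrite /unit_sum c00_sum (bigD1 (Ordinal i_n)) //.
rewrite c00Z c00_unitE eqxx mulr1 big1 => [|j ji]; first by rewrite /= addr0.
rewrite c00Z c00_unitE; case: eqP => [/(incr_inj Jh) E|_]; last by rewrite mulr0.
by case/eqP: ji; apply: val_inj.
Qed.

Lemma unit_sum0 n a l : (forall i, (i < n)%N -> J i != l) -> unit_sum n a l = 0.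
Proof.
move=> h; rewrite /unit_sum c00_sum big1 // => i _.
by rewrite c00Z c00_unitE eq_sym (negPf (h i _)) ?mulr0.
Qed.

Lemma unit_sum_cases n a l : (exists2 i, (i < n)%N & l = J i) \/ (unit_sum n a l = 0).
Proof.
have [[i i_n Jl]|none] := pselect (exists2 i, (i < n)%N & J i = l); first by left; exists i.
by right; apply: unit_sum0 => i i_n; apply/eqP => Jl; apply: none; exists i.
Qed.

Lemma unit_sum_mono n a b M : 0 <= M ->
  (forall i, (i < n)%N -> rnorm (a i : K^o) <= M * rnorm (b i : K^o)) ->
  N (unit_sum n a) <= M * N (unit_sum n b).
Proof.
move=> M0 ab; apply: schreier_norm_mono => // l; rewrite /absw.
have [[i i_n ->]|->] := unit_sum_cases n a l; first by rewrite !unit_sumE // ab.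
by rewrite rnorm0 mulr_ge0 ?rnorm_ge0.
Qed.

Lemma unit_sum_le n (z : c00 K) : N (unit_sum n (fun i => z (J i))) <= N z.
Proof.
rewrite -[leRHS]mul1r; apply: schreier_norm_mono => // l; rewrite mul1r /absw.
have [[i i_n ->]|->] := unit_sum_cases n (fun i => z (J i)) l; first by rewrite unit_sumE.
by rewrite rnorm0 rnorm_ge0.
Qed.

Lemma mass_unit_sum n a (F : {fset nat}) : (forall i, i \in F -> i < n)%N ->
  mass (J @` F)%fset (absw (unit_sum n a)) = \sum_(i <- F) rnorm (a i : K^o).
Proof.
move=> Fn; rewrite /mass big_imfset /=; last by move=> i j _ _ /(incr_inj Jh).
by apply: eq_big_seq => i iF; rewrite /absw unit_sumE ?Fn.
Qed.

Lemma unit_sum_sle n a t : (forall F : {fset nat}, (forall i, i \in F -> i < n)%N ->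
    S rho (J @` F)%fset -> \sum_(i <- F) rnorm (a i : K^o) <= t) ->
  N (unit_sum n a) <= t.
Proof.
move=> h; apply: schreier_norm_le => E sE.
pose F := [fset i in seq.iota 0 n | J i \in E]%fset.
have inF i : (i \in F) = (i < n)%N && (J i \in E) by rewrite !inE mem_iota.
have JF : (J @` F `<=` E)%fset.
  by apply/fsubsetP => _ /imfsetP[i /= + ->]; rewrite inF => /andP[].
apply: le_trans (h F _ (Schreier_sub sE JF)); last by move=> i; rewrite inF => /andP[].
rewrite -(mass_unit_sum (n := n) a); last by move=> i; rewrite inF => /andP[].
rewrite (mass_split (fun l => l \in (J @` F)%fset)) -[leRHS]addr0; apply: lerD.
  by apply: massS; [exact: absw_nonneg|apply/fsubsetP => l; rewrite inE => /andP[]].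
rewrite /mass big_seq big1 // => l; rewrite inE => /andP[lE lF].
have [[i i_n lJ]|h0] := unit_sum_cases n a l; last by rewrite /absw h0 rnorm0.
by case/negP: lF; rewrite lJ; apply: in_imfset; rewrite inF i_n -lJ.
Qed.

End unit_combinations.

Section pair.
Variables (R : realType) (k : scalar_kind) (fs : omega1 -> nat -> omega1).
Hypothesis fsP : fundamental_system fs.
Local Notation K := (scalars R k).
Variables (xi rho : omega1) (X : completion (@schreier_norm R k fs xi)).
Variable Y : completion (@schreier_norm R k fs rho).
Variables (J : nat -> nat) (Jh : {homo J : a b / (a < b)%N}).
Variables (c d : nat -> c00 K) (gamma : nat -> R) (delta CA CB : R).
Local Notation x i := (embed X (c i)).
Local Notation f i := (combination (coordinate X) (d i)).
Local Notation e i := (Defs.basis Y (J i)).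
Hypotheses (delta0 : 0 < delta) (CA0 : 0 <= CA) (CB0 : 0 <= CB).
Hypothesis diag : forall i, f i (x i) = toK k (gamma i).
Hypothesis gamma_ge : forall i, delta <= gamma i.
Hypothesis off_diag : forall i j, i <> j -> f i (x j) = 0.
Hypothesis upper_bound : forall n (a : nat -> K),
  rnorm (\sum_(i < n) a i *: x i) <= CA * rnorm (\sum_(i < n) a i *: e i).
Hypothesis lower_bound : forall n v,
  rnorm (\sum_(i < n) f i (embed X v) *: e i) <= CB * schreier_norm fs xi v.

Lemma dual_combination_bounded (w : c00 K) : exists2 L, 0 <= L &
  bounded_by (combination (coordinate X) w : X -> K^o) L.
Proof.
exists (mass (supp w) (absw w)); first exact: mass_ge0 (@absw_nonneg _ _ _).
apply: dual_bounded_dense => [|v]; first exact: mass_ge0 (@absw_nonneg _ _ _).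
rewrite combination_coordinate //; apply: le_trans (rnorm_sum _ _) _.
rewrite /mass mulr_suml; apply: ler_sum => j _.
by rewrite rnormM ler_wpM2l ?rnorm_ge0 // coef_le_schreier_norm.
Qed.

Lemma eval_sum n (a : nat -> K) i : (i < n)%N ->
  f i (\sum_(j < n) a j *: x j) = a i * toK k (gamma i).
Proof.
move=> i_n; rewrite dual_sum (bigD1 (Ordinal i_n)) //= dualZ diag big1 => [|j ji].
  by rewrite addr0.
rewrite dualZ off_diag ?scaler0 // => ij; case/eqP: ji; exact/val_inj/esym.
Qed.

Lemma dual_sumE (V : normedModType K) n (a : nat -> K) (g : nat -> dual V) y :
  (\sum_(i < n) a i *: g i) y = \sum_(i < n) a i * g i y.
Proof. by rewrite sum_dual. Qed.

Lemma gamma_gt0 i : 0 < gamma i.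
Proof. exact: lt_le_trans (gamma_ge i). Qed.

Lemma toK_gamma_neq0 i : toK k (gamma i) != 0.
Proof. by rewrite -(toK0 R k) gt_eqF // ltr_toK gamma_gt0. Qed.

(** One inequality is [upper_bound]. For the other, [lower_bound] is applied to the combination of
    the [x i] itself: by biorthogonality its coefficients are the [a i] times [gamma i >= delta]. *)
Lemma pair_equivalent :
  equivalent (@rnorm R k X) (@rnorm R k Y) (fun i => x i) (fun i => e i).
Proof.
(* The sum covers both directions, and the added 1 makes the constant positive. *)
exists (CA + CB / delta + 1).
  by rewrite ltr_wpDl // addr_ge0 // divr_ge0 // ltW.
move=> n a; split.
  apply: le_trans (upper_bound n a) _; rewrite ler_wpM2r ?rnorm_ge0 //.
  by rewrite -addrA lerDl addr_ge0 // divr_ge0 // ltW.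
set sx := \sum_(i < n) a i *: x i.
apply: (@le_trans _ _ (CB / delta * rnorm sx)); last first.
  by rewrite ler_wpM2r ?rnorm_ge0 // addrAC lerDr addr_ge0.
have -> : sx = embed X (\sum_(i < n) a i *: c i).
  by rewrite linear_sum; apply: eq_bigr => i _; rewrite linearZ.
have := lower_bound n (\sum_(i < n) a i *: c i); rewrite -(rnorm_embed X) => h.
rewrite mulrAC ler_pdivlMr // mulrC; apply: le_trans h.
have -> : \sum_(i < n) a i *: e i = embed Y (unit_sum J n a) by rewrite embed_unit_sum.
have -> : \sum_(i < n) f i (embed X (\sum_(i < n) a i *: c i)) *: e i =
    embed Y (unit_sum J n (fun i => a i * toK k (gamma i))).
  rewrite embed_unit_sum; apply: eq_bigr => i _; congr (_ *: _).
  rewrite linear_sum -(eval_sum a (ltn_ord i)); congr (f i _).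
  by apply: eq_bigr => j _; rewrite linearZ.
rewrite !rnorm_embed -ler_pdivlMl //; apply: unit_sum_mono => // [|i i_n].
  by rewrite invr_ge0 ltW.
rewrite rnormM (rnorm_toK k (ltW (gamma_gt0 i))) mulrCA ler_peMr ?rnorm_ge0 //.
by rewrite ler_pdivlMl // mulr1.
Qed.

Lemma coordinate_bounded (Z : omega1) (U : completion (@schreier_norm R k fs Z)) j :
  bounded_by (coordinate U j : U -> K^o) 1.
Proof.
apply: dual_bounded_dense => // v; rewrite coordinate_embed // mul1r.
exact: coef_le_schreier_norm.
Qed.

Lemma sum_dual_bounded (V : normedModType K) n (a : nat -> K) (g : nat -> dual V) :
  (forall i, exists2 L, 0 <= L & bounded_by (g i : V -> K^o) L) ->
  exists2 L, 0 <= L & bounded_by (\sum_(i < n) a i *: g i : dual V) L.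
Proof.
move=> gL; elim: n => [|n [L L0 IH]].
  by exists 0 => // v; rewrite big_ord0 rnorm0 mul0r.
have [M M0 gM] := gL n; exists (L + rnorm (a n : K^o) * M).
  by rewrite addr_ge0 // mulr_ge0 ?rnorm_ge0.
move=> v; rewrite big_ord_recr /= mulrDl; apply: le_trans (rnormD _ _) _.
apply: lerD; first exact: IH.
by rewrite rnormM -mulrA ler_wpM2l ?rnorm_ge0.
Qed.

Lemma coordinate_sumE n (a b : nat -> K) :
  (\sum_(i < n) a i *: coordinate Y (J i) : dual Y) (\sum_(i < n) b i *: e i) =
  \sum_(i < n) a i * b i.
Proof.
rewrite (dual_sumE n a (fun i => coordinate Y (J i))); apply: eq_bigr => i _.
have -> : \sum_(j < n) b j *: e j = embed Y (unit_sum J n b) by rewrite embed_unit_sum.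
by rewrite coordinate_embed // unit_sumE.
Qed.

Lemma functional_sum_bounded n (a : nat -> K) : exists2 L, 0 <= L &
  bounded_by (\sum_(i < n) a i *: f i : dual X) L.
Proof.
exact: (sum_dual_bounded n a (g := fun i => f i) (fun i => dual_combination_bounded (d i))).
Qed.

Lemma coordinate_sum_bounded n (a : nat -> K) : exists2 L, 0 <= L &
  bounded_by (\sum_(i < n) a i *: coordinate Y (J i) : dual Y) L.
Proof.
apply: (sum_dual_bounded n a (g := fun i => coordinate Y (J i))) => i.
by exists 1 => //; apply: coordinate_bounded.
Qed.

(** Duality: [F] is [G] composed with the map of [lower_bound], and [G] is [F] composed with the map
    sending a vector [z] to the combination of the [x i] with coefficients [z (J i)] divided by
    [gamma i]. *)
Lemma pair_dual_equivalent :
  equivalent (fun g : dual X => opnorm g) (fun g : dual Y => opnorm g)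
    (fun i => f i) (fun i => coordinate Y (J i)).
Proof.
have C0 : 0 <= CA / delta by rewrite divr_ge0 // ltW.
exists (CB + CA / delta + 1); first by rewrite ltr_wpDl // addr_ge0.
move=> n a; set F := \sum_(i < n) a i *: f i; set G := \sum_(i < n) _.
have [L L0 FL] := functional_sum_bounded n a; have [M M0 GM] := coordinate_sum_bounded n a.
have F0 : 0 <= opnorm F.
  by apply: le_trans (opnorm_ub L0 FL (_ : rnorm 0 <= 1)); rewrite ?rnorm_ge0 ?rnorm0.
have G0 : 0 <= opnorm G.
  by apply: le_trans (opnorm_ub M0 GM (_ : rnorm 0 <= 1)); rewrite ?rnorm_ge0 ?rnorm0.
have Fop := le_opnorm L0 FL (fun a v => dualZ F a v).
have Gop := le_opnorm M0 GM (fun a v => dualZ G a v).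
split.
  apply: (@le_trans _ _ (CB * opnorm G)); last first.
    by rewrite ler_wpM2r // -addrA lerDl addr_ge0.
  apply: opnorm_le; first exact: mulr_ge0.
  apply: dual_bounded_dense => [|v]; first exact: mulr_ge0.
  have -> : F (embed X v) = G (\sum_(i < n) f i (embed X v) *: e i).
    by rewrite (coordinate_sumE n a (fun i => f i (embed X v))) /F (dual_sumE n a (fun i => f i)).
  apply: le_trans (Gop _) _; by rewrite [CB * _]mulrC -mulrA ler_wpM2l.
apply: (@le_trans _ _ (CA / delta * opnorm F)); last first.
  by rewrite ler_wpM2r // addrAC lerDr addr_ge0.
apply: opnorm_le; first exact: mulr_ge0.
apply: dual_bounded_dense => [|z]; first exact: mulr_ge0.
pose b i : K := z (J i) / toK k (gamma i).
have -> : G (embed Y z) = F (\sum_(i < n) b i *: x i).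
  rewrite /F /G (dual_sumE n a (fun i => f i)) (dual_sumE n a (fun i => coordinate Y (J i))).
  apply: eq_bigr => i _; by rewrite (eval_sum b (ltn_ord i)) coordinate_embed // divfK ?toK_gamma_neq0.
apply: le_trans (Fop _) _; rewrite [CA / delta * _]mulrC -mulrA ler_wpM2l //.
apply: le_trans (upper_bound n b) _; rewrite -mulrA ler_wpM2l //.
rewrite -(embed_unit_sum Y J n b) rnorm_embed.
have d0 : 0 <= delta^-1 by rewrite invr_ge0 ltW.
apply: (@le_trans _ _ (delta^-1 * schreier_norm fs rho (unit_sum J n (fun i => z (J i))))).
  apply: unit_sum_mono => // i i_n; rewrite /b rnormM rnormV.
  rewrite (rnorm_toK k (ltW (gamma_gt0 i))) mulrC ler_wpM2r ?rnorm_ge0 //.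
  by rewrite lef_pV2 ?posrE ?gamma_gt0.
by rewrite ler_wpM2l // unit_sum_le.
Qed.

(** The operator is the map of [lower_bound] followed by that of [upper_bound], hence the product of
    the constants. *)
Lemma pair_projections :
  has_ubound (range (fun n => opnorm (\sum_(i < n) rank_one (x i) (f i)))).
Proof.
exists (CA * CB) => _ [n _ <-].
have TE y : (\sum_(i < n) rank_one (x i) (f i)) y = \sum_(i < n) f i y *: x i.
  by rewrite fct_sumE.
apply: opnorm_le; first exact: mulr_ge0.
(* This constant depends on [n]; it only permits the passage from the dense subspace to the
   completion. *)
have [L L0 TL] : exists2 L, 0 <= L & forall y z,
    rnorm (\sum_(i < n) f i y *: x i - \sum_(i < n) f i z *: x i) <= L * rnorm (y - z).
  elim: (n) => [|p [L L0 IH]].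
    by exists 0 => // y z; rewrite !big_ord0 subrr rnorm0 mul0r.
  have [M M0 fM] := dual_combination_bounded (d p).
  exists (L + M * rnorm (x p)); first by rewrite addr_ge0 // mulr_ge0 // rnorm_ge0.
  move=> y z; rewrite !big_ord_recr /= opprD addrACA mulrDl.
  apply: le_trans (rnormD _ _) _; apply: lerD; first exact: IH.
  rewrite -scalerBl rnormZ -dualB mulrAC ler_wpM2r ?rnorm_ge0 //; exact: fM.
apply: (lipschitz_dense L0) => [|y z|v]; first exact: mulr_ge0.
  by rewrite !TE.
rewrite TE -mulrA; apply: le_trans (upper_bound n (fun i => f i (embed X v))) _.
by rewrite ler_wpM2l.
Qed.

End pair.

(** * From weights back to vectors and functionals *)

Section aligned.
Variables (R : realType) (k : scalar_kind) (fs : omega1 -> nat -> omega1).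
Hypothesis fsP : fundamental_system fs.
Local Notation K := (scalars R k).
Implicit Types c d : c00 K.

(** [d] carries the conjugate phases of [c]. *)
Definition aligned d c := forall j, d j * c j = `|d j| * `|c j|.

(** For nonzero [a] this is the conjugate of [a] divided by its modulus, written without conjugation
    so as to serve both scalar fields; it vanishes at zero. *)
Definition phase (a : K^o) : K^o := toK k (rnorm a) / a.

Lemma rnorm_phase (a : K^o) : a != 0 -> rnorm (phase a) = 1.
Proof.
move=> a0; rewrite /phase rnormM rnormV rnorm_toK ?rnorm_ge0 // divff //.
by apply: contra_neq a0; apply: rnorm_eq0.
Qed.

Lemma phaseK (a : K^o) : a != 0 -> phase a * a = toK k (rnorm a).
Proof. by move=> a0; rewrite /phase divfK. Qed.

Lemma dot_supp H d (y : nat -> R) : (forall l, d l != 0 -> (l < H)%N) ->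
  dot H (absw d) y = \sum_(l <- supp d) absw d l * y l.
Proof.
move=> dH; rewrite -(sum_fset_ord (n := H)); last by move=> l; rewrite in_supp; apply: dH.
apply: eq_bigr => l _; case: ifPn => //; rewrite in_supp negbK => /eqP dl.
by rewrite /absw dl rnorm0 mul0r.
Qed.

Lemma toK_sum (I : Type) (s : seq I) (h : I -> R) :
  toK k (\sum_(i <- s) h i) = \sum_(i <- s) toK k (h i).
Proof. by elim/big_rec2: _ => [|i a b _ <-]; rewrite ?toK0 ?toKD. Qed.

(** [hi n] is the last element of the support. Since no support is empty, succession of neighbours
    propagates to all pairs. *)
Lemma blocks_of_successive (c : nat -> c00 K) : (forall n, c n <> 0) ->
  (forall n, successive (c n) (c n.+1)) ->
  exists2 hi : nat -> nat, {homo hi : a b / (a < b)%N} & blocks hi (fun n => absw (c n)).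
Proof.
move=> c0 suc.
have nonempty n : exists l, c n l != 0.
  apply: contrapT => none; apply: (c0 n); apply: c00_ext => l.
  by apply/eqP; apply: contrapT => /negP h; apply: none; exists l.
have lt p n : (p < n)%N -> forall i j, c p i != 0 -> c n j != 0 -> (i < j)%N.
  elim: n => // n IH; rewrite ltnS leq_eqVlt => /predU1P[->|pn] i j ci cj; first exact: suc ci cj.
  have [l cl] := nonempty n.
  exact: ltn_trans (IH pn i l ci cl) (suc n l j cl cj).
have /choice[hi hiP] : forall n, exists h, c n h != 0 /\ forall l, c n l != 0 -> (l <= h)%N.
  move=> n; have [|h] := @fset_maxP (supp (c n)).
    by have [l cl] := nonempty n; apply/fset0Pn; exists l; rewrite in_supp.
  by rewrite in_supp => ch hmax; exists h; split => // l cl; apply: hmax; rewrite in_supp.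
exists hi => [a b ab|n l]; first exact: lt ab _ _ (hiP a).1 (hiP b).1.
rewrite absw_neq0 => cl; split; first exact: (hiP n).2.
by move=> p pn; apply: lt pn _ _ (hiP p).1 cl.
Qed.

Section functionals.
Variables (xi : omega1) (X : completion (@schreier_norm R k fs xi)).

Lemma rnorm_eval_le H d v : (forall l, d l != 0 -> (l < H)%N) ->
  rnorm (combination (coordinate X) d (embed X v)) <= dot H (absw d) (absw v).
Proof.
move=> dH; rewrite combination_coordinate // dot_supp //.
apply: le_trans (rnorm_sum _ _) _; apply: ler_sum => l _.
by rewrite rnormM.
Qed.

Lemma eval_aligned H d c : (forall l, d l != 0 -> (l < H)%N) -> aligned d c ->
  combination (coordinate X) d (embed X c) = toK k (dot H (absw d) (absw c)).
Proof.
move=> dH al; rewrite combination_coordinate // dot_supp // toK_sum.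
by apply: eq_bigr => l _; rewrite al toKM; congr (_ * _); exact: rnormE.
Qed.

Lemma blocks_successive hi (c : nat -> c00 K) :
  blocks hi (fun n => absw (c n)) -> forall n, successive (c n) (c n.+1).
Proof.
move=> bc n i j ci cj; have [ihi _] := bc n i (etrans (absw_neq0 _ _) ci).
have [_ hij] := bc n.+1 j (etrans (absw_neq0 _ _) cj).
exact: leq_ltn_trans ihi (hij n (leqnn _)).
Qed.

End functionals.

(** Alignment turns the whole definition of a Schreier pair into conditions on moduli, which is why
    the two core theorems speak of nonnegative weights only. *)
Lemma aligned_schreier_pair (X : forall xi, completion (@schreier_norm R k fs xi)) xi rho
    (hi J : nat -> nat) (c d : nat -> c00 K) (delta CA CB : R) :
  {homo J : a b / (a < b)%N} -> 0 < delta -> 0 <= CA -> 0 <= CB ->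
  blocks hi (fun n => absw (c n)) -> blocks hi (fun n => absw (d n)) ->
  (forall i, schreier_norm fs xi (c i) = 1) ->
  (forall i, opnorm (combination (coordinate (X xi)) (d i)) = 1) ->
  (forall i, aligned (d i) (c i)) ->
  (forall i, delta <= dot (hi i).+1 (absw (d i)) (absw (c i))) ->
  upper fs xi rho J (fun n => absw (c n)) CA ->
  lower fs xi rho hi J (fun n => absw (d n)) CB ->
  schreier_pair (X := X) rho (fun i => embed (X xi) (c i))
    (fun i => combination (coordinate (X xi)) (d i)).
Proof.
move=> Jh delta0 CA0 CB0 bc bd c1 d1 al gd up low.
have dlt i l : d i l != 0 -> (l < (hi i).+1)%N.
  by rewrite -absw_neq0 => /bd[h _].
pose gamma i := dot (hi i).+1 (absw (d i)) (absw (c i)).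
have diag i : combination (coordinate (X xi)) (d i) (embed (X xi) (c i)) = toK k (gamma i).
  by apply: eval_aligned => // l; apply: dlt.
have off i j : i <> j -> combination (coordinate (X xi)) (d i) (embed (X xi) (c j)) = 0.
  move=> ij; rewrite combination_coordinate // big_seq big1 // => l.
  rewrite in_supp -absw_neq0 => dl; have [cl|] := eqVneq (c j l) 0; first by rewrite cl mulr0.
  rewrite -absw_neq0 => cl; have [lhi lk] := bd i l dl; have [lhj lk'] := bc j l cl.
  case: (ltngtP i j) => // lt; last first.
    by have := leq_trans (lk j lt) lhj; rewrite ltnn.
  by have := leq_trans (lk' i lt) lhi; rewrite ltnn.
have upb n (a : nat -> K) : rnorm (\sum_(i < n) a i *: embed (X xi) (c i)) <=
    CA * rnorm (\sum_(i < n) a i *: Defs.basis (X rho) (J i)).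
  have -> : \sum_(i < n) a i *: embed (X xi) (c i) = embed (X xi) (\sum_(i < n) a i *: c i).
    by rewrite linear_sum; apply: eq_bigr => i _; rewrite linearZ.
  rewrite -(embed_unit_sum (X rho) J n a) !rnorm_embed; apply: schreier_norm_le => E sE.
  apply: le_trans (up n (fun i => rnorm (a i : K^o)) _ _ _ E sE).
  - have -> : \sum_(i < n) rnorm (a i : K^o) * mass E (absw (c i)) =
        \sum_(l <- E) \sum_(i < n) rnorm (a i : K^o) * absw (c i) l.
      by rewrite exchange_big /=; apply: eq_bigr => i _; rewrite /mass mulr_sumr.
    apply: ler_sum => l _; rewrite /absw c00_sum.
    by apply: le_trans (rnorm_sum _ _) _; apply: ler_sum => i _; rewrite c00Z rnormM.
  - by move=> i; apply: rnorm_ge0.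
  - by move=> F Fn sF; rewrite -(mass_unit_sum Jh (n := n) a) //; apply: schreier_norm_sle.
have lob n v : rnorm (\sum_(i < n) combination (coordinate (X xi)) (d i) (embed (X xi) v) *:
    Defs.basis (X rho) (J i)) <= CB * schreier_norm fs xi v.
  rewrite -(embed_unit_sum (X rho) J n (fun i => combination (coordinate (X xi)) (d i) (embed (X xi) v))).
  rewrite rnorm_embed; apply: unit_sum_sle => // F Fn sF.
  apply: le_trans (low (absw v) _ (@absw_nonneg _ _ v) (schreier_norm_sle v) F sF).
  by apply: ler_sum => i _; apply: rnorm_eval_le => l; apply: dlt.
split; [|split].
- split=> [n|]; first by rewrite rnorm_embed.
  split=> [n E0|]; first by have := c1 n; rewrite -(rnorm_embed (X xi)) E0 rnorm0; lra.
  exists c; split=> n; first by rewrite combination_basis.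
  exact: blocks_successive bc n.
- split=> [n|]; first exact: d1.
  split=> [n E0|]; last first.
    by exists d; split=> // n; exact: blocks_successive bd n.
  have : opnorm (0 : dual (X xi)) <= 0 by apply: opnorm_le => // v; rewrite rnorm0 mul0r.
  by rewrite -E0 d1; lra.
exists J; split => //; split.
- exact: off.
- by move=> i; rewrite modulus_eval //; exact: al.
- apply: lt_le_trans delta0 _; apply: lb_le_inf.
    by eexists; exists 0%N.
  by move=> _ [i _ <-]; rewrite diag re_toK; apply: gd.
- split.
  + exact: (pair_equivalent Jh delta0 CA0 CB0 diag gd off upb lob).
  + exact: (pair_dual_equivalent fsP Jh delta0 CA0 CB0 diag gd off upb lob).
  + exact: (pair_projections fsP CA0 CB0 upb lob).
Qed.

Lemma schreier_norm_scale xi r c : 0 <= r ->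
  schreier_norm fs xi (toK k r *: c) = r * schreier_norm fs xi c.
Proof.
move=> r0; have aZ s (b : c00 K) l : 0 <= s -> absw (toK k s *: b) l = s * absw b l.
  by move=> s0; rewrite /absw c00Z rnormM rnorm_toK.
apply/le_anti/andP; split.
  by apply: schreier_norm_mono => // l; rewrite aZ.
have [->|rn0] := eqVneq r 0; first by rewrite mul0r schreier_norm_ge0.
have rp : 0 < r by rewrite lt_neqAle eq_sym rn0.
rewrite -ler_pdivlMl //; apply: schreier_norm_mono => [|l]; first by rewrite invr_ge0.
by rewrite aZ // mulKf.
Qed.

Lemma normalized_block_pair (X : forall xi, completion (@schreier_norm R k fs xi)) xi
    (y : nat -> X xi) : normalized_block y ->
  exists m : nat -> nat, {homo m : a b / (a < b)%N} /\
    exists (f : nat -> dual (X xi)) rho,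
      remainders xi rho /\ schreier_pair (X := X) rho (fun i => y (m i)) f.
Proof.
move=> [y1 [y0 [c [yc suc]]]].
have {}yc n : y n = embed (X xi) (c n) by rewrite yc combination_basis.
have c1 n : schreier_norm fs xi (c n) = 1 by rewrite -(rnorm_embed (X xi)) -yc.
have [|hi hih bc] := blocks_of_successive _ suc.
  by move=> n cn; apply: (y0 n); rewrite yc cn linear0.
have [|n|i|m [J [rho [E [delta [[mh Jh xirho delta0] [sE Ec dE up low]]]]]]] :=
    block_core fsP hih bc (xi := xi).
- by move=> n; apply: absw_nonneg.
- by rewrite -[X in sle _ _ _ X](c1 n); apply: schreier_norm_sle.
- by move=> /schreier_norm_le; rewrite c1; lra.
exists m; split => //.
(* The functional is the indicator of [E i] with the conjugate phases of the block. Its norm is at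
   most one because [E i] belongs to the family [xi], and at least one because [E i] is nonempty. *)
pose d i := c00_of (E i) (fun l => phase (c (m i) l)).
have dE' i l : absw (d i) l = (l \in E i)%:R.
  rewrite /absw /=; case: ifPn => [lE|_]; last exact: rnorm0.
  by rewrite rnorm_phase // -absw_neq0 Ec.
have bd : blocks (hi \o m) (fun i => absw (d i)).
  move=> i l; rewrite dE'; have [lE _|_] := boolP (l \in E i); last by rewrite eqxx.
  exact: (blocks_sub mh bc) (Ec _ _ lE).
have Ehi i l : l \in E i -> (l < (hi (m i)).+1)%N by move=> /Ec/bc[].
have ddot i v : dot (hi (m i)).+1 (absw (d i)) v = mass (E i) v.
  by rewrite -(dot_ind v (Ehi i)); apply: eq_bigr => l _; rewrite dE'.
exists (fun i => combination (coordinate (X xi)) (d i)), rho; split => //.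
have -> : (fun i => y (m i)) = (fun i => embed (X xi) (c (m i))) by apply/funext => i.
apply: (aligned_schreier_pair (hi := hi \o m) (J := J) (delta := delta) (CA := 3%:R) (CB := 1)) => //.
- exact: blocks_sub mh bc.
- move=> i; have lip v : rnorm (combination (coordinate (X xi)) (d i) (embed (X xi) v)) <=
      1 * schreier_norm fs xi v.
    rewrite mul1r; apply: (le_trans (rnorm_eval_le _ _ (H := (hi (m i)).+1) _)).
      by move=> l; rewrite -absw_neq0 => /bd[].
    by rewrite ddot; apply: schreier_norm_sle.
  have bnd := dual_bounded_dense ler01 lip.
  apply/le_anti/andP; split; first exact: opnorm_le bnd.
  have [E0|/fset0Pn[l lE]] := eqVneq (E i) fset0.
    by have := dE i; rewrite E0 mass0 leNgt delta0.
  have := opnorm_ub ler01 bnd (_ : rnorm (embed (X xi) (c00_unit K l)) <= 1).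
  rewrite rnorm_embed schreier_norm_unit // => /(_ (lexx _)); apply: le_trans.
  by rewrite combination_coordinate_unit // -[rnorm _]/(absw (d i) l) dE' lE.
- move=> i l; rewrite /=; case: ifPn => [lE|_]; last by rewrite mul0r normr0 mul0r.
  have cl : c (m i) l != 0 by rewrite -absw_neq0 Ec.
  have n1 : (`|phase (c (m i) l)| : K) = 1.
    have := rnormE (phase (c (m i) l)); rewrite rnorm_phase // toK1 => <- //.
  by rewrite phaseK // n1 mul1r; apply/esym; exact: (rnormE (c (m i) l)).
- by move=> i; rewrite ddot.
- have -> : (fun n => absw (d n)) = (fun i l => (l \in E i)%:R) => //.
  by apply/funext => i; apply/funext => l; rewrite dE'.
Qed.

Lemma normalized_dual_block_pair (X : forall xi, completion (@schreier_norm R k fs xi)) xi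
    (g : nat -> dual (X xi)) : normalized_dual_block g ->
  exists m : nat -> nat, {homo m : a b / (a < b)%N} /\
    exists (x : nat -> X xi) rho,
      remainders xi rho /\ schreier_pair (X := X) rho x (fun i => g (m i)).
Proof.
move=> [g1 [g0 [d [gd suc]]]].
have [|hi hih bd] := blocks_of_successive _ suc.
  move=> n dn; apply: (g0 n); rewrite gd dn.
  rewrite /combination (fsbig_finite _ _ (finite_support _)) big1 // => j _.
  by rewrite -[LHS]/((0 : K) *: coordinate (X xi) j) scale0r.
have dlt i l : d i l != 0 -> (l < (hi i).+1)%N.
  by rewrite -absw_neq0 => /bd[h _].
have gev i v : rnorm (g i (embed (X xi) v)) <= dot (hi i).+1 (absw (d i)) (absw v).
  by rewrite gd; apply: rnorm_eval_le; apply: dlt.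
(* The weight [v] is turned into a vector carrying the conjugate phases of [d i], cut off to its
   support. *)
pose twist i (v : nat -> R) := c00_of (supp (d i)) (fun l => toK k (v l) * phase (d i l)).
have twist_w i v l : nonneg v -> d i l != 0 -> absw (twist i v) l = v l.
  by move=> v0 dl; rewrite /absw /= in_supp dl rnormM rnorm_toK // rnorm_phase // mulr1.
have twist_0 i v l : d i l == 0 -> twist i v l = 0 by rewrite /= in_supp => ->.
have twist_al i v : nonneg v -> aligned (d i) (twist i v).
  move=> v0 l; have [dl|dl] := eqVneq (d i l) 0; first by rewrite dl mul0r normr0 mul0r.
  have -> : (`|twist i v l| : K) = toK k (v l).
    by have := rnormE (twist i v l); rewrite -[rnorm _]/(absw (twist i v) l) twist_w // => <-.
  have -> : (`|d i l| : K) = toK k (rnorm (d i l)) by rewrite -(rnormE (d i l)).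
  by rewrite /= in_supp dl mulrCA [d i l * _]mulrC phaseK // mulrC.
have twist_dot i v : nonneg v ->
    dot (hi i).+1 (absw (d i)) (absw (twist i v)) = dot (hi i).+1 (absw (d i)) v.
  move=> v0; apply: eq_bigr => l _; have [dl|dl] := eqVneq (d i l) 0.
    by rewrite /absw dl rnorm0 !mul0r.
  by rewrite twist_w.
have twist_le i v t : nonneg v -> sle fs xi v t -> schreier_norm fs xi (twist i v) <= t.
  move=> v0 vt; apply: schreier_norm_le; apply: sle_mono vt => l.
  have [dl|dl] := eqVneq (d i l) 0; last by rewrite twist_w.
  by rewrite /absw twist_0 ?dl // rnorm0.
have gbound i : exists2 L, 0 <= L & bounded_by (g i : X xi -> K^o) L.
  by rewrite gd; apply: dual_combination_bounded.
(* On the twisted vector the functional takes the value of the pairing of moduli, so its norm one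
   bounds this pairing. *)
have dot_le i v t : nonneg v -> sle fs xi v t -> dot (hi i).+1 (absw (d i)) v <= t.
  move=> v0 vt; rewrite -twist_dot //.
  have ge0 : 0 <= dot (hi i).+1 (absw (d i)) (absw (twist i v)).
    by apply: sumr_ge0 => l _; rewrite mulr_ge0 ?absw_nonneg.
  rewrite -(rnorm_toK k ge0) -(eval_aligned (X xi) (dlt i) (twist_al i v v0)) -gd.
  have [L L0 gL] := gbound i.
  apply: le_trans (le_opnorm L0 gL (fun a u => dualZ (g i) a u) _) _.
  by rewrite g1 mul1r rnorm_embed twist_le.
(* Otherwise the functional would be bounded by 1/2, contradicting its norm one. *)
have dot_ge i : exists v, [/\ nonneg v, sle fs xi v 1 & 1/2%:R <= dot (hi i).+1 (absw (d i)) v].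
  apply: contrapT => none; have half v : rnorm (g i (embed (X xi) v)) <= 1/2%:R * schreier_norm fs xi v.
    apply: le_trans (gev i v) _.
    have [n0|nn0] := eqVneq (schreier_norm fs xi v) 0.
      rewrite n0 mulr0; apply: dot_le; first exact: absw_nonneg.
      by rewrite -n0; apply: schreier_norm_sle.
    have np : 0 < schreier_norm fs xi v by rewrite lt_neqAle eq_sym nn0 schreier_norm_ge0.
    rewrite leNgt; apply/negP => lt; apply: none.
    exists (fun l => (schreier_norm fs xi v)^-1 * absw v l); split.
    - move=> l; apply: mulr_ge0; last exact: absw_nonneg.
      by rewrite invr_ge0 ltW.
    - rewrite -(mulVf nn0); apply: sle_scale; first by rewrite invr_ge0 ltW.
      exact: schreier_norm_sle.
    - by rewrite dotZ ler_pdivlMl // mulrC ltW.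
  have half0 : 0 <= 1/2%:R :> R by rewrite divr_ge0.
  have := opnorm_le half0 (dual_bounded_dense half0 half).
  by rewrite g1; lra.
have [|m [J [rho [v [delta [[mh Jh xirho delta0] [[v0 vd v1 dv] [up low]]]]]]]] :=
    dual_core fsP hih bd _ dot_le dot_ge.
  by move=> i; apply: absw_nonneg.
exists m; split => //.
(* The test vectors have norms between [delta] and 1. Normalizing them does not decrease the
   pairings and multiplies the upper constant by at most the inverse of [delta]. *)
pose n i := schreier_norm fs xi (twist (m i) (v i)).
have n_ge i : delta <= n i.
  apply: le_trans (dv i) _; rewrite -twist_dot //.
  by apply: dot_le; [exact: absw_nonneg|exact: schreier_norm_sle].
have np i : 0 < n i by apply: lt_le_trans (n_ge i).
have ni i : 0 <= (n i)^-1 by rewrite invr_ge0 ltW.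
pose c i := toK k (n i)^-1 *: twist (m i) (v i).
have cw i l : absw (c i) l = (n i)^-1 * v i l.
  rewrite /absw /c c00Z rnormM rnorm_toK //; congr (_ * _).
  have [dl|dl] := eqVneq (d (m i) l) 0; last by rewrite -[LHS]/(absw _ l) twist_w.
  rewrite twist_0 ?dl // rnorm0; apply/esym/eqP; apply: contrapT => /negP/vd.
  by rewrite absw_neq0 dl eqxx.
exists (fun i => embed (X xi) (c i)), rho; split => //.
have -> : (fun i => g (m i)) = (fun i => combination (coordinate (X xi)) (d (m i))).
  by apply/funext => i; rewrite gd.
apply: (aligned_schreier_pair (hi := hi \o m) (J := J) (delta := delta)
  (CA := 3%:R / delta) (CB := 8%:R)) => //.
- by rewrite divr_ge0 // ltW.
- move=> i l; rewrite cw => cl; apply: (blocks_sub mh bd) => /=; apply: vd.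
  by apply: contra_neq cl => ->; rewrite mulr0.
- exact: blocks_sub mh bd.
- by move=> i; rewrite schreier_norm_scale // mulVf // gt_eqF.
- by move=> i; rewrite -gd.
- move=> i l; rewrite c00Z mulrCA (twist_al (m i) _ (v0 i) l) normrM mulrCA.
  by rewrite norm_toK.
- move=> i; have -> : absw (c i) = (fun l => (n i)^-1 * v i l) by apply/funext => l.
  rewrite dotZ; apply: le_trans (dv i) _; rewrite ler_peMl //.
    by apply: le_trans (dv i); apply: ltW.
  by rewrite invf_ge1 // twist_le.
- move=> p b t b0 bt A sA.
  have -> : \sum_(i < p) b i * mass A (absw (c i)) =
      \sum_(i < p) (b i / n i) * mass A (v i).
    apply: eq_bigr => i _; rewrite -mulrA; congr (_ * _).
    by rewrite /mass mulr_sumr; apply: eq_bigr => l _.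
  rewrite -mulrA; apply: (up p (fun i => b i / n i) (delta^-1 * t)) sA => [i|F Fp sF].
    by rewrite divr_ge0 // ltW.
  apply: (@le_trans _ _ (\sum_(i <- F) delta^-1 * b i)).
    by apply: ler_sum => i _; rewrite mulrC ler_wpM2r // lef_pV2 ?posrE.
  by rewrite -mulr_sumr ler_pM2l ?invr_gt0 //; apply: bt.
Qed.

End aligned.

Theorem theorem1p1 (R : realType) (k : scalar_kind)
  (fs : omega1 -> nat -> omega1) (fs_fundamental : fundamental_system fs)
  (X : forall xi : omega1, completion (@schreier_norm R k fs xi))
  (xi : omega1) :
  (forall y : nat -> X xi, normalized_block y ->
     exists m : nat -> nat, {homo m : a b / (a < b)%N} /\
     exists (f : nat -> dual (X xi)) (rho : omega1),
       remainders xi rho /\ schreier_pair (X := X) rho (fun i => y (m i)) f) /\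
  (forall g : nat -> dual (X xi), normalized_dual_block g ->
     exists m : nat -> nat, {homo m : a b / (a < b)%N} /\
     exists (x : nat -> X xi) (rho : omega1),
       remainders xi rho /\ schreier_pair (X := X) rho x (fun i => g (m i))).
Proof.
by split=> z nz; [exact: normalized_block_pair|exact: normalized_dual_block_pair].
Qed.
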